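(* Let $\Omega\subset\mathbb{R}^3$ be a smooth domain containing the origin, and let $u\in C^1(\Omega\setminus\{0\},\mathbb{R}^3)$ satisfy $\operatorname{div} u\equiv 0$ on $\Omega\setminus\{0\}$. Suppose that for some $\alpha>0$ with $\overline{B_\alpha}\subset\Omega$ there are constants $C>0$ and $\epsilon\in(0,\alpha)$ such that $$\left|\int_{A_r^{\alpha}} u\cdot\hat n\,d\sigma\right|\ \ge\ C\,r^{1/2}\qquad\text{for all } 0<r\le\epsilon .$$ Then $u\notin L^2(\Omega)$, i.e. $\int_\Omega |u|^2\,dx=\infty$.
   Context: $B_\rho$ denotes the open ball of radius $\rho$ centered at the origin in $\mathbb{R}^3$, $\hat n(x)=x/|x|$ for $x\neq 0$, and $d\sigma$ is surface measure. Streamlines: for $\eta\in\Omega\setminus\{0\}$, the streamline $\gamma_\eta$ is the (maximal) solution curve in $\Omega\setminus\{0\}$ of $\partial_s\gamma_\eta(s)=u(\gamma_\eta(s))$ for $s>0$, with $\gamma_\eta(0)=\eta$. For $0<r<\alpha$, $$A_r^\alpha=\{\eta\in\partial B_\alpha:\ \gamma_\eta(s)\in B_r\text{ for some }s>0,\ \text{and}\ \gamma_\eta(s')\in B_\alpha\text{ for }0<s'<s\},$$ where it is understood that $\gamma_\eta$ is defined on $[0,s]$. At points of $A_r^\alpha$ one has $u\cdot\hat n\le 0$. The integral over $A_r^\alpha$ is understood as the integral over $\{\eta\in A_r^\alpha:(u\cdot\hat n)(\eta)\neq0\}$. *)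

(* Defs.v *)
From HB Require Import structures.
From mathcomp Require Import all_boot all_order all_algebra.
From mathcomp Require Import all_classical all_reals all_analysis.

Set Implicit Arguments.
Unset Strict Implicit.
Unset Printing Implicit Defensive.

Import Order.TTheory GRing.Theory Num.Theory.
Import numFieldNormedType.Exports.

Local Open Scope classical_set_scope.
Local Open Scope ring_scope.

(* R^3 is 'rV[R]_3. The library norm on it is the sup norm and is used only for
   its topology; lengths are measured with the Euclidean norm enorm. *)

Definition dot (R : realType) (x y : 'rV[R]_3) : R :=
  \sum_(i < 3) x ord0 i * y ord0 i.

Definition enorm (R : realType) (x : 'rV[R]_3) : R := Num.sqrt (dot x x).

Definition eball (R : realType) (rho : R) : set 'rV[R]_3 :=
  [set x | enorm x < rho].

Definition esphere (R : realType) (rho : R) : set 'rV[R]_3 :=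
  [set x | enorm x = rho].

Definition nhat (R : realType) (x : 'rV[R]_3) : 'rV[R]_3 :=
  (enorm x)^-1 *: x.

Definition e_ (R : realType) (i : 'I_3) : 'rV[R]_3 := delta_mx ord0 i.

(* f is of class C^k on the open set U. *)
Fixpoint Ck (R : realType) (V : normedModType R) (k : nat) (U : set 'rV[R]_3)
    (f : 'rV[R]_3 -> V) : Prop :=
  (forall x, U x -> {for x, continuous f}) /\
  if k is k'.+1 then
    forall i : 'I_3, (forall x, U x -> derivable f x (e_ R i)) /\
                     Ck k' U (fun x => 'D_(e_ R i) f x)
  else True.

Definition divergence (R : realType) (u : 'rV[R]_3 -> 'rV[R]_3)
    (x : 'rV[R]_3) : R :=
  \sum_(i < 3) ('D_(e_ R i) u x) ord0 i.

(* A domain with C^oo boundary: near each boundary point, Omega is the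
   sublevel set of a C^oo function with non-vanishing gradient. *)
Definition smooth_domain (R : realType) (Omega : set 'rV[R]_3) : Prop :=
  [/\ open Omega, connected Omega &
    forall p, (closure Omega `\` interior Omega) p ->
      exists (U : set 'rV[R]_3) (rho : 'rV[R]_3 -> R^o),
        [/\ open U, U p, (forall k, Ck k U rho),
            (forall x, U x -> exists i : 'I_3, 'D_(e_ R i) rho x != 0) &
            (forall x, U x -> (Omega x <-> rho x < 0))]].

(* gam solves the streamline equation on [0, T[, T possibly +oo; the values of
   gam outside [0, T[ are irrelevant. *)
Definition solves_streamline (R : realType) (Omega : set 'rV[R]_3)
    (u : 'rV[R]_3 -> 'rV[R]_3) (eta : 'rV[R]_3) (T : \bar R)
    (gam : R -> 'rV[R]_3) : Prop :=
  [/\ (0%:E < T)%E,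
      gam 0 = eta,
      (forall s : R, 0 <= s -> (s%:E < T)%E -> (Omega `\ 0) (gam s)),
      {within [set s : R | 0 <= s /\ (s%:E < T)%E], continuous gam} &
      (forall s : R, 0 < s -> (s%:E < T)%E ->
         is_derive s (1 : R) gam (u (gam s)))].

Definition streamline (R : realType) (Omega : set 'rV[R]_3)
    (u : 'rV[R]_3 -> 'rV[R]_3) (eta : 'rV[R]_3) (T : \bar R)
    (gam : R -> 'rV[R]_3) : Prop :=
  solves_streamline Omega u eta T gam /\
  forall (T' : \bar R) (gam' : R -> 'rV[R]_3),
    solves_streamline Omega u eta T' gam' ->
    (T <= T')%E ->
    (forall s : R, 0 <= s -> (s%:E < T)%E -> gam' s = gam s) ->
    T' = T.

(* A_r^alpha: the points of the sphere of radius alpha whose streamline enters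
   the ball of radius r before leaving the ball of radius alpha. *)
Definition entry_set (R : realType) (Omega : set 'rV[R]_3)
    (u : 'rV[R]_3 -> 'rV[R]_3) (alpha r : R) : set 'rV[R]_3 :=
  [set eta | esphere alpha eta /\
    exists (T : \bar R) (gam : R -> 'rV[R]_3),
      streamline Omega u eta T gam /\
      exists s : R,
        [/\ 0 < s, (s%:E < T)%E, eball r (gam s) &
            forall s' : R, 0 < s' -> s' < s -> eball alpha (gam s')]].

Definition vec3 (R : realType) (p : R * R * R) : 'rV[R]_3 :=
  \row_(i < 3) [:: p.1.1; p.1.2; p.2]`_i.

(* Lebesgue integral over D of a function on R^3. *)
Definition integral3 (R : realType) (D : set 'rV[R]_3)
    (f : 'rV[R]_3 -> \bar R) : \bar R :=
  (\int[lebesgue_measure \x lebesgue_measure \x lebesgue_measure]_(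
     p in @vec3 R @^-1` D) f (vec3 p))%E.

(* Spherical coordinates p = (polar angle, azimuth). *)
Definition sph (R : realType) (rho : R) (p : R * R) : 'rV[R]_3 :=
  vec3 (rho * (sin p.1 * cos p.2), rho * (sin p.1 * sin p.2), rho * cos p.1).

(* Integral of f over the part A of the sphere of radius rho with respect to
   surface measure, d sigma = rho^2 sin(polar) d(polar) d(azimuth). *)
Definition sphere_integral (R : realType) (rho : R) (A : set 'rV[R]_3)
    (f : 'rV[R]_3 -> R) : \bar R :=
  (\int[lebesgue_measure \x lebesgue_measure]_(
     p in (`[0%R, pi%R] `*` `[0%R, (pi *+ 2)%R]) `&` (sph rho @^-1` A))
     (f (sph rho p) * (rho ^+ 2 * sin p.1))%:E)%E.

(* Main.v *)
Require Import Defs.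
From HB Require Import structures.
From mathcomp Require Import all_boot all_order all_algebra.
From mathcomp Require Import all_classical all_reals all_analysis.
From mathcomp Require Import measurable_realfun ring lra.
Set Implicit Arguments.
Unset Strict Implicit.
Unset Printing Implicit Defensive.
Import Order.TTheory GRing.Theory Num.Theory.
Import numFieldNormedType.Exports.
Local Open Scope classical_set_scope.
Local Open Scope ring_scope.

(** The flux that enters the ball of radius [alpha] along the streamlines of the
    entry set has to cross the shell between the radii [r] and [2 * r], because
    [u] has no divergence and these streamlines reach the ball of radius [r]. A
    field whose flux through that shell is [F] has energy of order at least
    [F ^+ 2 / r] in it. When [F] is at least [C * sqrt r] this is a constant
    independent of [r] ([flux_energy]), and infinitely many disjoint dyadic
    shells give an infinite integral ([shells_energy]).

    The work lies in the flux inequality [entry_flux_le]: the integral over the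
    entry set is bounded by the integral of [2 * |x.u| * inner (|x|^2)], where
    [inner] is a bump of mass one supported in the shell. The entry set may be
    irregular, so that no tube of streamlines is formed. It is tested instead
    with continuous functions psi_m ([reaching]) that approximate the indicator of
    the points that flow into the ball of radius [r] before they leave the ball of
    radius [alpha].

    These functions come from a discrete flow. A [step] composes three shears,
    each along one coordinate, so that the weak form of the continuity equation
    ([step_weak]) follows from substitutions on the real line. As psi_m does not
    decrease along a step outside the small ball, testing this equation against a
    function of the radius that vanishes in the small ball and outside the large
    one bounds the inward flux of psi_m through a thin outer shell by the one
    through the inner shell, up to the outward flux through the outer shell
    ([flux_step]). The latter disappears in the limit because orbits that start
    there with outward velocity leave at once ([reaching_exit]). On the other
    hand, the orbits of the discrete flow converge to streamlines
    ([euler_tracking]), so that psi_m is eventually 1 at each point of a short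
    inward normal segment wherever the entry set has nonzero normal velocity
    ([reaching_near_streamline]). In spherical coordinates
    ([integral_spherical]), Fatou's lemma then turns the integral over the outer
    shell into the surface integral ([tube_flux]).

    Since [u] is singular at the origin and given on Omega only, it is first
    replaced by a compactly supported field that agrees with it where the
    argument takes place ([cutoff_field]). *)

(** * Continuity and measurability on products *)

Notation leb := (@lebesgue_measure _).
Notation mu3 := (leb \x leb \x leb)%E.
Notation R3 R := (R * R * R)%type.
Notation mR R := (measurableTypeR R).
Notation mR2 R := (measurableTypeR R * measurableTypeR R)%type.
Notation mR3 R := (measurableTypeR R * measurableTypeR R * measurableTypeR R)%type.

Section continuity.
Context {T U V : topologicalType} {R : realType}.

Lemma continuous_pair (f : T -> U) (g : T -> V) :
  continuous f -> continuous g -> continuous (fun x => (f x, g x)).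
Proof. by move=> cf cg x; apply: cvg_pair => /=; [exact: cf|exact: cg]. Qed.

Lemma continuous_comp_all (f : T -> U) (g : U -> V) :
  continuous f -> continuous g -> continuous (fun x => g (f x)).
Proof. by move=> cf cg x; exact: (continuous_comp (cf x) (cg (f x))). Qed.

Lemma continuous_fst_all (f : T -> U * V) :
  continuous f -> continuous (fun x => (f x).1).
Proof. by move=> cf x; apply: cvg_comp; [exact: cf|exact: cvg_fst]. Qed.

Lemma continuous_snd_all (f : T -> U * V) :
  continuous f -> continuous (fun x => (f x).2).
Proof. by move=> cf x; apply: cvg_comp; [exact: cf|exact: cvg_snd]. Qed.

Lemma continuous_add (f g : T -> R) :
  continuous f -> continuous g -> continuous (fun x => f x + g x).
Proof. by move=> cf cg x; apply: cvgD; [exact: cf|exact: cg]. Qed.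

Lemma continuous_mul (f g : T -> R) :
  continuous f -> continuous g -> continuous (fun x => f x * g x).
Proof. by move=> cf cg x; apply: cvgM; [exact: cf|exact: cg]. Qed.

Lemma continuous_opp (f : T -> R) :
  continuous f -> continuous (fun x => - f x).
Proof. by move=> cf x; apply: cvgN; exact: cf. Qed.

Lemma continuous_sqr (f : T -> R) :
  continuous f -> continuous (fun x => f x ^+ 2).
Proof.
by move=> cf; under [X in continuous X]eq_fun do rewrite expr2; exact: continuous_mul.
Qed.

Lemma continuous_min_all (f g : T -> R) :
  continuous f -> continuous g -> continuous (fun x => Num.min (f x) (g x)).
Proof. by move=> cf cg x; apply: continuous_min; [exact: cf|exact: cg]. Qed.

Lemma continuous_max_all (f g : T -> R) :
  continuous f -> continuous g -> continuous (fun x => Num.max (f x) (g x)).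
Proof. by move=> cf cg x; apply: continuous_max; [exact: cf|exact: cg]. Qed.

Lemma continuous_norm_all (f : T -> R) :
  continuous f -> continuous (fun x => `|f x|).
Proof. by move=> cf x; apply: (cvg_norm (cf x)). Qed.

Lemma continuous_id_all : continuous (fun x : T => x).
Proof. by move=> x; exact: cvg_id. Qed.

Lemma continuous_cst_all (u : U) : continuous (fun x : T => u).
Proof. by move=> x; exact: cvg_cst. Qed.

End continuity.

Ltac continuity := repeat match goal with
  | H : continuous ?f |- continuous ?f => exact: H
  | |- continuous (fun x => x) => exact: continuous_id_all
  | |- continuous (fun _ => ?c) => exact: continuous_cst_all
  | |- continuous (fun x => (@?f x, @?g x)) => apply: (@continuous_pair _ _ _ f g)
  | |- continuous (fun x => fst (@?f x)) => apply: (@continuous_fst_all _ _ _ f)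
  | |- continuous (fun x => snd (@?f x)) => apply: (@continuous_snd_all _ _ _ f)
  | |- continuous (fun x => (@?f x + @?g x)%R) => apply: (@continuous_add _ _ f g)
  | |- continuous (fun x => (@?f x * @?g x)%R) => apply: (@continuous_mul _ _ f g)
  | |- continuous (fun x => (- @?f x)%R) => apply: (@continuous_opp _ _ f)
  | |- continuous (fun x => (@?f x ^+ 2)%R) => apply: (@continuous_sqr _ _ f)
  | |- continuous (fun x => Num.min (@?f x) (@?g x)) => apply: (@continuous_min_all _ _ f g)
  | |- continuous (fun x => Num.max (@?f x) (@?g x)) => apply: (@continuous_max_all _ _ f g)
  | |- continuous (fun x => `| @?f x |%R) => apply: (@continuous_norm_all _ _ f)
  | H : continuous ?g |- continuous (fun x => ?g (@?f x)) =>
      apply: (@continuous_comp_all _ _ _ f g); [|exact: H]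
  end.

Section measurability.
Context {R : realType}.

(** Rounding the second variable down to a grid gives measurable functions that
    converge to [f]. This is how continuous functions on a product are seen to
    be measurable, the sigma-algebra there being generated by rectangles. *)
Lemma measurable_caratheodory d (T : measurableType d) (f : T * mR R -> R) :
  (forall z, measurable_fun [set: T] (fun x => f (x, z))) ->
  (forall x, continuous (fun z : R => f (x, z))) ->
  measurable_fun [set: T * mR R] f.
Proof.
move=> mf cf.
pose a (n : nat) (z : R) : R := (Num.floor (n.+1%:R * z))%:~R / n.+1%:R.
apply: (@measurable_fun_cvg _ _ _ _ (fun n p => f (p.1, a n p.2))).
- move=> n _ B mB; rewrite setTI.
  have -> : (fun p : T * mR R => f (p.1, a n p.2)) @^-1` B =
      \bigcup_(k : int) ([set x | B (f (x, k%:~R / n.+1%:R))] `*`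
        (`[k%:~R / n.+1%:R, (k + 1)%:~R / n.+1%:R[)%classic).
    apply/seteqP; split => [[x z]/= Bxz|[x z]/= [k _ /=[Bk]]].
      exists (Num.floor (n.+1%:R * z)) => //=; split => //.
      rewrite in_itv/= ler_pdivrMr// ltr_pdivlMr// mulrC.
      by rewrite ge_floor/= floorD1_gt.
    rewrite in_itv/= ler_pdivrMr// ltr_pdivlMr// => /andP[kz zk].
    rewrite /a; suff -> : Num.floor (n.+1%:R * z) = k by [].
    by apply: floor_def; rewrite mulrC kz zk.
  apply: countable_bigcupT_measurable => // k.
  apply: measurableX; last exact: measurable_itv.
  by rewrite -[X in measurable X]setTI; apply: mf.
- move=> [x z] _ /=.
  have az : a n z @[n --> \oo] --> z.
    apply/cvgrPdist_le => e e0; near=> n.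
    have n0 : 0 < n.+1%:R :> R by [].
    rewrite /a ger0_norm; last first.
      by rewrite subr_ge0 ler_pdivrMr// mulrC ge_floor.
    rewrite lerBlDr -(ler_pM2l n0) mulrDr [n.+1%:R * (_ / _)]mulrC divfK ?gt_eqF//.
    apply: ltW; apply: lt_le_trans (floorD1_gt _) _.
    rewrite intrD addrC lerD2r mulr1z.
    have : e^-1 <= n.+1%:R :> R.
      apply: (@le_trans _ _ n%:R); last by rewrite ler_nat.
      by near: n; exact: nbhs_infty_ger.
    by move=> ?; rewrite mulrC -ler_pdivrMl// mulr1.
  exact: (@cvg_comp _ _ _ (fun n => a n z) (fun z => f (x, z)) _ _ _ az (cf x z)).
Unshelve. all: by end_near. Qed.

Lemma continuous_measurable2 (f : R * R -> R) : continuous f ->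
  measurable_fun [set: mR2 R] f.
Proof.
move=> cf; apply: measurable_caratheodory => [z|x]; last by continuity.
by apply: continuous_measurable_fun; continuity.
Qed.

Lemma continuous_measurable3 (f : R3 R -> R) : continuous f ->
  measurable_fun [set: mR3 R] f.
Proof.
move=> cf; apply: measurable_caratheodory => [z|x]; last by continuity.
by apply: continuous_measurable2; continuity.
Qed.

End measurability.

Section product_of_lebesgue.
Context {R : realType}.

(** A copy of the product measure that carries a sigma-finiteness instance, as
    Tonelli's theorem in space asks for it. *)
Definition leb2 : set (mR2 R) -> \bar R := (leb \x leb)%E.

HB.instance Definition _ := Measure.copy leb2 (leb \x leb)%E.

Lemma leb2_sigma_finite : sigma_finite [set: mR2 R] leb2.
Proof.
exists (fun n => `[- n%:R, n%:R] `*` `[- n%:R, n%:R]).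
  apply/esym; rewrite -subTset => -[x y] _.
  have [n /andP[xn yn]] : exists n : nat, (`|x| <= n%:R) && (`|y| <= n%:R).
    exists (Num.truncn (Num.max `|x| `|y|)).+1; rewrite -ge_max.
    exact/ltW/truncnS_gt.
  by exists n => //=; rewrite !in_itv/= -!ler_norml xn yn.
move=> n; split; first by apply: measurableX; exact: measurable_itv.
rewrite /leb2 product_measure1E//=; apply: lte_mul_pinfty => //.
  by rewrite ge0_fin_numE//= lebesgue_measure_itv; case: ifPn => _; rewrite ltry.
by rewrite lebesgue_measure_itv; case: ifPn => _; rewrite ltry.
Qed.

HB.instance Definition _ := Measure_isSigmaFinite.Build _ _ _ leb2 leb2_sigma_finite.

End product_of_lebesgue.

(** * Integrals of compactly supported functions *)

(** The space C_c of continuous functions with compact support. *)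
Definition cc {R : realType} (f : R3 R -> R) : Prop :=
  continuous f /\ exists M, forall p, M < `|p| -> f p = 0.

Section compactly_supported.
Context {R : realType}.
Implicit Types f g : R3 R -> R.

Lemma box_compact (M : R) : compact [set p : R3 R | `|p| <= M].
Proof.
have -> : [set p : R3 R | `|p| <= M] =
  (`[-M, M] `*` `[-M, M] `*` `[-M, M])%classic.
  apply/seteqP; split => -[[x y] z]/=; rewrite !prod_normE/= !in_itv/= !ge_max !ler_norml.
    by move=> /andP[/andP[-> ->] ->].
  by move=> [[-> ->] ->].
by apply: compact_setX; [apply: compact_setX|]; exact: segment_compact.
Qed.

Lemma cc_bounded f : cc f -> exists B : R, 0 < B /\ forall p, `|f p| <= B.
Proof.
move=> [cf [M fM]].
have /compact_bounded[B [Br fB]] : compact (f @` [set p : R3 R | `|p| <= M]).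
  by apply: continuous_compact; [exact: continuous_subspaceT|exact: box_compact].
have B1 : B < `|B| + 1 by rewrite (le_lt_trans (ler_norm B))// ltrDl.
exists (`|B| + 1); split => [|p]; first by rewrite ltr_wpDl.
have [pM|Mp] := leP `|p| M; last by rewrite fM// normr0 addr_ge0.
by apply: (fB _ B1); exists p.
Qed.

Lemma cc_unif f : cc f -> forall e : R, 0 < e -> exists d, 0 < d /\
  forall p q, `|p - q| < d -> `|f p - f q| < e.
Proof.
move=> [cf [M fM]] e e0.
have /compact_near_coveringP := @box_compact (M + 1).
move=> /(_ _ (0:R)^'+ (fun d p => forall q, `|p - q| < d -> `|f p - f q| < e)).
case.
  move=> p _; have := cf p => /cvgrPdist_lt/(_ _ (divr_gt0 e0 (ltr0n R 2)))/=.
  move=> /nbhs_ballP[d /= d0 has_partial]; rewrite prod_norm_ball /= in has_partial.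
  exists (ball p (d / 2), [set d' | d' < d / 2]).
    split => /=; first by apply: nbhsx_ballx; rewrite divr_gt0.
    by apply: nbhs_right_lt; rewrite divr_gt0.
  move=> [p' d']/= []; rewrite prod_norm_ball /= => pp' dd' q p'q.
  have : `|f p - f p'| < e / 2.
    by apply: has_partial; rewrite /ball_/= (lt_le_trans pp')// ler_pdivrMr// ler_pMr// ler1n.
  have : `|f p - f q| < e / 2.
    apply: has_partial; rewrite /ball_/= -(subrK p' p) -addrA (le_lt_trans (ler_normD _ _))//.
    by rewrite [ltRHS](splitr d) ltrD// (lt_trans p'q).
  move=> H1 H2; rewrite -(subrK (f p) (f p')) -addrA (le_lt_trans (ler_normD _ _))//.
  by rewrite [ltRHS](splitr e) ltrD// distrC.
move=> d /= d0 dP.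
pose d1 := Num.min (d / 2) 1.
have d10 : 0 < d1 by rewrite lt_min divr_gt0/=.
exists d1; split => // p q pq.
have [pM|Mp] := leP `|p| (M + 1).
  apply: (dP d1) => //=; rewrite sub0r normrN gtr0_norm// /d1.
  by rewrite gt_min ltr_pdivrMr// ltr_pMr// ltr1n.
have pq1 : `|p - q| < 1 by rewrite (lt_le_trans pq)// ge_min lexx orbT.
rewrite !fM ?subrr ?normr0//.
  have := ler_distD q p 0; rewrite !subr0 => H.
  by rewrite -(ltrD2r 1) (lt_le_trans Mp)// (le_trans H)// addrC lerD2l ltW.
by rewrite (lt_trans _ Mp)// ltrDl.
Qed.

Lemma cc_measurable f : continuous f -> measurable_fun [set: mR3 R] (EFin \o f).
Proof. by move=> cf; apply/measurable_EFinP; exact: continuous_measurable3. Qed.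

Definition box (M : R) : set (R3 R) := (`[-M, M] `*` `[-M, M] `*` `[-M, M])%classic.

Lemma measurable_box M : measurable (box M : set (mR3 R)).
Proof. by apply: measurableX; [apply: measurableX|]; exact: measurable_itv. Qed.

Lemma mu3_box M : 0 <= M -> (mu3 (box M) = ((M *+ 2) ^+ 3)%:E)%E.
Proof.
move=> M0; rewrite product_measure1E//=; [|exact: measurableX].
rewrite product_measure1E//=.
have -> : leb [set` `[- M, M]] = (M *+ 2)%:E.
  rewrite lebesgue_measure_itv/= lte_fin; move: M0; rewrite le_eqVlt => /predU1P[<-|M0].
    by rewrite oppr0 ltxx mul0rn.
  by rewrite ifT ?gtrN// -EFinB opprK mulr2n.
by rewrite -!EFinM exprS expr2 mulrA.
Qed.

Lemma box_norm M p : box M p <-> `|p| <= M.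
Proof.
case: p => -[x y] z; rewrite /box/= !prod_normE/= !in_itv/= !ge_max !ler_norml.
split; first by move=> [[-> ->] ->].
by move=> /andP[/andP[-> ->] ->].
Qed.

Lemma cc_integrable f : cc f -> mu3.-integrable [set: mR3 R] (EFin \o f).
Proof.
move=> fcc; have [B [B0 fB]] := cc_bounded fcc.
have [cf [M fM]] := fcc.
have -> : EFin \o f = (EFin \o f) \_ (box `|M|).
  apply/funext => p; rewrite patchE; case: ifPn => //.
  rewrite notin_setE => pM /=; rewrite fM// ltNge; apply/negP => H.
  by apply: pM; apply/box_norm; rewrite (le_trans H)// ler_norm.
apply/integrable_restrict => //; first exact: measurable_box.
rewrite setTI; apply: measurable_bounded_integrable.
- exact: measurable_box.
- by have := mu3_box (normr_ge0 M); rewrite /= => ->; rewrite ltry.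
- apply: measurable_funTS; exact: continuous_measurable3.
- exists B; split; first by rewrite num_real.
  by move=> x Bx p _; exact: le_trans (fB p) (ltW Bx).
Qed.

End compactly_supported.

(** * Coordinates *)

Definition crd {R : realType} (i : 'I_3) (p : R3 R) : R :=
  match val i with 0%N => p.1.1 | 1%N => p.1.2 | _ => p.2 end.

Definition rest {R : realType} (i : 'I_3) (p : R3 R) : R * R :=
  match val i with 0%N => (p.1.2, p.2) | 1%N => (p.1.1, p.2) | _ => p.1 end.

Definition ins {R : realType} (i : 'I_3) (q : R * R) (t : R) : R3 R :=
  match val i with
  | 0%N => (t, q.1, q.2) | 1%N => (q.1, t, q.2) | _ => (q.1, q.2, t) end.

Section coordinates.
Context {R : realType}.
Implicit Types (p : R3 R) (i j : 'I_3).

Lemma ins_rest i p : ins i (rest i p) (crd i p) = p.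
Proof. by case: i => -[|[|[|//]]] ?; case: p => -[]. Qed.

Lemma coord_ins i (q : R * R) (t : R) : crd i (ins i q t) = t.
Proof. by case: i => -[|[|[|//]]] ?. Qed.

Lemma rest_ins i (q : R * R) (t : R) : rest i (ins i q t) = q.
Proof. by case: i => -[|[|[|//]]] ?; case: q. Qed.

Lemma continuous_coord i : continuous (@crd R i).
Proof. by rewrite /crd; case: i => -[|[|[|//]]] ? /=; continuity. Qed.

Lemma continuous_rest i : continuous (@rest R i).
Proof. by rewrite /rest; case: i => -[|[|[|//]]] ? /=; continuity. Qed.

Lemma continuous_ins (T : topologicalType) i (f : T -> R * R) (g : T -> R) :
  continuous f -> continuous g -> continuous (fun x => ins i (f x) (g x)).
Proof. by move=> cf cg; rewrite /ins; case: i => -[|[|[|//]]] ? /=; continuity. Qed.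

Lemma norm_coord i p : `|crd i p| <= `|p|.
Proof.
rewrite /crd; case: i => -[|[|[|//]]] ? /=;
  by rewrite !prod_normE/= !le_max lexx ?orbT.
Qed.

Lemma norm_le_coord p (M : R) : (forall i, `|crd i p| <= M) -> `|p| <= M.
Proof.
move=> H; rewrite !prod_normE/= !ge_max.
have H0 : `|p.1.1| <= M := H (@Ordinal 3 0 isT).
have H1 : `|p.1.2| <= M := H (@Ordinal 3 1 isT).
have H2 : `|p.2| <= M := H (@Ordinal 3 2 isT).
by rewrite H0 H1 H2.
Qed.

Lemma coordD i p (p' : R3 R) : crd i (p + p') = crd i p + crd i p'.
Proof. by case: i => -[|[|[|//]]] ?. Qed.

Lemma coordN i p : crd i (- p) = - crd i p.
Proof. by case: i => -[|[|[|//]]] ?. Qed.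

Lemma coordZ i (a : R) p : crd i (a *: p) = a * crd i p.
Proof. by case: i => -[|[|[|//]]] ?. Qed.

Lemma sub_ins i (q : R * R) (s t : R) : `|ins i q s - ins i q t| = `|s - t|.
Proof.
apply/eqP; rewrite eq_le; apply/andP; split.
  apply: norm_le_coord => j; rewrite coordD coordN.
  by case: i => -[|[|[|//]]] ?; case: j => -[|[|[|//]]] ?; rewrite /crd/= ?subrr ?normr0.
by have := norm_coord i (ins i q s - ins i q t); rewrite coordD coordN !coord_ins.
Qed.

Lemma coord_eq p (p' : R3 R) : (forall i, crd i p = crd i p') -> p = p'.
Proof.
move=> H.
have H0 : p.1.1 = p'.1.1 := H (@Ordinal 3 0 isT).
have H1 : p.1.2 = p'.1.2 := H (@Ordinal 3 1 isT).
have H2 : p.2 = p'.2 := H (@Ordinal 3 2 isT).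
by move: p p' {H} H0 H1 H2 => [[x y] z] [[x' y'] z']/= -> -> ->.
Qed.

Lemma continuous_slice i (q : R * R) (f : R3 R -> R) :
  continuous f -> continuous (fun t => f (ins i q t)).
Proof.
move=> cf; apply: (@continuous_comp_all _ _ _ (ins i q) f) => //.
by apply: continuous_ins; continuity.
Qed.

Lemma tonelli2_xy (f : R * R -> R) : continuous f -> (forall q, 0 <= f q) ->
  (\int[leb \x leb]_q (f q)%:E = \int[leb]_x \int[leb]_y (f (x, y))%:E)%E.
Proof.
move=> cf f0; apply: (@fubini_tonelli1 _ _ _ _ R leb leb (EFin \o f)) => [|p]; last by rewrite lee_fin.
by apply/measurable_EFinP; exact: continuous_measurable2.
Qed.

Lemma tonelli2_yx (f : R * R -> R) : continuous f -> (forall q, 0 <= f q) ->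
  (\int[leb \x leb]_q (f q)%:E = \int[leb]_y \int[leb]_x (f (x, y))%:E)%E.
Proof.
move=> cf f0; apply: (@fubini_tonelli2 _ _ _ _ R leb leb (EFin \o f)) => [|p]; last by rewrite lee_fin.
by apply/measurable_EFinP; exact: continuous_measurable2.
Qed.

Lemma tonelli3_qz (f : R3 R -> R) : continuous f -> (forall p, 0 <= f p) ->
  (\int[mu3]_p (f p)%:E = \int[leb \x leb]_q \int[leb]_z (f (q, z))%:E)%E.
Proof.
move=> cf f0; apply: (@fubini_tonelli1 _ _ _ _ R leb2 leb (EFin \o f)) => [|p]; last by rewrite lee_fin.
exact: cc_measurable.
Qed.

Lemma tonelli3_zq (f : R3 R -> R) : continuous f -> (forall p, 0 <= f p) ->
  (\int[mu3]_p (f p)%:E = \int[leb]_z \int[leb \x leb]_q (f (q, z))%:E)%E.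
Proof.
move=> cf f0; apply: (@fubini_tonelli2 _ _ _ _ R leb2 leb (EFin \o f)) => [|p]; last by rewrite lee_fin.
exact: cc_measurable.
Qed.

(** Changes of variables in space are only made along lines parallel to an
    axis, so that they reduce to the real line. *)
Lemma eq_integral_lines i (F G : R3 R -> R) :
  continuous F -> continuous G ->
  (forall p, 0 <= F p) -> (forall p, 0 <= G p) ->
  (forall q, \int[leb]_t (F (ins i q t))%:E = \int[leb]_t (G (ins i q t))%:E)%E ->
  (\int[mu3]_p (F p)%:E = \int[mu3]_p (G p)%:E)%E.
Proof.
move=> cF cG F0 G0.
case: i => -[|[|[|//]]] ? /= FG.
- apply: (etrans (tonelli3_zq cF F0)); apply: (etrans _ (esym (tonelli3_zq cG G0))).
  apply: eq_integral => z _.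
  have cFz : continuous (fun q => F (q, z)) by continuity.
  have cGz : continuous (fun q => G (q, z)) by continuity.
  apply: (etrans (tonelli2_yx cFz (fun=> F0 _))).
  apply: (etrans _ (esym (tonelli2_yx cGz (fun=> G0 _)))).
  by apply: eq_integral => y _; exact: (FG (y, z)).
- apply: (etrans (tonelli3_zq cF F0)); apply: (etrans _ (esym (tonelli3_zq cG G0))).
  apply: eq_integral => z _.
  have cFz : continuous (fun q => F (q, z)) by continuity.
  have cGz : continuous (fun q => G (q, z)) by continuity.
  apply: (etrans (tonelli2_xy cFz (fun=> F0 _))).
  apply: (etrans _ (esym (tonelli2_xy cGz (fun=> G0 _)))).
  by apply: eq_integral => x _; exact: (FG (x, z)).
- apply: (etrans (tonelli3_qz cF F0)); apply: (etrans _ (esym (tonelli3_qz cG G0))).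
  by apply: eq_integral => -[x y] _; exact: (FG (x, y)).
Qed.

End coordinates.

Definition J {R : realType} (f : R3 R -> R) : R := \int[mu3]_p f p.

Section J_theory.
Context {R : realType}.
Implicit Types f g : R3 R -> R.

Lemma ccM f g : cc f -> continuous g -> cc (fun p => f p * g p).
Proof.
move=> [cf [M fM]] cg; split; first by continuity.
by exists M => p /fM ->; rewrite mul0r.
Qed.

Lemma cc_comp f (h : R -> R) : cc f -> continuous h -> h 0 = 0 ->
  cc (fun p => h (f p)).
Proof.
move=> [cf [M fM]] ch h0; split; first by continuity.
by exists M => p /fM ->.
Qed.

Lemma ccD f g : cc f -> cc g -> cc (fun p => f p + g p).
Proof.
move=> [cf [M fM]] [cg [N gN]]; split; first by continuity.
exists (Num.max M N) => p; rewrite gt_max => /andP[/fM -> /gN ->].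
by rewrite addr0.
Qed.

Lemma ccN f : cc f -> cc (fun p => - f p).
Proof.
by move=> fcc; apply: (@cc_comp f (fun x => - x)) => //; [continuity|rewrite oppr0].
Qed.

Lemma ccB f g : cc f -> cc g -> cc (fun p => f p - g p).
Proof. by move=> cf cg; apply: ccD => //; exact: ccN. Qed.

Lemma ccZ (a : R) f : cc f -> cc (fun p => a * f p).
Proof.
by move=> fcc; apply: (@cc_comp f (fun x => a * x)) => //; [continuity|rewrite mulr0].
Qed.

Lemma cc_sum (I : Type) (s : seq I) (F : I -> R3 R -> R) :
  (forall i, cc (F i)) -> cc (fun p => \sum_(i <- s) F i p).
Proof.
move=> H; elim: s => [|i s IHs].
  under eq_fun do rewrite big_nil.
  by split; [continuity|exists 0].
under eq_fun do rewrite big_cons.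
exact: ccD.
Qed.

Lemma JD f g : cc f -> cc g -> J (fun p => f p + g p) = J f + J g.
Proof. by move=> /cc_integrable cf /cc_integrable cg; rewrite /J RintegralD. Qed.

Lemma JB f g : cc f -> cc g -> J (fun p => f p - g p) = J f - J g.
Proof. by move=> /cc_integrable cf /cc_integrable cg; rewrite /J RintegralB. Qed.

Lemma JZ (a : R) f : cc f -> J (fun p => a * f p) = a * J f.
Proof. by move=> /cc_integrable cf; rewrite /J RintegralZl. Qed.

Lemma J_le f g : cc f -> cc g -> (forall p, f p <= g p) -> J f <= J g.
Proof.
by move=> /cc_integrable cf /cc_integrable cg fg; rewrite /J le_Rintegral.
Qed.

Lemma J_ge0 f : (forall p, 0 <= f p) -> 0 <= J f.
Proof. by move=> f0; rewrite /J Rintegral_ge0. Qed.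

Lemma J_EFin f : cc f -> ((J f)%:E = \int[mu3]_p (f p)%:E)%E.
Proof.
by move=> /cc_integrable fi; rewrite /J /Rintegral fineK//; exact: integrable_fin_num.
Qed.

Lemma J_bound f (M e : R) : 0 <= M -> cc f -> (forall p, M < `|p| -> f p = 0) ->
  (forall p, `|f p| <= e) -> `|J f| <= e * (M *+ 2) ^+ 3.
Proof.
move=> M0 fcc fM fe.
have e0 : 0 <= e by rewrite (le_trans _ (fe 0)).
rewrite -lee_fin /J EFin_normr_Rintegral//; last exact: cc_integrable.
apply: (le_trans (le_abse_integral _ _ _)) => //.
  by apply: cc_measurable; case: fcc.
have mb := measurable_box M.
have -> : ((e * (M *+ 2) ^+ 3)%:E = \int[mu3]_p (e * \1_(box M) p)%:E)%E.
  under eq_integral do rewrite EFinM.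
  rewrite ge0_integralZl//=; last by apply/measurable_EFinP; exact: measurable_indic.
  by rewrite integral_indic// setIT EFinM -mu3_box.
apply: ge0_le_integral => //=.
- have cn : continuous (fun p => `|f p|) by case: fcc => cf _; continuity.
  exact: (cc_measurable cn).
- apply/measurable_EFinP; apply: measurable_funM => //.
- move=> p _; rewrite lee_fin indicE.
  have [pM|Mp] := leP `|p| M.
    by rewrite mem_set ?mulr1//; exact/box_norm.
  by rewrite fM// normr0 mulr_ge0.
Qed.

End J_theory.

(** * Shears and the discrete continuity equation *)

Section shear.
Context {R : realType}.

Lemma is_derive_continuous (f d : R -> R) :
  (forall t, is_derive t (1 : R) f (d t)) -> continuous f.
Proof.
by move=> fd t; have [dt _] := fd t; apply/differentiable_continuous/derivable1_diffP.
Qed.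

Lemma mean_value (f d : R -> R) (a b : R) :
  (forall t, is_derive t (1 : R) f (d t)) ->
  exists2 c, `|c - a| <= `|b - a| & f b - f a = d c * (b - a).
Proof.
move=> fd; have cf := is_derive_continuous fd.
have [ab|ba|->] := ltgtP a b; last by exists b; rewrite // subrr subrr mulr0.
  have [|c] := @MVT _ f d a b ab (fun t _ => fd t).
    exact: continuous_subspaceT.
  rewrite in_itv/= => /andP[ac cb] E; exists c => //.
  by rewrite !ger0_norm ?subr_ge0 ?lerD2r// ltW.
have [|c] := @MVT _ f d b a ba (fun t _ => fd t).
  exact: continuous_subspaceT.
rewrite in_itv/= => /andP[bc ca] E; exists c.
  by rewrite distrC (distrC b) !ger0_norm ?subr_ge0 ?lerD2l ?lerN2// ltW.
by rewrite -(opprB (f a)) E -(opprB a b) mulrN.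
Qed.

(** The map [t + a t] is increasing, its derivative being at least 1/2, and it is
    the identity near infinity. *)
Lemma integral_near_identity (a d G : R -> R) (M : R) :
  (forall t, is_derive t (1 : R) a (d t)) -> continuous d ->
  (forall t, M < `|t| -> a t = 0 /\ d t = 0) ->
  (forall t, `|d t| <= 2^-1) -> continuous G -> (forall t, 0 <= G t) ->
  (\int[leb]_t (G t)%:E = \int[leb]_t (G (t + a t) * (1 + d t))%:E)%E.
Proof.
move=> ad cd aM d2 cG G0.
pose X t : R := t + a t.
have XD t : is_derive t (1 : R) X (1 + d t) by apply: is_deriveD.
have XE : derive1 X = fun t => 1 + d t.
  by apply/funext => t; rewrite derive1E; apply: derive_val.
rewrite (@increasing_ge0_integration_by_substitutionT _ X)//.
- by rewrite XE.
- move=> x y xy; have [c _] := mean_value x y XD.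
  move/eqP; rewrite -subr_gt0 subr_eq => /eqP ->.
  rewrite addrK mulr_gt0// ?subr_gt0//.
  by have := d2 c; rewrite ler_norml => /andP[? _]; lra.
- by rewrite XE; continuity.
- rewrite XE; apply/cvg_ex; exists 1; apply: (cvg_near_cst _) => //.
  near=> t; rewrite (aM _ _).2 ?addr0// ltr_normr ltrNr; apply/orP; right.
  by near: t; apply: nbhs_ninfty_lt; rewrite num_real.
- rewrite XE; apply/cvg_ex; exists 1; apply: (cvg_near_cst _) => //.
  near=> t; rewrite (aM _ _).2 ?addr0// ltr_normr; apply/orP; left.
  by near: t; apply: nbhs_pinfty_gt; rewrite num_real.
- apply/cvgrNyPle => A; near=> t.
  rewrite /X (aM _ _).1 ?addr0; first by near: t; apply: nbhs_ninfty_le; rewrite num_real.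
  rewrite ltr_normr ltrNr; apply/orP; right.
  by near: t; apply: nbhs_ninfty_lt; rewrite num_real.
- apply/cvgryPge => A; near=> t.
  rewrite /X (aM _ _).1 ?addr0; first by near: t; apply: nbhs_pinfty_ge; rewrite num_real.
  rewrite ltr_normr; apply/orP; left.
  by near: t; apply: nbhs_pinfty_gt; rewrite num_real.
Unshelve. all: by end_near. Qed.

Definition has_partial (i : 'I_3) (f d : R3 R -> R) : Prop :=
  forall q t, is_derive t (1 : R) (fun s => f (ins i q s)) (d (ins i q t)).

Definition shear (i : 'I_3) (a : R3 R -> R) (p : R3 R) : R3 R :=
  ins i (rest i p) (crd i p + a p).

Lemma shear_ins i a q (t : R) : shear i a (ins i q t) = ins i q (t + a (ins i q t)).
Proof. by rewrite /shear rest_ins coord_ins. Qed.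

Lemma continuous_shear i a : continuous a -> continuous (shear i a).
Proof.
move=> ca; apply: continuous_ins; first exact: continuous_rest.
by apply: continuous_add => //; exact: continuous_coord.
Qed.

Lemma norm_ins_ge i q (t : R) : `|t| <= `|ins i q t|.
Proof. by rewrite -[t in leLHS](coord_ins i q); exact: norm_coord. Qed.

Lemma integral_shear_ge0 i (a d F : R3 R -> R) :
  cc a -> cc d -> has_partial i a d -> (forall p, `|d p| <= 2^-1) ->
  continuous F -> (forall p, 0 <= F p) ->
  (\int[mu3]_p (F (shear i a p) * (1 + d p))%:E = \int[mu3]_p (F p)%:E)%E.
Proof.
move=> [ca [M aM]] [cd [N dN]] ad d2 cF F0.
have d1 p : 0 <= 1 + d p by have := d2 p; rewrite ler_norml => /andP[? _]; lra.
apply: (@eq_integral_lines _ i) => //.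
- have cs := continuous_shear (i:=i) ca; have cFs := continuous_comp_all cs cF.
  have : continuous (fun p : R3 R => F (shear i a p) * (1 + d p)) by continuity.
  exact.
- by move=> p; rewrite mulr_ge0.
- move=> q; apply/esym.
  rewrite (@integral_near_identity (fun t => a (ins i q t)) (fun t => d (ins i q t))
    (fun t => F (ins i q t)) (Num.max M N) (ad q)) //.
  + by apply: eq_integral => t _; rewrite shear_ins.
  + exact: continuous_slice.
  + move=> t; rewrite gt_max => /andP[Mt Nt].
    by rewrite aM ?dN ?(lt_le_trans _ (norm_ins_ge _ _ _)).
  + exact: continuous_slice.
Qed.

(** A shear moves one coordinate only, so that its Jacobian is [1 + d] and
    [integral_near_identity] applies on every line. The sign of [F] is removed
    by splitting it into its positive and negative parts. *)
Lemma J_shear i (a d F : R3 R -> R) :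
  cc a -> cc d -> has_partial i a d -> (forall p, `|d p| <= 2^-1) -> cc F ->
  cc (fun p => F (shear i a p) * (1 + d p)) /\
  J (fun p => F (shear i a p) * (1 + d p)) = J F.
Proof.
move=> acc dcc ad d2.
have [B [B0 aB]] := cc_bounded acc.
have [ca _] := acc; have [cd _] := dcc.
have cs := continuous_shear (i:=i) ca.
have ccs F' : cc F' -> cc (fun p => F' (shear i a p) * (1 + d p)).
  move=> [cF [M FM]]; split.
    by have cFs := continuous_comp_all cs cF; continuity.
  exists (M + B) => p pMB; rewrite FM ?mul0r//.
  have : `|p - shear i a p| <= B.
    rewrite /shear -{1}(ins_rest i p) sub_ins opprD addrA subrr sub0r normrN.
    exact: aB.
  have := ler_distD (shear i a p) p 0; rewrite !subr0 => H1 H2.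
  by rewrite -(ltrD2r B) (lt_le_trans pMB)// (le_trans H1)// addrC lerD2l.
have Jpos F' : cc F' -> (forall p, 0 <= F' p) ->
    J (fun p => F' (shear i a p) * (1 + d p)) = J F'.
  by move=> [cF _] F0; rewrite /J /Rintegral integral_shear_ge0.
move=> Fcc; split; first exact: ccs.
have [cF _] := Fcc.
pose Fp p := Num.max (F p) 0; pose Fn p := Num.max (- F p) 0.
have Fpcc : cc Fp.
  by apply: (@cc_comp _ F (fun x => Num.max x 0)) => //; [continuity|rewrite maxxx].
have Fncc : cc Fn.
  apply: (@cc_comp _ F (fun x => Num.max (- x) 0)) => //; first by continuity.
  by rewrite oppr0 maxxx.
have FE p : F p = Fp p - Fn p.
  by rewrite /Fp /Fn; case: (leP 0 (F p)) => H; case: (leP 0 (- F p)) => H'; lra.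
have -> : (fun p => F (shear i a p) * (1 + d p)) = (fun p =>
    Fp (shear i a p) * (1 + d p) - Fn (shear i a p) * (1 + d p)).
  by apply/funext => p; rewrite FE mulrBl.
rewrite JB; [|exact: ccs|exact: ccs].
rewrite !Jpos//; last 2 first.
- by move=> p; rewrite le_max lexx orbT.
- by move=> p; rewrite le_max lexx orbT.
by rewrite -JB//; congr J; apply/funext => p; rewrite -FE.
Qed.

End shear.

Section transport.
Context {R : realType}.
Implicit Types (f phi psi : R3 R -> R).

Lemma has_partialZ i (c : R) (v dv : R3 R -> R) : has_partial i v dv -> has_partial i (fun p => c * v p) (fun p => c * dv p).
Proof. by move=> vd q t; have vdqt := vd q t; apply: is_deriveZ. Qed.

Lemma norm_shear_sub i a (p : R3 R) : `|shear i a p - p| = `|a p|.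
Proof.
by rewrite /shear -[X in `|_ - X|](ins_rest i p) sub_ins addrC addKr.
Qed.

Lemma cc_comp_shear i a f psi : cc f -> continuous psi -> continuous a ->
  cc (fun p => f p * psi (shear i a p)).
Proof.
move=> fcc cpsi ca; apply: ccM => //.
exact: continuous_comp_all (continuous_shear ca) cpsi.
Qed.

Definition unit_valued psi := forall p : R3 R, 0 <= psi p <= 1.

(** The change of variables gives both integrals the common factor
    [psi (shear i a p)], so that no regularity of [psi] enters the estimate. *)
Lemma J_shear_compare i (a d f Phi : R3 R -> R) (M e : R) psi : 0 <= M ->
  cc a -> cc d -> has_partial i a d -> (forall p, `|d p| <= 2^-1) -> cc f -> cc Phi ->
  (forall p, M < `|p| -> f p = 0) -> (forall p, M < `|p| -> Phi (shear i a p) = 0) ->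
  (forall p, `|Phi (shear i a p) * (1 + d p) - f p| <= e) ->
  continuous psi -> unit_valued psi ->
  `|J (fun p => f p * psi (shear i a p)) - J (fun p => Phi p * psi p)|
    <= e * (M *+ 2) ^+ 3.
Proof.
move=> M0 acc dcc ad d2 fcc Phicc fM PhiM Phif cpsi psi1.
have [ca _] := acc.
have cs := continuous_shear (i := i) ca.
have [Pcc <-] := J_shear acc dcc ad d2 (ccM Phicc cpsi).
rewrite -JB//; last exact: cc_comp_shear.
apply: J_bound => //.
- by apply: ccB => //; exact: cc_comp_shear.
- by move=> p Mp; rewrite fM// PhiM// !mul0r subrr.
- move=> p; rewrite mulrAC -mulrBl normrM distrC.
  have /andP[p0 p1] := psi1 (shear i a p).
  rewrite -[leRHS]mulr1; apply: ler_pM => //.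
  by rewrite ger0_norm.
Qed.

Lemma cc_support f : cc f -> exists M, 0 < M /\ forall p, M < `|p| -> f p = 0.
Proof.
move=> [_ [M fM]]; exists (`|M| + 1); split; first by rewrite ltr_wpDl.
by move=> p Mp; apply: fM; rewrite (le_lt_trans (ler_norm M))// (le_lt_trans _ Mp)// lerDl.
Qed.

(** Here and in [shear_weak1] the threshold [h0] is uniform in [psi]: the test
    functions used later depend on the step length. *)
Lemma shear_weak0 i (v dv f : R3 R -> R) : cc v -> cc dv -> has_partial i v dv -> cc f ->
  forall e : R, 0 < e -> exists h0 : R, 0 < h0 /\ forall h, 0 < h < h0 ->
  forall psi, continuous psi -> unit_valued psi ->
  `|J (fun p => f p * psi (shear i (fun p => h * v p) p)) - J (fun p => f p * psi p)| <= e.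
Proof.
move=> vcc dvcc vd fcc e e0.
have [Kv [Kv0 vK]] := cc_bounded vcc.
have [Kd [Kd0 dK]] := cc_bounded dvcc.
have [Kf [Kf0 fK]] := cc_bounded fcc.
have [M [M0 fM]] := cc_support fcc.
pose V := ((M + Kv) *+ 2) ^+ 3.
have V0 : 0 < V by rewrite exprn_gt0// pmulrn_lgt0// addr_gt0.
pose e1 := e / V / 2.
have e10 : 0 < e1 by rewrite !divr_gt0.
have [d [d0 fd]] := cc_unif fcc e10.
pose h0 := Num.min (Num.min 1 (d / Kv)) (Num.min (2^-1 / Kd) (e1 / (Kf * Kd))).
exists h0; split; first by rewrite /h0 !lt_min ltr01 (divr_gt0 d0 Kv0)
    (divr_gt0 _ Kd0) ?invr_gt0// (divr_gt0 e10 (mulr_gt0 Kf0 Kd0)).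
move=> h /andP[hp]; rewrite /h0 !lt_min => /andP[/andP[h1 hd] /andP[hKd he]] psi cpsi psi1.
rewrite ltr_pdivlMr// in hd; rewrite ltr_pdivlMr// in hKd.
rewrite ltr_pdivlMr ?mulr_gt0// in he.
have hv p : `|h * v p| < d.
  by rewrite normrM (gtr0_norm hp)// (le_lt_trans _ hd)// ler_pM2l.
have -> : e = (e1 + e1) * V by rewrite /e1 -splitr divfK// gt_eqF.
apply: (J_shear_compare (d := fun p => h * dv p)) => //.
- by rewrite addr_ge0// ltW.
- exact: ccZ.
- exact: ccZ.
- exact: has_partialZ.
- by move=> p; rewrite normrM (gtr0_norm hp)// (le_trans _ (ltW hKd))// ler_pM2l.
- by move=> p Mp; apply: fM; rewrite (lt_trans _ Mp)// ltrDl.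
- move=> p Mp; apply: fM.
  have := ler_distD (shear i (fun p => h * v p) p) p 0; rewrite !subr0 => H.
  have := lt_le_trans Mp H; rewrite distrC norm_shear_sub normrM (gtr0_norm hp)// => H1.
  rewrite -(ltrD2r Kv) (lt_le_trans H1)// addrC lerD2l (le_trans _ (vK p))//.
  by rewrite ler_piMl// ltW.
- move=> p; rewrite mulrDr mulr1 addrAC (le_trans (ler_normD _ _))// lerD//.
    by rewrite ltW// fd// norm_shear_sub.
  rewrite !normrM (gtr0_norm hp)// mulrCA (le_trans _ (ltW he))// ler_pM2l//.
  by rewrite ler_pM.
Qed.

(** First-order expansion in [h] of the action of a shear on the density [phi]:
    by [J_shear_compare] it is enough that the pullback of
    [phi - h * (v phi)'] has density [phi] up to [o(h)]. *)
Lemma shear_weak1 i (v dv phi dphi : R3 R -> R) : cc v -> cc dv -> has_partial i v dv ->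
  cc phi -> cc dphi -> has_partial i phi dphi ->
  forall e : R, 0 < e -> exists h0 : R, 0 < h0 /\ forall h, 0 < h < h0 ->
  forall psi, continuous psi -> unit_valued psi ->
  `|J (fun p => phi p * psi (shear i (fun p => h * v p) p)) - J (fun p => phi p * psi p)
    + h * J (fun p => (v p * dphi p + phi p * dv p) * psi p)| <= e * h.
Proof.
move=> vcc dvcc vd pcc dpcc pD e e0.
pose g p := v p * dphi p + phi p * dv p.
have gcc : cc g by apply: ccD; apply: ccM => //; [case: dpcc|case: dvcc].
have [Kv [Kv0 vK]] := cc_bounded vcc.
have [Kd [Kd0 dK]] := cc_bounded dvcc.
have [Kf [Kf0 fK]] := cc_bounded pcc.
have [Kg [Kg0 gK]] := cc_bounded gcc.
have [Kp [Kp0 pK]] := cc_bounded dpcc.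
have [M1 [M10 fM1]] := cc_support pcc.
have [M2 [M20 fM2]] := cc_support gcc.
pose M := M1 + M2; have M0 : 0 < M by rewrite addr_gt0.
have fM p : M < `|p| -> phi p = 0.
  by move=> Mp; apply: fM1; rewrite (lt_trans _ Mp)// ltrDl.
have gM p : M < `|p| -> g p = 0.
  by move=> Mp; apply: fM2; rewrite (lt_trans _ Mp)// ltrDr.
pose V := ((M + Kv) *+ 2) ^+ 3.
have V0 : 0 < V by rewrite exprn_gt0// pmulrn_lgt0// addr_gt0.
pose K := Kv + 1 + Kd + 1.
have K0 : 0 < K by rewrite !addr_gt0.
pose e1 := e / V / K.
have e10 : 0 < e1 by rewrite !divr_gt0.
have [d1 [d10 fd1]] := cc_unif dpcc e10.
have [d2 [d20 fd2]] := cc_unif gcc e10.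
pose d := Num.min d1 d2.
have d0 : 0 < d by rewrite lt_min d10.
pose h0 := Num.min (Num.min 1 (d / Kv))
  (Num.min (2^-1 / Kd) (Num.min (e1 / (Kp * Kv)) (e1 / (Kg * Kd)))).
exists h0; split; first by rewrite /h0 !lt_min ltr01 (divr_gt0 d0 Kv0)
    (divr_gt0 _ Kd0) ?invr_gt0// (divr_gt0 e10 (mulr_gt0 Kp0 Kv0)) (divr_gt0 e10 (mulr_gt0 Kg0 Kd0)).
move=> h /andP[hp]; rewrite /h0 !lt_min.
move=> /andP[/andP[h1 hd] /andP[hKd /andP[he1 he2]]] psi cpsi psi1.
rewrite ltr_pdivlMr// in hd; rewrite ltr_pdivlMr// in hKd.
rewrite ltr_pdivlMr ?mulr_gt0// in he1; rewrite ltr_pdivlMr ?mulr_gt0// in he2.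
have hvKv p : `|h * v p| <= h * Kv by rewrite normrM (gtr0_norm hp)// ler_pM2l.
have hv p : `|h * v p| < d by rewrite (le_lt_trans (hvKv p)).
pose Phi p := phi p - h * g p.
have Phicc : cc Phi by apply: ccB => //; exact: ccZ.
have -> : J (fun p => phi p * psi (shear i (fun p => h * v p) p)) - J (fun p => phi p * psi p)
    + h * J (fun p => (v p * dphi p + phi p * dv p) * psi p) =
    J (fun p => phi p * psi (shear i (fun p => h * v p) p)) - J (fun p => Phi p * psi p).
  rewrite -addrA; congr (_ + _); rewrite -JZ; last exact: ccM.
  have -> : (fun p => Phi p * psi p) = (fun p => phi p * psi p - h * (g p * psi p)).
    by apply/funext => p; rewrite /Phi mulrBl mulrA.
  rewrite JB; [by rewrite opprB addrC|exact: ccM|by apply: ccZ; exact: ccM].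
have -> : e * h = (K * e1 * h) * V.
  by rewrite /e1; field; rewrite !gt_eqF.
apply: (J_shear_compare (d := fun p => h * dv p)) => //.
- by rewrite addr_ge0// ltW.
- exact: ccZ.
- exact: ccZ.
- exact: has_partialZ.
- by move=> p; rewrite normrM (gtr0_norm hp)// (le_trans _ (ltW hKd))// ler_pM2l.
- by move=> p Mp; apply: fM; rewrite (lt_trans _ Mp)// ltrDl.
- move=> p Mp.
  have MS : M < `|shear i (fun p => h * v p) p|.
    have := ler_distD (shear i (fun p => h * v p) p) p 0; rewrite !subr0 => H.
    have := lt_le_trans Mp H; rewrite distrC norm_shear_sub normrM (gtr0_norm hp)// => H1.
    rewrite -(ltrD2r Kv) (lt_le_trans H1)// addrC lerD2l (le_trans _ (vK p))//.
    by rewrite ler_piMl// ltW.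
  by rewrite /Phi fM// gM// mulr0 subrr.
- move=> p; set S := shear _ _ _.
  have [c cv cE] := mean_value (crd i p) (crd i p + h * v p) (pD (rest i p)).
  rewrite addrAC subrr add0r in cv cE; rewrite ins_rest -/(shear i (fun p => h * v p) p) -/S in cE.
  set c' := ins i (rest i p) c in cE.
  have c'p : `|c' - p| <= `|h * v p| by rewrite /c' -[X in `|_ - X|](ins_rest i p) sub_ins.
  have D1 : `|dphi c' - dphi p| <= e1.
    by rewrite ltW// fd1// (le_lt_trans c'p)// (lt_le_trans (hv p))// ge_min lexx.
  have D2 : `|g S - g p| <= e1.
    by rewrite ltW// fd2// norm_shear_sub (lt_le_trans (hv p))// ge_min lexx orbT.
  have -> : Phi S * (1 + h * dv p) - phi p = h * ((dphi c' - dphi p) * v p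
      + h * (dphi c' * v p) * dv p + (- (g S - g p)) + - (h * (g S * dv p))).
    rewrite /Phi; have -> : phi S = phi p + dphi c' * (h * v p) by rewrite -cE addrC subrK.
    by rewrite /g; ring.
  rewrite normrM (gtr0_norm hp)// mulrC ler_pM2r//.
  have -> : K * e1 = Kv * e1 + Kd * e1 + e1 + e1 by rewrite /K; ring.
  apply: (le_trans (ler_normD _ _)); apply: lerD; last first.
    rewrite normrN normrM (gtr0_norm hp)// (le_trans _ (ltW he2))// ler_pM2l// normrM.
    by rewrite ler_pM.
  apply: (le_trans (ler_normD _ _)); apply: lerD; last by rewrite normrN.
  apply: (le_trans (ler_normD _ _)); apply: lerD.
    by rewrite normrM mulrC ler_pM.
  rewrite normrM mulrC ler_pM// normrM (gtr0_norm hp)// (le_trans _ (ltW he1))// ler_pM2l// normrM.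
  by rewrite ler_pM.
Qed.

Definition i0 : 'I_3 := @Ordinal 3 0 isT.
Definition i1 : 'I_3 := @Ordinal 3 1 isT.
Definition i2 : 'I_3 := @Ordinal 3 2 isT.

(** One step of a splitting scheme for the flow of [v]. The coordinates move one
    after the other, which makes the step a composition of shears. *)
Definition step (v : 'I_3 -> R3 R -> R) (h : R) (p : R3 R) : R3 R :=
  shear i2 (fun p => h * v i2 p) (shear i1 (fun p => h * v i1 p)
    (shear i0 (fun p => h * v i0 p) p)).

Lemma continuous_step v h : (forall i, continuous (v i)) -> continuous (step v h).
Proof.
move=> cv.
have cs i : continuous (shear i (fun p => h * v i p)).
  by apply: continuous_shear; apply: continuous_mul => //; continuity.
exact: continuous_comp_all (continuous_comp_all (cs i0) (cs i1)) (cs i2).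
Qed.

Lemma sum3 (F : 'I_3 -> R) : \sum_i F i = F i0 + F i1 + F i2.
Proof.
rewrite !big_ord_recr/= big_ord0 add0r.
by congr (F _ + F _ + F _); apply/val_inj.
Qed.

(** The continuity equation in weak form, for one step: each shear contributes
    its own first-order term by [shear_weak1], and [shear_weak0] replaces the
    sheared test functions in these terms by [psi]. *)
Lemma step_weak (v dv dphi : 'I_3 -> R3 R -> R) phi :
  (forall i, cc (v i)) -> (forall i, cc (dv i)) -> (forall i, has_partial i (v i) (dv i)) ->
  cc phi -> (forall i, cc (dphi i)) -> (forall i, has_partial i phi (dphi i)) ->
  forall e : R, 0 < e -> exists h0 : R, 0 < h0 /\ forall h, 0 < h < h0 ->
  forall psi, continuous psi -> unit_valued psi ->
  `|J (fun p => phi p * psi (step v h p)) - J (fun p => phi p * psi p)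
    + h * J (fun p => (\sum_i (v i p * dphi i p + phi p * dv i p)) * psi p)| <= e * h.
Proof.
move=> vcc dvcc vd pcc dpcc pD e e0.
pose g i p := v i p * dphi i p + phi p * dv i p.
have gcc i : cc (g i).
  by apply: ccD; apply: ccM => //; [case: (dpcc i)|case: (dvcc i)].
(* three first-order expansions and three replacements of a test function *)
pose e1 := e / 6; have e10 : 0 < e1 by rewrite divr_gt0.
have W1 i := shear_weak1 (vcc i) (dvcc i) (vd i) pcc (dpcc i) (pD i) e10.
have W0 i j := shear_weak0 (vcc i) (dvcc i) (vd i) (gcc j) e10.
have [a0 [a00 A0]] := W1 i0; have [a1 [a10 A1]] := W1 i1; have [a2 [a20 A2]] := W1 i2.
have [b0 [b00 B0]] := W0 i1 i0; have [b1 [b10 B1]] := W0 i2 i0.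
have [b2 [b20 B2]] := W0 i2 i1.
exists (Num.min a0 (Num.min a1 (Num.min a2 (Num.min b0 (Num.min b1 b2))))).
split; first by rewrite !lt_min a00 a10 a20 b00 b10.
move=> h; rewrite !lt_min => /and5P[hp ha0 ha1 ha2 /and3P[hb0 hb1 hb2]] psi cpsi psi1.
have cs i : continuous (shear i (fun p => h * v i p)).
  apply: continuous_shear; apply: continuous_mul; first by continuity.
  by case: (vcc i).
pose psi2 p := psi (shear i2 (fun p => h * v i2 p) p).
pose psi1' p := psi2 (shear i1 (fun p => h * v i1 p) p).
have cpsi2 : continuous psi2 by exact: continuous_comp_all (cs i2) cpsi.
have cpsi1 : continuous psi1' by exact: continuous_comp_all (cs i1) cpsi2.
have upsi2 : unit_valued psi2 by move=> p; exact: psi1.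
have upsi1 : unit_valued psi1' by move=> p; exact: psi1.
have {}A0 := A0 h; rewrite hp ha0 in A0; have {A0}/= A0 := A0 isT _ cpsi1 upsi1.
have {}A1 := A1 h; rewrite hp ha1 in A1; have {A1}/= A1 := A1 isT _ cpsi2 upsi2.
have {}A2 := A2 h; rewrite hp ha2 in A2; have {A2}/= A2 := A2 isT _ cpsi psi1.
have {}B0 := B0 h; rewrite hp hb0 in B0; have {B0}/= B0 := B0 isT _ cpsi2 upsi2.
have {}B1 := B1 h; rewrite hp hb1 in B1; have {B1}/= B1 := B1 isT _ cpsi psi1.
have {}B2 := B2 h; rewrite hp hb2 in B2; have {B2}/= B2 := B2 isT _ cpsi psi1.
have -> : J (fun p => (\sum_i (v i p * dphi i p + phi p * dv i p)) * psi p) =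
    J (fun p => g i0 p * psi p) + J (fun p => g i1 p * psi p) + J (fun p => g i2 p * psi p).
  rewrite -JD; [|exact: ccM|exact: ccM].
  rewrite -JD; [|apply: ccD; exact: ccM|exact: ccM].
  by congr J; apply/funext => p; rewrite sum3 -/(g i0 p) -/(g i1 p) -/(g i2 p) !mulrDl.
(* The integrals below agree up to unfolding the sheared test functions. *)
rewrite -/(psi1' _) in A0.
change (fun p => phi p * psi (step v h p)) with
  (fun p => phi p * psi1' (shear i0 (fun p => h * v i0 p) p)).
move: A0 A1 A2 B0 B1 B2.
change (fun p => phi p * psi2 (shear i1 (fun p0 => h * v i1 p0) p)) with
  (fun p => phi p * psi1' p).
change (fun p => g i0 p * psi2 (shear i1 (fun p0 => h * v i1 p0) p)) with
  (fun p => g i0 p * psi1' p).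
change (fun p => phi p * psi (shear i2 (fun p0 => h * v i2 p0) p)) with
  (fun p => phi p * psi2 p).
change (fun p => g i0 p * psi (shear i2 (fun p0 => h * v i2 p0) p)) with
  (fun p => g i0 p * psi2 p).
change (fun p => g i1 p * psi (shear i2 (fun p0 => h * v i2 p0) p)) with
  (fun p => g i1 p * psi2 p).
change (fun p => (v i0 p * dphi i0 p + phi p * dv i0 p) * psi1' p) with
  (fun p => g i0 p * psi1' p).
change (fun p => (v i1 p * dphi i1 p + phi p * dv i1 p) * psi2 p) with
  (fun p => g i1 p * psi2 p).
change (fun p => (v i2 p * dphi i2 p + phi p * dv i2 p) * psi p) with
  (fun p => g i2 p * psi p).
set j0 := J _; set j1 := J _; set j2 := J _; set j3 := J _; set j4 := J _.
set j5 := J _; set j6 := J _; set j7 := J _.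
set k0 := J _; set k1 := J _ => A0 A1 A2 B0 B1 B2.
have hB x : `|x| <= e1 -> `|h * x| <= e1 * h.
  by move=> xe; rewrite normrM (gtr0_norm hp) mulrC ler_pM2r.
have {}B0 := hB _ B0; have {}B1 := hB _ B1; have {}B2 := hB _ B2.
have -> : e * h = 6 * (e1 * h) by rewrite /e1; field.
by move: A0 A1 A2 B0 B1 B2; rewrite !ler_norml; lra.
Qed.

End transport.

(** * Reaching a target along a discrete flow *)

Section clip.
Context {R : realType}.

Definition clip (x : R) : R := Num.min 1 (Num.max 0 x).

Lemma clip_ge0 x : 0 <= clip x.
Proof. by rewrite /clip le_min ler01 le_max lexx. Qed.

Lemma clip_le1 x : clip x <= 1.
Proof. by rewrite /clip ge_min lexx. Qed.

Lemma clip0 x : x <= 0 -> clip x = 0.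
Proof. by move=> x0; rewrite /clip max_l// min_r. Qed.

Lemma clip1 x : 1 <= x -> clip x = 1.
Proof. by move=> x1; rewrite /clip max_r ?min_l// (le_trans ler01). Qed.

Lemma continuous_clip (T : topologicalType) (f : T -> R) :
  continuous f -> continuous (fun x => clip (f x)).
Proof. by move=> cf; rewrite /clip; continuity. Qed.

End clip.

Section reach.
Context {R : realType}.
Variables (E : R3 R -> R3 R) (b g : R3 R -> R).
Hypotheses (b_ge0 : forall p, 0 <= b p) (b_le1 : forall p, b p <= 1).
Hypotheses (g_ge0 : forall p, 0 <= g p) (g_le1 : forall p, g p <= 1).

(** If [b] and [g] are indicator functions, this is the indicator of the points
    whose orbit under [E] meets [g = 1] within [N] steps and stays in [b = 1]
    until then. Minima and maxima keep it continuous in [p]. *)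
Fixpoint reach (N : nat) (p : R3 R) : R :=
  if N is N'.+1 then Num.min (b p) (Num.max (g p) (reach N' (E p)))
  else Num.min (b p) (g p).

Lemma reach_unit N : unit_valued (reach N).
Proof.
move=> p; apply/andP; split; last by case: N => [|N] /=; rewrite ge_min b_le1.
by case: N => [|N] /=; rewrite le_min b_ge0 ?le_max g_ge0.
Qed.

Lemma reach_mono N p : reach N p <= reach N.+1 p.
Proof.
elim: N p => [|N IHN] p; rewrite [reach _.+1 p]/=.
  by rewrite /= le_min ge_min lexx/= le_max ge_min lexx orbT.
rewrite [leLHS]/=.
by rewrite le_min ge_min lexx/= ge_min ge_max !le_max lexx (IHN (E p)) !orbT.
Qed.

(** Outside the target a point can reach it only through its image, and the
    image has one more step at its disposal. *)
Lemma reach_step N p : g p = 0 -> reach N p <= reach N (E p).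
Proof.
move=> g0; case: N => [|N] /=; rewrite g0.
  by rewrite ge_min; apply/orP; right; rewrite le_min b_ge0 g_ge0.
rewrite ge_min ge_max; apply/orP; right.
have /andP[-> _] := reach_unit N.+1 (E p).
exact: reach_mono.
Qed.

Lemma reach_exit n N p : (forall j, (j <= n)%N -> g (iter j E p) = 0) ->
  b (iter n E p) = 0 -> reach N p = 0.
Proof.
elim: n N p => [|n IHn] N p gE bE.
  apply/eqP; rewrite eq_le; have /andP[-> _] := reach_unit N p.
  by rewrite andbT; case: N => [|N] /=; rewrite ge_min bE lexx.
have g0 : g p = 0 by exact: (gE 0%N).
apply/eqP; rewrite eq_le; have /andP[-> _] := reach_unit N p; rewrite andbT.
case: N => [|N] /=; rewrite g0 ge_min; apply/orP; right; first by [].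
rewrite ge_max lexx/= IHn// => [j jn|]; rewrite -iterSr//.
exact: gE.
Qed.

Lemma reach_hit n N p : (n <= N)%N -> (forall j, (j <= n)%N -> b (iter j E p) = 1) ->
  g (iter n E p) = 1 -> reach N p = 1.
Proof.
elim: n N p => [|n IHn] N p nN bE gE.
  have b1 : b p = 1 by exact: (bE 0%N).
  case: N {nN} => [|N] /=; rewrite b1.
    by rewrite (gE : g p = 1) minxx.
  rewrite (gE : g p = 1) max_l ?minxx//.
  by have /andP[_ ->] := reach_unit N (E p).
case: N nN => [//|N] nN /=.
rewrite (bE 0%N)//= (IHn N (E p))//.
- by rewrite max_r ?minxx// g_le1.
- by move=> j jn; rewrite -iterSr; exact: bE.
- by rewrite -iterSr.
Qed.

Lemma continuous_reach N : continuous E -> continuous b -> continuous g ->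
  continuous (reach N).
Proof.
move=> cE cb cg; elim: N => [|N IHN] /=; first by continuity.
by have cr := continuous_comp_all cE IHN; continuity.
Qed.

End reach.

(** * Euler orbits and streamlines *)

(** The squared Euclidean length; the norm [`|p|] is the maximum norm. *)
Definition nsq {R : realType} (p : R3 R) : R := \sum_i crd i p ^+ 2.

Definition vec {R : realType} (v : 'I_3 -> R3 R -> R) (p : R3 R) : R3 R :=
  (v i0 p, v i1 p, v i2 p).

(** Half the rate of change of the squared radius along [v]. *)
Definition radial {R : realType} (v : 'I_3 -> R3 R -> R) (p : R3 R) : R :=
  \sum_i crd i p * v i p.

Section squared_norm.
Context {R : realType}.
Implicit Types p q : R3 R.

Lemma continuous_nsq : continuous (@nsq R).
Proof.
have -> : @nsq R = fun p => p.1.1 ^+ 2 + p.1.2 ^+ 2 + p.2 ^+ 2.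
  by apply/funext => p; rewrite /nsq sum3.
by continuity.
Qed.

Lemma nsq_ge0 p : 0 <= nsq p.
Proof. by apply: sumr_ge0 => i _; rewrite sqr_ge0. Qed.

Lemma nsq_le p : nsq p <= 3 * `|p| ^+ 2.
Proof.
have H i : crd i p ^+ 2 <= `|p| ^+ 2.
  by rewrite -(real_normK (num_real (crd i p))) lerXn2r ?nnegrE// norm_coord.
rewrite /nsq sum3; have := H i0; have := H i1; have := H i2; lra.
Qed.

Lemma sqr_norm_le p : `|p| ^+ 2 <= nsq p.
Proof.
have H i : crd i p ^+ 2 <= nsq p.
  by rewrite /nsq (bigD1 i)//= lerDl sumr_ge0// => j _; rewrite sqr_ge0.
rewrite -(@sqr_sqrtr _ (nsq p)) ?nsq_ge0// lerXn2r ?nnegrE ?sqrtr_ge0//.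
apply: norm_le_coord => i.
by rewrite -sqrtr_sqr ler_wsqrtr.
Qed.

Lemma norm_le_nsq p (a : R) : 0 <= a -> nsq p <= a ^+ 2 -> `|p| <= a.
Proof.
move=> a0 pa; rewrite -(@ler_pXn2r _ 2) ?nnegrE//.
exact: le_trans (sqr_norm_le p) pa.
Qed.

Lemma crd_vec (v : 'I_3 -> R3 R -> R) i p : crd i (vec v p) = v i p.
Proof. by case: i => -[|[|[|//]]] ?; congr (v _ p); apply/val_inj. Qed.

Lemma sum_crd_le (F G : 'I_3 -> R) (A B : R) : (forall i, `|F i| <= A) ->
  (forall i, `|G i| <= B) -> `|\sum_i F i * G i| <= 3 * (A * B).
Proof.
move=> FA GB; have H i : `|F i * G i| <= A * B by rewrite normrM ler_pM.
rewrite sum3; have := H i0; have := H i1; have := H i2.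
by rewrite !ler_norml; lra.
Qed.

Lemma nsqD p (w : R3 R) : nsq (p + w) = nsq p + 2 * (\sum_i crd i p * crd i w) + nsq w.
Proof. by rewrite /nsq !sum3 !coordD; ring. Qed.

Lemma nsq_lip p q (M : R) : `|p| <= M -> `|p - q| <= 1 ->
  `|nsq q - nsq p| <= (6 * M + 3) * `|p - q|.
Proof.
move=> pM pq1.
have -> : q = p + (q - p) by rewrite addrC subrK.
set w := q - p; rewrite nsqD.
have -> : p - (p + w) = - w by rewrite opprD addrA subrr add0r.
have w1 : `|w| <= 1 by rewrite distrC.
set S := \sum_i _; have -> : nsq p + 2 * S + nsq w - nsq p = 2 * S + nsq w by ring.
rewrite normrN (le_trans (ler_normD _ _))// [leRHS]mulrDl lerD//.
  rewrite normrM ger0_norm//.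
  have := @sum_crd_le (fun i => crd i p) (fun i => crd i w) `|p| `|w|
    (fun i => norm_coord i p) (fun i => norm_coord i w).
  have : `|p| * `|w| <= M * `|w| by rewrite ler_wpM2r.
  lra.
rewrite ger0_norm ?nsq_ge0// (le_trans (nsq_le w))// ler_pM2l// expr2.
by rewrite ler_piMl.
Qed.

End squared_norm.

Lemma I3P (i : 'I_3) : i = i0 \/ i = i1 \/ i = i2.
Proof.
by case: i => -[|[|[|//]]] ?; [left|right; left|right; right]; exact/val_inj.
Qed.

Section euler.
Context {R : realType}.

Lemma cc_lipschitz (f : R3 R -> R) (df : 'I_3 -> R3 R -> R) :
  (forall i, has_partial i f (df i)) -> (forall i, cc (df i)) ->
  exists L : R, 0 < L /\ forall p q, `|f p - f q| <= L * `|p - q|.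
Proof.
move=> fd dcc.
have H i : exists K : R, 0 < K /\ forall q s t, `|f (ins i q s) - f (ins i q t)| <= K * `|s - t|.
  have [K [K0 dK]] := cc_bounded (dcc i); exists K; split => // q s t.
  have [c _ ->] := mean_value t s (fd i q).
  by rewrite normrM ler_wpM2r.
have [K0 [K00 H0]] := H i0; have [K1 [K10 H1]] := H i1; have [K2 [K20 H2]] := H i2.
exists (K0 + K1 + K2); split; first by rewrite !addr_gt0.
move=> [[x y] z] [[x' y'] z'].
have h0 := H0 (y, z) x x'; have h1 := H1 (x', z) y y'; have h2 := H2 (x', y') z z'.
rewrite /ins/= in h0 h1 h2.
set P := (X in `|X|) in h0 *; set p := (x, y, z); set q := (x', y', z').
have n0 : `|x - x'| <= `|p - q| by exact: (norm_coord i0 (p - q)).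
have n1 : `|y - y'| <= `|p - q| by exact: (norm_coord i1 (p - q)).
have n2 : `|z - z'| <= `|p - q| by exact: (norm_coord i2 (p - q)).
have -> : f p - f q = (f p - f (x', y, z)) + (f (x', y, z) - f (x', y', z)) +
  (f (x', y', z) - f q) by ring.
rewrite !mulrDl; apply: (le_trans (ler_normD _ _)); apply: lerD.
  apply: (le_trans (ler_normD _ _)); apply: lerD.
    by rewrite (le_trans h0)// ler_pM2l.
  by rewrite (le_trans h1)// ler_pM2l.
by rewrite (le_trans h2)// ler_pM2l.
Qed.

Variables (v : 'I_3 -> R3 R -> R) (K L : R).
Hypotheses (K_gt0 : 0 < K) (v_le : forall i p, `|v i p| <= K).
Hypotheses (L_gt0 : 0 < L) (v_lip : forall i p q, `|v i p - v i q| <= L * `|p - q|).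

Lemma vec_lip p q : `|vec v p - vec v q| <= L * `|p - q|.
Proof. by apply: norm_le_coord => i; rewrite coordD coordN !crd_vec. Qed.

Lemma step_coords (h : R) p (S0 := shear i0 (fun p => h * v i0 p) p)
    (S1 := shear i1 (fun p => h * v i1 p) S0) :
  step v h p - p = (h * v i0 p, h * v i1 S0, h * v i2 S1).
Proof.
rewrite /step -/S0 -/S1; apply: coord_eq => i; rewrite coordD coordN.
have crd_shear j k (a : R3 R -> R) x :
    crd k (shear j a x) = crd k x + (if k == j then a x else 0).
  case: x => -[x1 x2] x3; rewrite /shear/=.
  by case: j => -[|[|[|//]]] ?; case: k => -[|[|[|//]]] ?; rewrite /crd/= ?addr0.
rewrite crd_shear /S1 crd_shear /S0 crd_shear -/S0 -/S1.
have n01 : (i0 == i1) = false by []; have n02 : (i0 == i2) = false by [].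
have n12 : (i1 == i2) = false by [].
have [->|[->|->]] := I3P i; rewrite ?eqxx ?n01 ?n02 ?n12 ?(eq_sym i1) ?(eq_sym i2)
  ?n01 ?n02 ?n12 [RHS]/crd/=; ring.
Qed.

Lemma step_sub_le (h : R) p : 0 <= h -> `|step v h p - p| <= h * K.
Proof.
move=> h0; rewrite step_coords !prod_normE/= !ge_max !normrM !(ger0_norm h0).
by rewrite !ler_wpM2l.
Qed.

(** The later shears of a step are evaluated at points that have already moved
    by at most [2 * h * K], which costs second order. *)
Lemma step_euler (h : R) p : 0 <= h -> `|step v h p - p - h *: vec v p| <= 2 * L * K * h ^+ 2.
Proof.
move=> h0; rewrite step_coords.
set S0 := shear i0 _ p; set S1 := shear i1 _ S0.
have s0 : `|S0 - p| <= h * K by rewrite norm_shear_sub normrM ger0_norm// ler_wpM2l.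
have s1 : `|S1 - p| <= 2 * (h * K).
  have -> : S1 - p = (S1 - S0) + (S0 - p) by rewrite addrA subrK.
  rewrite (le_trans (ler_normD _ _))// mulr2n mulrDl mul1r lerD//.
  by rewrite norm_shear_sub normrM ger0_norm// ler_wpM2l.
have E : h * (L * (2 * (h * K))) = 2 * L * K * h ^+ 2 by ring.
have P0 : 0 <= h * (L * (2 * (h * K))) by rewrite !mulr_ge0// ltW.
apply: norm_le_coord => i; rewrite coordD coordN coordZ crd_vec -E.
have e0 : crd i0 (h * v i0 p, h * v i1 S0, h * v i2 S1) = h * v i0 p by [].
have e1 : crd i1 (h * v i0 p, h * v i1 S0, h * v i2 S1) = h * v i1 S0 by [].
have e2 : crd i2 (h * v i0 p, h * v i1 S0, h * v i2 S1) = h * v i2 S1 by [].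
have [->|[->|->]] := I3P i.
- by rewrite e0 subrr normr0.
- rewrite e1 -mulrBr normrM ger0_norm// ler_wpM2l// (le_trans (v_lip _ _ _))//.
  rewrite ler_wpM2l//; first exact: ltW.
  by rewrite (le_trans s0)// ler_peMl// ?ler1n// mulr_ge0// ltW.
- rewrite e2 -mulrBr normrM ger0_norm// ler_wpM2l// (le_trans (v_lip _ _ _))//.
  by rewrite ler_wpM2l// ltW.
Qed.

Lemma nsq_step (M : R) : 0 <= M -> exists D : R, 0 < D /\ forall h p, 0 <= h <= 1 ->
  `|p| <= M -> `|nsq (step v h p) - nsq p - 2 * h * radial v p| <= D * h ^+ 2.
Proof.
move=> M0; pose D := 6 * (M * (2 * L * K)) + 3 * K ^+ 2.
exists D; split.
  have : 0 < K ^+ 2 by rewrite exprn_gt0.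
  have : 0 <= M * (2 * L * K) by rewrite !mulr_ge0// ltW.
  rewrite /D; lra.
move=> h p /andP[h0 h1] pM.
set w := step v h p - p.
have -> : step v h p = p + w by rewrite /w addrC subrK.
rewrite nsqD.
set e := w - h *: vec v p.
have we : w = h *: vec v p + e by rewrite /e addrC subrK.
have -> : \sum_i crd i p * crd i w = h * radial v p + \sum_i crd i p * crd i e.
  rewrite /radial !sum3 we !coordD !coordZ !crd_vec; ring.
have eh : `|e| <= 2 * L * K * h ^+ 2 by rewrite /e /w; exact: step_euler.
have wh : `|w| <= h * K by exact: step_sub_le.
have A1 := @sum_crd_le R (fun i => crd i p) (fun i => crd i e) _ _
    (fun i => norm_coord i p) (fun i => norm_coord i e).
have A2 := nsq_le w.
have B1 : `|p| * `|e| <= M * (2 * L * K * h ^+ 2) by rewrite ler_pM.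
have B2 : `|w| ^+ 2 <= (h * K) ^+ 2.
  by rewrite lerXn2r ?nnegrE// mulr_ge0// ltW.
have A3 := nsq_ge0 w.
set s := \sum_i _ in A1 *.
have -> : nsq p + 2 * (h * radial v p + s) + nsq w - nsq p - 2 * h * radial v p
   = 2 * s + nsq w by ring.
have -> : D * h ^+ 2 = 6 * (M * (2 * L * K * h ^+ 2)) + 3 * (h * K) ^+ 2 by rewrite /D; ring.
move: A1; rewrite !ler_norml; lra.
Qed.

Lemma iter_step_sub (h : R) p n : 0 <= h -> `|iter n (step v h) p - p| <= n%:R * h * K.
Proof.
move=> h0; elim: n => [|n IHn]; first by rewrite subrr normr0 !mul0r.
rewrite iterS -natr1 !mulrDl mul1r.
have -> : step v h (iter n (step v h) p) - p =
  (step v h (iter n (step v h) p) - iter n (step v h) p) + (iter n (step v h) p - p).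
  by rewrite addrA subrK.
rewrite (le_trans (ler_normD _ _))// addrC lerD//.
exact: step_sub_le.
Qed.

End euler.

Section tracking.
Context {R : realType}.
Variables (v : 'I_3 -> R3 R -> R) (K L : R).
Hypotheses (v_cc : forall i, cc (v i)).
Hypotheses (K_gt0 : 0 < K) (v_le : forall i p, `|v i p| <= K).
Hypotheses (L_gt0 : 0 < L) (v_lip : forall i p q, `|v i p - v i q| <= L * `|p - q|).

Lemma cc_radial : cc (radial v).
Proof.
apply: cc_sum => i; have := ccM (v_cc i) (@continuous_coord R i).
by under eq_fun do rewrite mulrC.
Qed.

(** Near [p] the radial component stays above [delta / 2], so that the squared
    radius grows at a fixed rate. If the missing amount [tau] is small, it is
    gained before the orbit has left that neighbourhood. *)
Lemma exit_time (c delta : R) : 0 < delta ->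
  exists tau0 : R, 0 < tau0 /\ forall tau, 0 < tau <= tau0 ->
  exists h0 : R, 0 < h0 /\ forall h, 0 < h < h0 -> forall p,
  delta <= radial v p -> c - tau <= nsq p ->
  exists n, c <= nsq (iter n (step v h) p) /\
    forall j, (j <= n)%N -> c - tau <= nsq (iter j (step v h) p).
Proof.
move=> delta0.
have [M [M0 rM]] := cc_support cc_radial.
have [d1 [d10 rd]] := cc_unif cc_radial (divr_gt0 delta0 (ltr0n R 2)).
pose d := Num.min d1 1; have d0 : 0 < d by rewrite lt_min d10 ltr01.
have M10 : 0 <= M + 1 by rewrite addr_ge0// ltW.
have [D [D0 stepD]] := nsq_step K_gt0 v_le L_gt0 v_lip M10.
exists (d * delta / (4 * K)); split; first by rewrite divr_gt0// mulr_gt0.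
move=> tau /andP[tau0 taud]; rewrite ler_pdivlMr ?mulr_gt0// in taud.
pose h0 := Num.min 1 (Num.min (delta / (2 * D)) (d / (2 * K))).
exists h0; split.
  by rewrite /h0 !lt_min ltr01 (divr_gt0 delta0 (mulr_gt0 _ D0)) ?(divr_gt0 d0 (mulr_gt0 _ K_gt0)).
move=> h /andP[hp]; rewrite /h0 !lt_min => /and3P[h1 hD hK] p rp taup.
rewrite ltr_pdivlMr ?mulr_gt0// in hD; rewrite ltr_pdivlMr ?mulr_gt0// in hK.
have pM : `|p| <= M.
  by rewrite leNgt; apply/negP => /rM r0; move: rp; rewrite r0 leNgt delta0.
have grow j : j%:R * h * K < d ->
    nsq p + j%:R * h * (delta / 2) <= nsq (iter j (step v h) p).
  elim: j => [|j IHj]; first by rewrite !mul0r addr0.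
  rewrite -natr1 2!mulrDl mul1r => jd.
  have jd' : j%:R * h * K < d by rewrite (le_lt_trans _ jd)// lerDl mulr_ge0// ltW.
  have {}IHj := IHj jd'.
  set x := iter j (step v h) p in IHj *.
  have xp : `|x - p| < d.
    by apply: le_lt_trans jd'; apply: iter_step_sub => //; exact: ltW.
  have xM : `|x| <= M + 1.
    have -> : x = p + (x - p) by rewrite addrC subrK.
    rewrite (le_trans (ler_normD _ _))// lerD// ltW// (lt_le_trans xp)//.
    by rewrite ge_min lexx orbT.
  have rx : delta / 2 <= radial v x.
    have : `|radial v x - radial v p| < delta / 2.
      by apply: rd; rewrite (lt_le_trans xp)// ge_min lexx.
    rewrite ltr_norml => /andP[+ _]; lra.
  have h01 : 0 <= h <= 1 by rewrite !ltW.
  have := stepD h x h01 xM; rewrite ler_norml => /andP[+ _].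
  have : D * h ^+ 2 <= h * (delta / 2) by rewrite expr2 mulrCA ler_pM2l//; lra.
  have : 2 * h * (delta / 2) <= 2 * h * radial v x by rewrite ler_pM2l// mulr_gt0.
  rewrite iterS -/x; move: IHj; lra.
pose n := (Num.truncn (2 * tau / (h * delta))).+1.
have nd : n%:R * h * K < d.
  have A : (Num.truncn (2 * tau / (h * delta)))%:R <= 2 * tau / (h * delta).
    by rewrite truncn_le// divr_ge0// mulr_ge0// ltW.
  have {}A : n%:R <= 2 * tau / (h * delta) + 1 by rewrite /n -natr1 lerD2r.
  have {}A : n%:R * h * K <= (2 * tau / (h * delta) + 1) * h * K.
    by rewrite ler_pM2r// ler_pM2r.
  have B : (2 * tau / (h * delta) + 1) * h * K = (tau * (4 * K)) / (2 * delta) + h * K.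
    by field; rewrite !gt_eqF.
  have : (tau * (4 * K)) / (2 * delta) <= d / 2.
    by rewrite ler_pdivrMr ?mulr_gt0//; move: taud; lra.
  by move: A; rewrite B; lra.
have nj j : (j <= n)%N -> j%:R * h * K < d.
  move=> jn; rewrite (le_lt_trans _ nd)// ler_pM2r// ler_pM2r//.
  by rewrite ler_nat.
exists n; split.
  apply: le_trans (grow n nd).
  have : 2 * tau / (h * delta) <= n%:R by rewrite ltW// truncnS_gt.
  rewrite ler_pdivrMr ?mulr_gt0// mulrA => H; move: taup; lra.
move=> j jn; apply: le_trans (grow j (nj j jn)); rewrite (le_trans taup)// lerDl.
by rewrite mulr_ge0// ?mulr_ge0// ?divr_ge0// ltW.
Qed.

Variables (gam : R -> R3 R) (s1 : R).
Hypothesis s1_gt0 : 0 < s1.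
Hypothesis gam_cont : forall i, {within `[0, s1], continuous (fun t => crd i (gam t))}.
Hypothesis gam_der : forall i t, 0 < t < s1 ->
  is_derive t (1 : R) (fun t => crd i (gam t)) (v i (gam t)).

Lemma gam_mean i s t : 0 <= s -> s < t -> t <= s1 -> exists c, s < c < t /\
  crd i (gam t) - crd i (gam s) = v i (gam c) * (t - s).
Proof.
move=> s0 st ts1.
have [||c cst E] := @MVT _ (fun t => crd i (gam t)) (fun t => v i (gam t)) s t st.
- move=> x; rewrite in_itv/= => /andP[sx xt]; apply: gam_der.
  by rewrite (le_lt_trans s0 sx) (lt_le_trans xt ts1).
- apply: (@continuous_subspaceW _ _ `[s, t]%classic `[0, s1]%classic); last exact: gam_cont.
  move=> x /=; rewrite !in_itv/= => /andP[sx xt].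
  by rewrite (le_trans s0 sx) (le_trans xt ts1).
by exists c; split.
Qed.

Lemma gam_lip s t : 0 <= s -> s <= t -> t <= s1 -> `|gam t - gam s| <= K * (t - s).
Proof.
move=> s0; rewrite le_eqVlt => /predU1P[<-|st] ts1; first by rewrite !subrr normr0 mulr0.
apply: norm_le_coord => i; rewrite coordD coordN.
have [c [_ ->]] := gam_mean i s0 st ts1.
have ts0 : 0 < t - s by rewrite subr_gt0.
by rewrite normrM (gtr0_norm ts0) ler_pM2r.
Qed.

Lemma gam_euler s t : 0 <= s -> s < t -> t <= s1 ->
  `|gam t - gam s - (t - s) *: vec v (gam s)| <= L * K * (t - s) ^+ 2.
Proof.
move=> s0 st ts1; have ts0 : 0 < t - s by rewrite subr_gt0.
apply: norm_le_coord => i; rewrite !coordD !coordN coordZ crd_vec.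
have [c [/andP[sc ct] ->]] := gam_mean i s0 st ts1.
rewrite [(t - s) * _]mulrC -mulrBl normrM (gtr0_norm ts0) expr2 mulrA ler_pM2r//.
rewrite (le_trans (v_lip _ _ _))// -mulrA ler_pM2l//.
rewrite (le_trans (gam_lip s0 (ltW sc) (ltW (lt_le_trans ct ts1))))//.
by rewrite ler_pM2l// lerD2r ltW.
Qed.

(** Discrete Gronwall inequality. Adding [3 * K * h] to the error absorbs the
    local errors [2 * L * K * h ^+ 2] of the step and [L * K * h ^+ 2] of the
    streamline. *)
Lemma euler_tracking (h : R) p n : 0 < h -> n%:R * h <= s1 ->
  `|iter n (step v h) p - gam (n%:R * h)| <=
    expR (L * s1) * (`|p - gam 0| + 3 * K * h).
Proof.
move=> h0 ns1.
have H j : (j <= n)%N -> `|iter j (step v h) p - gam (j%:R * h)| + 3 * K * h <=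
    (1 + h * L) ^+ j * (`|p - gam 0| + 3 * K * h).
  elim: j => [|j IHj] jn; first by rewrite mul0r expr0 mul1r.
  have {}IHj := IHj (ltnW jn).
  set x := iter j (step v h) p in IHj *.
  set s := j%:R * h in IHj *.
  have tE : j.+1%:R * h = s + h by rewrite -natr1 mulrDl mul1r.
  have s0 : 0 <= s by rewrite mulr_ge0// ltW.
  have ts1 : s + h <= s1.
    by rewrite -tE (le_trans _ ns1)// ler_pM2r// ler_nat.
  have st : s < s + h by rewrite ltrDl.
  rewrite iterS -/x tE exprS -[leRHS]mulrA.
  have E1 := step_euler K_gt0 v_le L_gt0 v_lip x (ltW h0).
  have E2 := gam_euler s0 st ts1.
  have hE : s + h - s = h by rewrite addrC addrA addNr add0r.
  rewrite hE in E2.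
  have E3 : `|h *: (vec v x - vec v (gam s))| <= h * (L * `|x - gam s|).
    by rewrite normrZ gtr0_norm// ler_pM2l//; exact: vec_lip.
  have -> : step v h x - gam (s + h) = (x - gam s) + h *: (vec v x - vec v (gam s)) +
     (step v h x - x - h *: vec v x) - (gam (s + h) - gam s - h *: vec v (gam s)).
    by apply: coord_eq => i; rewrite !(coordD, coordN, coordZ); ring.
  have T := ler_normD ((x - gam s) + h *: (vec v x - vec v (gam s)) +
     (step v h x - x - h *: vec v x)) (- (gam (s + h) - gam s - h *: vec v (gam s))).
  rewrite normrN in T.
  have T2 := ler_normD ((x - gam s) + h *: (vec v x - vec v (gam s)))
     (step v h x - x - h *: vec v x).
  have T3 := ler_normD (x - gam s) (h *: (vec v x - vec v (gam s))).
  have : (1 + h * L) * (`|x - gam s| + 3 * K * h) <=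
    (1 + h * L) * ((1 + h * L) ^+ j * (`|p - gam 0| + 3 * K * h)).
    by rewrite ler_pM2l// addr_gt0// mulr_gt0.
  apply: le_trans.
  have -> : (1 + h * L) * (`|x - gam s| + 3 * K * h) = `|x - gam s| + h * (L * `|x - gam s|)
    + 2 * L * K * h ^+ 2 + L * K * h ^+ 2 + 3 * K * h by ring.
  rewrite lerD2r; move: E1 E2 E3 T T2 T3; lra.
have P0 : 0 <= `|p - gam 0| + 3 * K * h by rewrite addr_ge0// !mulr_ge0// ltW.
apply: (@le_trans _ _ ((1 + h * L) ^+ n * (`|p - gam 0| + 3 * K * h))).
  by apply: le_trans (H n (leqnn n)); rewrite lerDl !mulr_ge0// ltW.
rewrite ler_wpM2r//.
apply: (@le_trans _ _ (expR (h * L) ^+ n)).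
  rewrite lerXn2r ?nnegrE ?expR_ge0//; last exact: expR_ge1Dx.
  by rewrite addr_ge0// mulr_ge0// ltW.
rewrite -expRM_natl ler_expR mulrA [L * _]mulrC ler_pM2r//.
Qed.

End tracking.

Definition bump {R : realType} (c : R) (m : nat) (p : R3 R) : R :=
  clip (m.+1%:R * (c - nsq p)).

(** Approximate indicator of the points of the ball [nsq < a] whose trajectory
    enters [nsq < r] before it leaves [nsq < a]. The number of steps makes the
    covered time tend to infinity while the step length tends to zero. *)
Definition reaching {R : realType} (v : 'I_3 -> R3 R -> R) (a r : R) (m : nat) : R3 R -> R :=
  reach (step v m.+1%:R^-1) (bump a m) (bump r m) (m.+1 * m.+1).

Section reaching_theory.
Context {R : realType}.
Variables (v : 'I_3 -> R3 R -> R) (K L : R).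
Hypotheses (v_cc : forall i, cc (v i)).
Hypotheses (K_gt0 : 0 < K) (v_le : forall i p, `|v i p| <= K).
Hypotheses (L_gt0 : 0 < L) (v_lip : forall i p q, `|v i p - v i q| <= L * `|p - q|).

Lemma bump_ge0 c m (p : R3 R) : 0 <= bump c m p. Proof. exact: clip_ge0. Qed.
Lemma bump_le1 c m (p : R3 R) : bump c m p <= 1. Proof. exact: clip_le1. Qed.

Lemma bump0 c m (p : R3 R) : c <= nsq p -> bump c m p = 0.
Proof. by move=> cp; apply: clip0; rewrite mulr_ge0_le0// subr_le0. Qed.

Lemma bump1 c m e (p : R3 R) : 0 < e -> nsq p <= c - e -> e^-1 <= m.+1%:R -> bump c m p = 1.
Proof.
move=> e0 pe em; apply: clip1.
rewrite -[leLHS](mulVf (lt0r_neq0 e0)) ler_pM// ?invr_ge0 ?(ltW e0)//.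
lra.
Qed.

Lemma continuous_bump c m : continuous (@bump R c m).
Proof. by have cn := @continuous_nsq R; apply: continuous_clip; continuity. Qed.

Lemma continuous_reaching a r m : continuous (reaching v a r m).
Proof.
apply: continuous_reach; [|exact: continuous_bump..].
by apply: continuous_step => i; case: (v_cc i).
Qed.

Lemma reaching_unit a r m : unit_valued (reaching v a r m).
Proof. by apply: reach_unit => p; rewrite ?bump_ge0 ?bump_le1. Qed.

Lemma reaching_step a r m p : r <= nsq p ->
  reaching v a r m p <= reaching v a r m (step v m.+1%:R^-1 p).
Proof.
by move=> rp; apply: reach_step => *; rewrite ?bump_ge0 ?bump_le1 ?bump0.
Qed.

Lemma near_infty_inv (e : R) : 0 < e -> exists m0, forall m, (m0 <= m)%N ->
  0 < (m.+1%:R^-1 : R) < e /\ e^-1 <= m.+1%:R.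
Proof.
move=> e0; exists (Num.truncn e^-1) => m m0.
have H : e^-1 < m.+1%:R by rewrite (lt_le_trans (truncnS_gt _))// ler_nat ltnS.
split; last exact: ltW.
by rewrite invr_gt0 ltr0n/= -(invrK e) ltf_pV2// posrE ?invr_gt0.
Qed.

(** A point of a thin shell below the outer sphere with outward radial component
    leaves the ball [nsq < a] before it can meet the target. *)
Lemma reaching_exit (a r delta : R) : r < a -> 0 < delta ->
  exists tau0 : R, 0 < tau0 /\ forall tau, 0 < tau <= tau0 ->
  exists m0, forall m, (m0 <= m)%N -> forall p,
  delta <= radial v p -> a - tau <= nsq p -> reaching v a r m p = 0.
Proof.
move=> ra delta0.
have [t0 [t00 H]] := exit_time v_cc K_gt0 v_le L_gt0 v_lip a delta0.
exists (Num.min t0 (a - r)); split; first by rewrite lt_min t00 subr_gt0.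
move=> tau /andP[tau0]; rewrite le_min => /andP[tau1 tau2].
have [|h0 [h00 {}H]] := H tau; first by rewrite tau0.
have [m0 Hm] := near_infty_inv h00; exists m0 => m m0m p dp pt.
have [n [n1 n2]] := H _ (Hm m m0m).1 p dp pt.
apply: (@reach_exit _ _ _ _ _ _ _ n) => *; rewrite ?bump_ge0 ?bump_le1 ?bump0//.
by rewrite (le_trans _ (n2 _ _))//; lra.
Qed.

(** For a short time [s0] the streamline is close to the outer sphere, and the
    Euler orbits stay inside because [radial] is still negative. After [s0] the
    streamline has a positive distance [mx < a ^+ 2] from the sphere, and it is
    enough that the orbits follow it. *)
Lemma reaching_near_streamline (a r : R) (gam : R -> R3 R) (s1 : R) :
  0 < a -> 0 < s1 ->
  (forall i, {within `[0, s1], continuous (fun t => crd i (gam t))}) ->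
  (forall i t, 0 < t < s1 ->
     is_derive t (1 : R) (fun t => crd i (gam t)) (v i (gam t))) ->
  nsq (gam 0) = a ^+ 2 -> radial v (gam 0) < 0 ->
  (forall t, 0 < t <= s1 -> nsq (gam t) < a ^+ 2) -> nsq (gam s1) < r ->
  exists rho0, 0 <= rho0 < 1 /\ forall rho, rho0 < rho < 1 ->
  exists m0, forall m, (m0 <= m)%N -> reaching v (a ^+ 2) r m (rho *: gam 0) = 1.
Proof.
move=> a0 s10 gc gd g0 rg0 gin gr.
set eta := gam 0 in g0 rg0 *.
have etaa : `|eta| <= a by apply: norm_le_nsq; [exact: ltW|rewrite g0].
pose theta := - radial v eta / 2.
have theta0 : 0 < theta by rewrite divr_gt0// oppr_gt0.
have [d [d0 rd]] := cc_unif (cc_radial v_cc) theta0.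
have M0 : 0 <= a + d by rewrite addr_ge0// ltW.
have [D [D0 stepD]] := nsq_step K_gt0 v_le L_gt0 v_lip M0.
pose s0 := Num.min s1 (d / (2 * K)).
have s00 : 0 < s0 by rewrite /s0 lt_min s10 divr_gt0// mulr_gt0.
have s01 : s0 <= s1 by rewrite ge_min lexx.
have [mx [mxa gmx]] : exists mx, mx < a ^+ 2 /\ forall t, s0 <= t <= s1 -> nsq (gam t) <= mx.
  have [|c cin cmax] := @EVT_max R (fun t => nsq (gam t)) s0 s1 s01.
    have -> : (fun t => nsq (gam t)) = (fun t => crd i0 (gam t) * crd i0 (gam t)
       + crd i1 (gam t) * crd i1 (gam t) + crd i2 (gam t) * crd i2 (gam t)).
      by apply/funext => t; rewrite /nsq sum3 !expr2.
    have gcs i : {within `[s0, s1], continuous (fun t => crd i (gam t))}.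
      apply: (@continuous_subspaceW _ _ `[s0, s1]%classic `[0, s1]%classic); last exact: gc.
      move=> x /=; rewrite !in_itv/= => /andP[sx ->]; rewrite andbT.
      by rewrite (le_trans (ltW s00)).
    by move=> t; apply: cvgD; [apply: cvgD|]; apply: cvgM; exact: gcs.
  exists (nsq (gam c)); split.
    move: cin; rewrite in_itv/= => /andP[c0 c1].
    by apply: gin; rewrite (lt_le_trans s00 c0) c1.
  by move=> t ts; apply: cmax; rewrite in_itv.
pose e := Num.min (a ^+ 2 - mx) (r - nsq (gam s1)).
have e0 : 0 < e by rewrite lt_min !subr_gt0 mxa.
pose W := 6 * a + 3.
have W0 : 0 < W by rewrite addr_gt0// mulr_gt0.
pose w := Num.min 1 (e / 2 / W).
have w0 : 0 < w by rewrite lt_min ltr01 !divr_gt0.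
pose X := expR (L * s1).
have X0 : 0 < X by exact: expR_gt0.
pose kap := Num.min 1 (Num.min (d / (2 * a)) (w / (4 * X * a))).
have kap0 : 0 < kap.
  rewrite /kap !lt_min ltr01 (divr_gt0 d0 (mulr_gt0 _ a0))//=.
  by rewrite (divr_gt0 w0 (mulr_gt0 (mulr_gt0 _ X0) a0)).
exists (1 - kap); split.
  by rewrite subr_ge0 /kap ge_min lexx/= gtrBl.
move=> rho /andP[rho0 rho1].
set p := rho *: eta.
have rhop : 0 < rho by rewrite (le_lt_trans _ rho0)// subr_ge0 /kap ge_min lexx.
have pe : `|p - eta| <= (1 - rho) * a.
  have -> : p - eta = - ((1 - rho) *: eta) by rewrite scalerBl scale1r opprB.
  have r1 : 0 <= 1 - rho by rewrite subr_ge0 ltW.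
  by rewrite normrN normrZ (ger0_norm r1) ler_wpM2l.
have k1 : 1 - rho < kap by lra.
have pd2 : `|p - eta| < d / 2.
  rewrite (le_lt_trans pe)//.
  have : 1 - rho < d / (2 * a) by rewrite (lt_le_trans k1)// /kap !ge_min lexx !orbT.
  by rewrite ltr_pdivlMr ?mulr_gt0// => H; lra.
have pw : X * `|p - eta| <= w / 4.
  have : 1 - rho < w / (4 * X * a) by rewrite (lt_le_trans k1)// /kap !ge_min lexx !orbT.
  rewrite ltr_pdivlMr ?mulr_gt0// => H.
  have : X * `|p - eta| <= X * ((1 - rho) * a) by rewrite ler_pM2l.
  lra.
have np : nsq p = rho ^+ 2 * a ^+ 2.
  by rewrite -g0 /nsq mulr_sumr; apply: eq_bigr => i _; rewrite coordZ exprMn.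
pose gap := (1 - rho ^+ 2) * a ^+ 2.
have gap0 : 0 < gap.
  by rewrite mulr_gt0 ?exprn_gt0// subr_gt0 exprn_ilt1// ltW.
pose h0 := Num.min (Num.min 1 (2 * theta / D)) (Num.min (Num.min gap (e / 2))
  (Num.min (w / (12 * K * X)) (w / (4 * K)))).
have h00 : 0 < h0.
  rewrite /h0 !lt_min ltr01 gap0 (divr_gt0 (mulr_gt0 (ltr0n R 2) theta0) D0)/=.
  rewrite (divr_gt0 e0 (ltr0n R 2)) (divr_gt0 w0 (mulr_gt0 (ltr0n R 4) K_gt0)).
  by rewrite (divr_gt0 w0 (mulr_gt0 (mulr_gt0 (ltr0n R 12) K_gt0) X0)).
have [m1 Hm1] := near_infty_inv h00.
have [m2 Hm2] := near_infty_inv gap0.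
have [m3 Hm3] := near_infty_inv (divr_gt0 e0 (ltr0n R 2)).
have s1V : 0 < s1^-1 by rewrite invr_gt0.
have [m4 Hm4] := near_infty_inv s1V.
exists (maxn (maxn m1 m2) (maxn m3 m4)) => m.
rewrite !geq_max => /andP[/andP[/Hm1[/andP[hp hh] _] /Hm2[_ mgap]] /andP[/Hm3[_ me] m4m]].
set h := (m.+1%:R^-1 : R) in hp hh *.
move: hh; rewrite /h0 !lt_min => /andP[/andP[h1 hD] /and3P[/andP[hgap he] hK1 hK2]].
rewrite ltr_pdivlMr// in hD; rewrite ltr_pdivlMr ?mulr_gt0// in hK1.
rewrite ltr_pdivlMr ?mulr_gt0// in hK2.
have h01 : 0 <= h <= 1 by rewrite !ltW.
pose x j := iter j (step v h) p.
have xp j : `|x j - p| <= j%:R * h * K by apply: iter_step_sub => //; exact: ltW.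
(* phase 1: the radial component stays negative up to time s0 *)
have phase1 j : j%:R * h <= s0 -> nsq (x j) <= nsq p.
  elim: j => [//|j IHj] js0.
  have jh : j%:R * h <= s0 by rewrite (le_trans _ js0)// ler_pM2r// ler_nat.
  have xe : `|x j - eta| < d.
    have -> : x j - eta = (x j - p) + (p - eta) by rewrite addrA subrK.
    rewrite (le_lt_trans (ler_normD _ _))// (splitr d) ler_ltD//.
    rewrite (le_trans (xp j))//.
    have : j%:R * h <= d / (2 * K) by rewrite (le_trans jh)// ge_min lexx orbT.
    by rewrite ler_pdivlMr ?mulr_gt0//; lra.
  have rx : radial v (x j) <= - theta.
    by have := rd _ _ xe; rewrite ltr_norml /theta => /andP[_]; lra.
  have xM : `|x j| <= a + d.
    have -> : x j = eta + (x j - eta) by rewrite addrC subrK.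
    by rewrite (le_trans (ler_normD _ _))// lerD// ltW.
  have := stepD h (x j) h01 xM; rewrite ler_norml => /andP[_].
  have : D * h ^+ 2 <= h * (2 * theta) by rewrite expr2 mulrCA ler_pM2l// mulrC ltW.
  have : 2 * h * radial v (x j) <= 2 * h * (- theta) by rewrite ler_pM2l// mulr_gt0.
  have := IHj jh; rewrite /x iterS; lra.
(* phase 2: afterwards the iterates follow the streamline *)
have follow j : j%:R * h <= s1 -> nsq (x j) <= nsq (gam (j%:R * h)) + e / 2 /\
    `|x j - gam (j%:R * h)| <= w / 2.
  move=> js1.
  have D1 := euler_tracking K_gt0 v_le L_gt0 v_lip gc gd p hp js1.
  rewrite -/(x j) -/X -/eta in D1.
  have {}D1 : `|x j - gam (j%:R * h)| <= w / 2.
    rewrite (le_trans D1)// mulrDr; move: pw hK1; lra.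
  split=> //.
  have gj : `|gam (j%:R * h)| <= a.
    apply: norm_le_nsq; first exact: ltW.
    have [->|j0] := eqVneq j 0%N; first by rewrite mul0r g0.
    by rewrite ltW// gin// js1 mulr_gt0// ltr0n lt0n.
  have D2 : `|gam (j%:R * h) - x j| <= 1.
    by rewrite distrC (le_trans D1)// (@le_trans _ _ (1 / 2))// ?ler_pM2r// ?ge_min ?lexx//; lra.
  have := nsq_lip gj D2; rewrite ler_norml distrC => /andP[_].
  have : (6 * a + 3) * `|x j - gam (j%:R * h)| <= W * (w / 2) by rewrite ler_pM2l.
  have : w <= e / 2 / W by rewrite ge_min lexx orbT.
  by rewrite ler_pdivlMr//; lra.
have gapE : nsq p = a ^+ 2 - gap by rewrite np /gap; ring.
pose n := Num.truncn (s1 * m.+1%:R).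
have hm : h * m.+1%:R = 1 by rewrite mulVf// pnatr_eq0.
have hm' : s1 * m.+1%:R * h = s1 by rewrite -mulrA [m.+1%:R * h]mulrC hm mulr1.
have ns1 : n%:R * h <= s1.
  have : n%:R <= s1 * m.+1%:R by rewrite truncn_le// mulr_ge0// ltW.
  by rewrite -(ler_pM2r hp) hm'.
have s1n : s1 - h <= n%:R * h.
  have : s1 * m.+1%:R < n.+1%:R by exact: truncnS_gt.
  by rewrite -(ltr_pM2r hp) hm' -natr1 mulrDl mul1r -/n; lra.
have s1m : s1 <= m.+1%:R.
  by have [_] := Hm4 _ m4m; rewrite invrK.
rewrite /reaching -/h; apply: (reach_hit _ _ _ _ (n := n)) => [q|q|q|q||j jn|].
- exact: bump_ge0.
- exact: bump_le1.
- exact: bump_ge0.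
- exact: bump_le1.
- rewrite -(ler_nat R) natrM (@le_trans _ _ (s1 * m.+1%:R))//.
    by rewrite truncn_le// mulr_ge0// ltW.
  by rewrite ler_pM2r.
- have jh : j%:R * h <= s1.
    by rewrite (le_trans _ ns1)// ler_pM2r// ler_nat.
  have [js0|js0] := leP (j%:R * h) s0.
    by apply: (bump1 gap0) => //; rewrite (le_trans (phase1 j js0)) ?gapE.
  apply: (bump1 (divr_gt0 e0 (ltr0n R 2))) => //.
  have [+ _] := follow j jh.
  have : nsq (gam (j%:R * h)) <= mx by apply: gmx; rewrite (ltW js0).
  have : e <= a ^+ 2 - mx by rewrite ge_min lexx.
  rewrite -/(x j); lra.
- apply: (bump1 (divr_gt0 e0 (ltr0n R 2))) => //.
  rewrite -/(x n).
  have [_ xg] := follow n ns1.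
  have nh0 : 0 <= n%:R * h by rewrite mulr_ge0// ltW.
  have gg := gam_lip v_le gc gd nh0 ns1 (lexx s1).
  have D1 : `|gam s1 - x n| <= w.
    have -> : gam s1 - x n = (gam s1 - gam (n%:R * h)) - (x n - gam (n%:R * h)).
      by rewrite opprB addrA subrK.
    rewrite (le_trans (ler_normB _ _))//.
    have : K * (s1 - n%:R * h) <= K * h by rewrite ler_pM2l//; lra.
    move: gg xg hK2; lra.
  have gs1 : `|gam s1| <= a.
    by apply: norm_le_nsq; [exact: ltW|rewrite ltW// gin// s10 lexx].
  have D2 : `|gam s1 - x n| <= 1 by rewrite (le_trans D1)// ge_min lexx.
  have := nsq_lip gs1 D2; rewrite ler_norml => /andP[_].
  have : W * `|gam s1 - x n| <= W * w by rewrite ler_pM2l.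
  have : w <= e / 2 / W by rewrite ge_min lexx orbT.
  rewrite ler_pdivlMr//.
  have : e <= r - nsq (gam s1) by rewrite ge_min lexx orbT.
  rewrite -/W; lra.
Qed.

End reaching_theory.

(** * Spherical coordinates *)

Section tonelli_on_rectangles.
Context {R : realType}.

Lemma tonelli_rectangle (D1 D2 : set R) (f : R * R -> \bar R) :
  measurable (D1 : set (mR R)) -> measurable (D2 : set (mR R)) ->
  measurable_fun [set: mR2 R] f -> (forall q, 0 <= f q)%E ->
  (\int[leb \x leb]_(q in D1 `*` D2) f q = \int[leb]_(x in D1) \int[leb]_(y in D2) f (x, y) /\
   \int[leb]_(x in D1) \int[leb]_(y in D2) f (x, y) =
     \int[leb]_(y in D2) \int[leb]_(x in D1) f (x, y))%E.
Proof.
move=> mD1 mD2 mf f0.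
pose F : R * R -> \bar R := f \_ (D1 `*` D2).
have mF : measurable_fun [set: mR2 R] F.
  apply/(measurable_restrictT _ (measurableX mD1 mD2)).
  exact: measurable_funTS.
have F0 q : (0 <= F q)%E by rewrite /F patchE; case: ifP.
have T1 := @fubini_tonelli1 _ _ _ _ R leb leb F mF F0.
have T2 := @fubini_tonelli _ _ _ _ R leb leb F mF F0.
have E1 : (\int[leb]_x \int[leb]_y F (x, y) =
    \int[leb]_(x in D1) \int[leb]_(y in D2) f (x, y))%E.
  rewrite [RHS]integral_mkcond; apply: eq_integral => x _; rewrite patchE.
  case: ifPn => xD1.
    rewrite [RHS]integral_mkcond; apply: eq_integral => y _; rewrite /F !patchE.
    by rewrite in_setX/= xD1.
  apply: integral0_eq => y _; rewrite /F patchE in_setX/=.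
  by rewrite (negbTE xD1).
have E2 : (\int[leb]_y \int[leb]_x F (x, y) =
    \int[leb]_(y in D2) \int[leb]_(x in D1) f (x, y))%E.
  rewrite [RHS]integral_mkcond; apply: eq_integral => y _; rewrite patchE.
  case: ifPn => yD2.
    rewrite [RHS]integral_mkcond; apply: eq_integral => x _; rewrite /F !patchE.
    by rewrite in_setX/= yD2 andbT.
  apply: integral0_eq => x _; rewrite /F patchE in_setX/=.
  by rewrite (negbTE yD2) andbF.
split; last by rewrite -E1 T2 E2.
rewrite -E1 [LHS]integral_mkcond; exact: T1.
Qed.

Lemma measurable_continuous2 (f : R * R -> R) : continuous f ->
  measurable_fun [set: mR2 R] (EFin \o f).
Proof. by move=> cf; apply/measurable_EFinP; exact: continuous_measurable2. Qed.

Lemma measurable_line_integral (K : R3 R -> R) : continuous K -> (forall p, 0 <= K p) ->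
  measurable_fun [set: mR2 R] (fun q => \int[leb]_t (K (q, t))%:E)%E.
Proof.
move=> cK K0.
apply: (@measurable_fun_fubini_tonelli_F _ _ _ _ R leb (EFin \o K)).
  exact: cc_measurable.
by move=> p; rewrite lee_fin.
Qed.

Lemma measurable_strip_integral (D : set R) (f : R * R -> R) :
  measurable (D : set (mR R)) -> continuous f -> (forall q, 0 <= f q) ->
  measurable_fun [set: mR R] (fun r => \int[leb]_(t in D) (f (r, t))%:E)%E.
Proof.
move=> mD cf f0.
pose F : R * R -> \bar R := (EFin \o f) \_ ([set: R] `*` D).
have -> : (fun r => \int[leb]_(t in D) (f (r, t))%:E)%E = (fun r => \int[leb]_t F (r, t))%E.
  apply/funext => r; rewrite integral_mkcond; apply: eq_integral => t _.
  by rewrite /F !patchE in_setX/= in_setT.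
apply: (@measurable_fun_fubini_tonelli_F _ _ _ _ R leb F).
  have mTD := @measurableX _ _ (mR R) (mR R) [set: R] D measurableT mD.
  apply/(measurable_restrictT _ mTD); apply: measurable_funTS.
  exact: measurable_continuous2.
by move=> q; rewrite /F patchE; case: ifP => // _; rewrite lee_fin.
Qed.

Lemma measurable_line_integral2 (f : R * R -> R) : continuous f -> (forall q, 0 <= f q) ->
  measurable_fun [set: mR R] (fun y => \int[leb]_x (f (x, y))%:E)%E.
Proof.
move=> cf f0.
apply: (@measurable_fun_fubini_tonelli_G _ _ _ _ R leb (EFin \o f)).
  exact: measurable_continuous2.
by move=> q; rewrite lee_fin.
Qed.

Lemma measurable_continuous1 (f : R -> R) : continuous f ->
  measurable_fun [set: mR R] (EFin \o f).
Proof. by move=> cf; apply/measurable_EFinP; exact: continuous_measurable_fun. Qed.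

End tonelli_on_rectangles.

Section polar.
Context {R : realType}.

Lemma integral_scale (c : R) (G : R -> R) : 0 < c -> continuous G -> (forall x, 0 <= G x) ->
  (\int[leb]_x (G x)%:E = \int[leb]_t (G (c * t) * c)%:E)%E.
Proof.
move=> c0 cG G0.
have XD (t : R) : is_derive t (1 : R) (fun t : R => c * t) c.
  rewrite -[X in is_derive _ _ _ X]mulr1; exact: is_deriveZ.
have XE : derive1 (fun t : R => c * t) = cst c.
  by apply/funext => t; rewrite derive1E; apply: derive_val.
rewrite (@increasing_ge0_integration_by_substitutionT _ (fun t => c * t))//.
- by rewrite XE.
- by move=> x y xy; rewrite ltr_pM2l.
- by rewrite XE => x; exact: cvg_cst.
- by rewrite XE; apply/cvg_ex; exists c; exact: cvg_cst.
- by rewrite XE; apply/cvg_ex; exists c; exact: cvg_cst.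
- by apply/cvgrNyPle => A; near=> t; rewrite mulrC -ler_pdivlMr.
- by apply/cvgryPge => A; near=> t; rewrite mulrC -ler_pdivrMr.
Unshelve. all: by end_near. Qed.

(** The substitution [th = pi / 2 - atan t], made on compact intervals that
    exhaust the line. *)
Lemma integral_arccot (G : R -> R) : continuous G -> (forall x, 0 <= G x) ->
  (\int[leb]_(th in `[0%R, pi%R]) (G th)%:E =
   \int[leb]_t (G (pi / 2 - atan t) * (1 + t ^+ 2)^-1)%:E)%E.
Proof.
move=> cG G0.
pose F (t : R) : R := pi / 2 - atan t.
have FD (t : R) : is_derive t (1 : R) F (- (1 + t ^+ 2)^-1).
  by rewrite -[X in is_derive _ _ _ X]sub0r; apply: is_deriveB.
have FE : derive1 F = fun t => - (1 + t ^+ 2)^-1.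
  by apply/funext => t; rewrite derive1E; apply: derive_val.
have cF : continuous F by apply: is_derive_continuous FD.
have c1 : continuous (fun t : R => (1 + t ^+ 2)^-1).
  move=> t; apply: cvgV; first by rewrite gt_eqF// ltr_pwDl// sqr_ge0.
  have : continuous (fun t : R => 1 + t ^+ 2) by continuity.
  exact.
have decF x y : x < y -> F y < F x.
  by move=> xy; rewrite ltrD2l ltrN2 lt_atan.
pose H t := G (F t) * (1 + t ^+ 2)^-1.
have cH : continuous H.
  by apply: continuous_mul c1; exact: continuous_comp_all cF cG.
have H0 t : 0 <= H t by rewrite mulr_ge0// invr_ge0 addr_ge0// sqr_ge0.
have mG := measurable_continuous1 cG; have mH := measurable_continuous1 cH.
pose A (n : nat) : set R := `[F n%:R, F (- n%:R)]%classic.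
pose B (n : nat) : set R := `[- n%:R, n%:R]%classic.
have subst n : (\int[leb]_(th in A n) (G th)%:E = \int[leb]_(t in B n) (H t)%:E)%E.
  have nn : - n%:R <= n%:R :> R by apply: (@le_trans _ _ 0); rewrite ?oppr_le0.
  rewrite (@integration_by_substitution_decreasing _ F G _ _ nn).
  - by apply: eq_integral => t _; rewrite FE /H/= opprK.
  - by move=> x y _ _; exact: decF.
  - by rewrite FE => x _; apply: continuous_opp c1 _.
  - rewrite FE; apply/cvg_ex; exists (- (1 + (- n%:R) ^+ 2)^-1).
    by apply: cvg_at_right_filter; apply: continuous_opp c1 _.
  - rewrite FE; apply/cvg_ex; exists (- (1 + n%:R ^+ 2)^-1).
    by apply: cvg_at_left_filter; apply: continuous_opp c1 _.
  - split; first by move=> x _; have [] := FD x.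
    + by apply: cvg_at_right_filter; exact: cF.
    + by apply: cvg_at_left_filter; exact: cF.
  - exact: continuous_subspaceT.
have U1 : \bigcup_n B n = [set: R].
  rewrite -subTset => x _; exists (Num.truncn `|x|).+1 => //=.
  by rewrite /B/= in_itv/= -ler_norml ltW// truncnS_gt.
have U2 : \bigcup_n A n = `]0, pi[%classic.
  apply/seteqP; split=> th /=.
    move=> [n _ /=]; rewrite /A/= !in_itv/= => /andP[a1 a2]; apply/andP; split.
      by apply: lt_le_trans a1; rewrite subr_gt0 atan_ltpi2.
    apply: le_lt_trans a2 _; rewrite /F atanN opprK [ltRHS](splitr pi) ltrD2l.
    exact: atan_ltpi2.
  rewrite in_itv/= => /andP[th0 thpi].
  pose t := tan (pi / 2 - th).
  have tE : F t = th.
    by rewrite /F /t tanK ?in_itv/=; [ring|apply/andP; split; lra].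
  exists (Num.truncn `|t|).+1 => //=; rewrite /A/= in_itv/= -tE /F !lerD2l !lerN2.
  have : `|t| <= (Num.truncn `|t|).+1%:R by rewrite ltW// truncnS_gt.
  by rewrite ler_norml => /andP[? ?]; rewrite !le_atan.
have mB n : measurable (B n : set (mR R)) by exact: measurable_itv.
have mA n : measurable (A n : set (mR R)) by exact: measurable_itv.
have L1 : (\int[leb]_(t in B n) (H t)%:E)%E @[n --> \oo] -->
    (\int[leb]_(t in \bigcup_n B n) (H t)%:E)%E.
  apply: ge0_nondecreasing_set_cvg_integral => //.
  - move=> m n mn; apply/subsetPset => t; rewrite /B/= !in_itv/= => /andP[a1 a2].
    have mn' : m%:R <= n%:R :> R by rewrite ler_nat.
    by rewrite (le_trans a2 mn') (le_trans _ a1)// lerN2.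
  - by move=> n; exact: measurable_funTS.
  - by move=> n t _; rewrite lee_fin.
have L2 : (\int[leb]_(t in A n) (G t)%:E)%E @[n --> \oo] -->
    (\int[leb]_(t in \bigcup_n A n) (G t)%:E)%E.
  apply: ge0_nondecreasing_set_cvg_integral => //.
  - move=> m n mn; apply/subsetPset => t; rewrite /A/= !in_itv/= => /andP[a1 a2].
    have mn' : m%:R <= n%:R :> R by rewrite ler_nat.
    rewrite (le_trans _ a1) ?(le_trans a2)//; rewrite /F lerD2l lerN2 le_atan//.
    by rewrite lerN2.
  - by move=> n; exact: measurable_funTS.
  - by move=> n t _; rewrite lee_fin.
rewrite U1 in L1; rewrite U2 in L2.
have SE : (fun n => \int[leb]_(th in A n) (G th)%:E)%E = (fun n => \int[leb]_(t in B n) (H t)%:E)%E.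
  by apply/funext => n; exact: subst.
rewrite SE in L2.
rewrite integral_itv_bndoo; last exact: measurable_funTS.
exact: (cvg_unique _ L2 L1).
Qed.

(** Polar coordinates by substitutions on the line: first [x = y * t], then
    [y = r / sqrt (1 + t ^+ 2)], and finally [t = cot th]. The weight
    [Num.max r 0] replaces the condition [0 < r], so that all integrands are
    continuous on the whole line. *)
Lemma integral_half_plane (f : R * R -> R) : continuous f -> (forall q, 0 <= f q) ->
  (\int[leb]_(y in `]0%R, +oo[) \int[leb]_x (f (x, y))%:E =
   \int[leb]_r \int[leb]_(th in `[0%R, pi%R]) (f (r * cos th, r * sin th) * Num.max r 0)%:E)%E.
Proof.
move=> cf f0.
have csin := @continuous_sin R; have ccos := @continuous_cos R.
pose c (t : R) : R := (Num.sqrt (1 + t ^+ 2))^-1.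
have s0 (t : R) : 0 < Num.sqrt (1 + t ^+ 2) by rewrite sqrtr_gt0 ltr_pwDl// sqr_ge0.
have c0 t : 0 < c t by rewrite invr_gt0.
have cc2 t : c t * c t = (1 + t ^+ 2)^-1.
  by rewrite -invfM -expr2 sqr_sqrtr// addr_ge0// sqr_ge0.
have c_cont : continuous c.
  move=> t; apply: cvgV; first by rewrite gt_eqF.
  have c1 : continuous (fun t : R => 1 + t ^+ 2) by continuity.
  exact: (continuous_comp_all c1 (@sqrt_continuous R)).
have max0 (x : R) : 0 <= Num.max x 0 by rewrite le_max lexx orbT.
pose K1 (q : R * R) := f (q.1 * q.2, q.1) * Num.max q.1 0.
have cK1 : continuous K1 by rewrite /K1; continuity.
have K10 q : 0 <= K1 q by rewrite mulr_ge0.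
pose K2 (q : R * R) := f (q.2 * (c q.1 * q.1), q.2 * c q.1) * (c q.1 * c q.1 * Num.max q.2 0).
have cK2 : continuous K2 by rewrite /K2; continuity.
have K20 q : 0 <= K2 q by rewrite !mulr_ge0// ltW.
transitivity (\int[leb]_y \int[leb]_t (K1 (y, t))%:E)%E.
  rewrite integral_mkcond; apply: eq_integral => y _; rewrite patchE.
  have [y0|y0] := leP y 0.
    rewrite memNset; last by rewrite /= in_itv/= andbT => /(le_lt_trans y0); rewrite ltxx.
    by rewrite integral0_eq// => x _; rewrite /K1/= (max_r y0) mulr0.
  rewrite mem_set; last by rewrite /= in_itv/= y0.
  rewrite (integral_scale y0); [|by continuity|by []].
  by apply: eq_integral => t _; rewrite /K1/= (max_l (ltW y0)).
rewrite -(tonelli2_xy cK1 K10) (tonelli2_yx cK1 K10).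
transitivity (\int[leb]_t \int[leb]_r (K2 (t, r))%:E)%E.
  apply: eq_integral => t _.
  rewrite (integral_scale (c0 t)); [|by continuity|by []].
  apply: eq_integral => r _; rewrite /K1 /K2/=.
  have -> : Num.max (c t * r) 0 = c t * Num.max r 0.
    by rewrite maxr_pMr ?mulr0// ltW.
  congr (EFin _); rewrite [c t * r]mulrC -!mulrA; congr (_ * _); ring.
rewrite -(tonelli2_xy cK2 K20) (tonelli2_yx cK2 K20).
apply: eq_integral => r _.
rewrite (integral_arccot (G := fun th => f (r * cos th, r * sin th) * Num.max r 0)).
- apply: eq_integral => t _; rewrite /K2/= -cc2.
  have -> : sin (pi / 2 - atan t) = c t.
    by rewrite sinB sin_pihalf cos_pihalf mul1r mul0r subr0 cos_atan.
  have -> : cos (pi / 2 - atan t) = c t * t.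
    rewrite cosB sin_pihalf cos_pihalf mul1r mul0r add0r.
    have ca : cos (atan t) = c t by rewrite cos_atan.
    have E : sin (atan t) / c t = t by rewrite -ca; exact: atanK.
    by rewrite -[X in _ = c t * X]E mulrC divfK// gt_eqF.
  by congr (EFin _); ring.
- by continuity.
- by move=> th; rewrite mulr_ge0.
Qed.

(** Reflection maps the lower half-plane to the upper one and the angle [th] to
    [2 * pi - th]. *)
Lemma integral_polar (f : R * R -> R) : continuous f -> (forall q, 0 <= f q) ->
  (\int[leb]_y \int[leb]_x (f (x, y))%:E =
   \int[leb]_r \int[leb]_(th in `[0%R, (pi *+ 2)%R])
     (f (r * cos th, r * sin th) * Num.max r 0)%:E)%E.
Proof.
move=> cf f0.
have csin := @continuous_sin R; have ccos := @continuous_cos R.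
pose g (y : R) := (\int[leb]_x (f (x, y))%:E)%E.
have g0 y : (0 <= g y)%E by apply: integral_ge0 => x _; rewrite lee_fin.
have mg : measurable_fun [set: mR R] g by exact: measurable_line_integral2.
have mgN : measurable_fun [set: mR R] (fun y : R => g (- y)).
  apply: (@measurable_line_integral2 R (fun q => f (q.1, - q.2))) => [|q]; last exact: f0.
  by continuity.
have max0 (x : R) : 0 <= Num.max x 0 by rewrite le_max lexx orbT.
have pi2 : pi <= pi *+ 2 :> R by rewrite mulr2n lerDl pi_ge0.
transitivity (\int[leb]_y g y)%E; first by [].
have -> : (\int[leb]_y g y = \int[leb]_(y in `]-oo, 0%R] `|` `]0%R, +oo[) g y)%E.
  congr (integral _ _ _); apply/esym; rewrite -subTset => x _ /=; rewrite !in_itv/= andbT.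
  by case: (leP x 0); [left|right].
rewrite ge0_integral_setU//=; last 2 first.
- exact: measurable_funTS.
- by apply/disj_setPS => x /=; rewrite !in_itv/= andbT => -[x0 /(le_lt_trans x0)]; rewrite ltxx.
have -> : (\int[leb]_(y in `]-oo, 0%R]) g y = \int[leb]_(y in `]0%R, +oo[) g (- y)%R)%E.
  rewrite integral_itv_obnd_cbnd; last exact: measurable_funTS.
  rewrite ge0_integration_by_substitution0//.
  by apply: eq_integral => y _; rewrite opprK.
have H1 := integral_half_plane cf f0.
have H2 := @integral_half_plane (fun q => f (q.1, - q.2)) _ (fun=> f0 _).
rewrite [X in (_ + X)%E]H1 [X in (X + _)%E]H2; last by continuity.
pose k (q : R * R) := f (q.1 * cos q.2, q.1 * sin q.2) * Num.max q.1 0.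
pose k' (q : R * R) := f (q.1 * cos q.2, - (q.1 * sin q.2)) * Num.max q.1 0.
have ck : continuous k by rewrite /k; continuity.
have ck' : continuous k' by rewrite /k'; continuity.
have k0 q : 0 <= k q by rewrite mulr_ge0.
have k'0 q : 0 <= k' q by rewrite mulr_ge0.
have m1 := @measurable_strip_integral R `[0, pi]%classic k (measurable_itv _) ck k0.
have m2 := @measurable_strip_integral R `[0, pi]%classic k' (measurable_itv _) ck' k'0.
transitivity (\int[leb]_r (\int[leb]_(th in `[0%R, pi%R]) (k' (r, th))%:E +
    \int[leb]_(th in `[0%R, pi%R]) (k (r, th))%:E))%E.
  apply/esym; apply: ge0_integralD => //.
  - by move=> r _; apply: integral_ge0 => th _; rewrite lee_fin.
  - by move=> r _; apply: integral_ge0 => th _; rewrite lee_fin.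
apply: eq_integral => r _.
have ckr : continuous (fun th => k (r, th)) by continuity.
have -> : (\int[leb]_(th in `[0%R, pi%R]) (k' (r, th))%:E =
    \int[leb]_(th in `[pi%R, (pi *+ 2)%R]) (k (r, th))%:E)%E.
  pose F (th : R) : R := pi *+ 2 - th.
  have FD (t : R) : is_derive t (1 : R) F (-1).
    by rewrite -[X in is_derive _ _ _ X]sub0r; apply: is_deriveB.
  have FE : derive1 F = cst (-1).
    by apply/funext => t; rewrite derive1E; apply: derive_val.
  have cF := is_derive_continuous FD.
  have := @integration_by_substitution_decreasing _ F (fun th => k (r, th)) 0 pi (pi_ge0 _).
  have Fpi : F pi = pi by rewrite /F mulr2n addrK.
  have F0 : F 0 = pi *+ 2 by rewrite /F subr0.
  rewrite Fpi F0 => ->.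
  - apply: eq_integral => th _; rewrite FE/= opprK mulr1 /k /k'/= /F.
    by rewrite cosB sinB cos2pi sin2pi !mul1r !mul0r addr0 sub0r mulrN.
  - by move=> x y _ _ xy; rewrite /F ltrD2l ltrN2.
  - by rewrite FE => x _; exact: cvg_cst.
  - by rewrite FE; apply/cvg_ex; exists (-1); exact: cvg_cst.
  - by rewrite FE; apply/cvg_ex; exists (-1); exact: cvg_cst.
  - split; first by move=> x _; have [] := FD x.
    + by apply: cvg_at_right_filter; exact: cF.
    + by apply: cvg_at_left_filter; exact: cF.
  - exact: continuous_subspaceT.
have mk := measurable_continuous1 ckr.
rewrite addeC -(integral_itv_bndo_bndc); last exact: measurable_funTS.
rewrite -ge0_integral_setU//=; last 3 first.
- exact: measurable_funTS.
- by move=> x _; rewrite lee_fin.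
- apply/disj_setPS => x /=; rewrite !in_itv/= => -[/andP[_ xpi] /andP[pix _]].
  by move: (lt_le_trans xpi pix); rewrite ltxx.
congr (integral _ _ _); apply/seteqP; split => x /=; rewrite !in_itv/=.
  by move=> [/andP[-> /ltW/le_trans->]//|/andP[/(le_trans (pi_ge0 _))-> ->]].
move=> /andP[x0 x2]; case: (ltP x pi) => xpi; [left|right].
  by rewrite x0.
by rewrite x2.
Qed.

Definition sphere_point (rho : R) (q : R * R) : R3 R :=
  (rho * (sin q.1 * cos q.2), rho * (sin q.1 * sin q.2), rho * cos q.1).

Definition angles : set (R * R) := `[0%R, pi%R]%classic `*` `[0%R, (pi *+ 2)%R]%classic.

(** Cylindrical coordinates are followed by polar coordinates in each half-plane
    of constant azimuth. The radius is the inner variable of integration, since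
    limits will be taken along rays. *)
Lemma integral_spherical (f : R3 R -> R) : continuous f -> (forall p, 0 <= f p) ->
  (\int[mu3]_p (f p)%:E = \int[leb \x leb]_(q in angles) \int[leb]_rho
     (f (sphere_point rho q) * (Num.max rho 0 ^+ 2 * Num.max (sin q.1) 0))%:E)%E.
Proof.
move=> cf f0.
have csin := @continuous_sin R; have ccos := @continuous_cos R.
have max0 (x : R) : 0 <= Num.max x 0 by rewrite le_max lexx orbT.
have mpi : measurable (`[0%R, pi]%classic : set (mR R)) by exact: measurable_itv.
have mpi2 : measurable (`[0%R, pi *+ 2]%classic : set (mR R)) by exact: measurable_itv.
rewrite tonelli3_zq//.
(* cylindrical coordinates (s, phi, z) *)
transitivity (\int[leb]_z \int[leb]_s \int[leb]_(phi in `[0%R, (pi *+ 2)%R])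
    (f (s * cos phi, s * sin phi, z) * Num.max s 0)%:E)%E.
  apply: eq_integral => z _.
  have cfz : continuous (fun q => f (q, z)) by continuity.
  by rewrite (tonelli2_yx cfz (fun=> f0 _)) (integral_polar cfz (fun=> f0 _)).
pose K (p : R3 R) := f (p.2 * cos p.1.2, p.2 * sin p.1.2, p.1.1) * Num.max p.2 0.
have cK : continuous K by rewrite /K; continuity.
have K0 p : 0 <= K p by rewrite mulr_ge0.
transitivity (\int[leb]_z \int[leb]_(phi in `[0%R, (pi *+ 2)%R]) \int[leb]_s (K (z, phi, s))%:E)%E.
  apply: eq_integral => z _.
  have cKz : continuous (fun q : R * R => K (z, q.2, q.1)) by continuity.
  exact: (tonelli_rectangle measurableT mpi2 (measurable_continuous2 cKz) (fun=> K0 _)).2.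
have mKs := measurable_line_integral cK K0.
rewrite (tonelli_rectangle measurableT mpi2 mKs _).2; last first.
  by move=> q; apply: integral_ge0 => s _; rewrite lee_fin.
(* polar coordinates (rho, theta) in each half-plane of constant phi *)
pose L (p : R3 R) := f (sphere_point p.2 p.1) * (Num.max p.2 0 ^+ 2 * Num.max (sin p.1.1) 0).
have cL : continuous L by rewrite /L /sphere_point; continuity.
have L0 p : 0 <= L p by rewrite !mulr_ge0.
have KL (rho th phi : R) : 0 <= sin th ->
    K (rho * cos th, phi, rho * sin th) * Num.max rho 0 = L (th, phi, rho).
  move=> s0; rewrite /K /L /sphere_point/= (max_l s0).
  have [rho0|rho0] := leP rho 0; first by rewrite expr0n/= mul0r !mulr0.
  have rs : 0 <= rho * sin th by apply: mulr_ge0 => //; exact: ltW.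
  by rewrite (max_l rs) !mulrA; ring.
have mL := measurable_line_integral cL L0.
rewrite (tonelli_rectangle mpi mpi2 mL _).1; last first.
  by move=> q; apply: integral_ge0 => s _; rewrite lee_fin.
rewrite (tonelli_rectangle mpi mpi2 mL _).2; last first.
  by move=> q; apply: integral_ge0 => s _; rewrite lee_fin.
apply: eq_integral => phi _.
have cKphi : continuous (fun q : R * R => K (q.1, phi, q.2)) by continuity.
have -> : (\int[leb]_z \int[leb]_s (K (z, phi, s))%:E =
    \int[leb]_s \int[leb]_z (K (z, phi, s))%:E)%E.
  by rewrite -(tonelli2_xy cKphi (fun=> K0 _)) (tonelli2_yx cKphi (fun=> K0 _)).
have -> : (\int[leb]_s \int[leb]_z (K (z, phi, s))%:E =
    \int[leb]_(s in `]0%R, +oo[) \int[leb]_z (K (z, phi, s))%:E)%E.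
  rewrite [RHS]integral_mkcond; apply: eq_integral => s _; rewrite patchE.
  case: ifPn => //; rewrite notin_setE /= in_itv/= andbT => /negP; rewrite -leNgt => s0.
  by rewrite integral0_eq// => z _; rewrite /K/= (max_r s0) mulr0.
rewrite (integral_half_plane cKphi (fun=> K0 _)).
have cLphi : continuous (fun q : R * R => L (q.2, phi, q.1)) by continuity.
rewrite -(tonelli_rectangle measurableT mpi (measurable_continuous2 cLphi) (fun=> L0 _)).2.
apply: eq_integral => rho _; apply: eq_integral => th; rewrite inE /= in_itv/= => thpi.
have s0 : 0 <= sin th by rewrite sin_ge0_pi// in_itv.
by rewrite -(KL _ _ _ s0).
Qed.

End polar.

(** * Radial profiles *)

Section smoothstep.
Context {R : realType}.

Lemma is_derive_quadratic (f : R -> R) (x d : R) :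
  (forall h, `|f (h + x) - f x - d * h| <= h ^+ 2) -> is_derive x (1 : R) f d.
Proof.
move=> fd.
have H : h^-1 *: ((f \o shift x) (h *: (1 : R)) - f x) @[h --> 0^'] --> d.
  apply/cvgrPdist_le => e e0; near=> h.
  have h0 : h != 0 by near: h; exact: nbhs_dnbhs_neq.
  have he : `|h| <= e by near: h; apply: dnbhs0_le.
  rewrite /= /GRing.scale/= mulr1.
  have -> : d - h^-1 * (f (h + x) - f x) = - (h^-1 * (f (h + x) - f x - d * h)).
    by field.
  rewrite normrN normrM normfV ler_pdivrMl ?normr_gt0//.
  rewrite (le_trans (fd h))// -real_normK ?num_real// expr2.
  by rewrite ler_wpM2l.
by split; [apply/cvg_ex; exists d|exact: cvg_lim].
Unshelve. all: by end_near. Qed.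

Lemma is_derive_pos_sqr (x : R) :
  is_derive x (1 : R) (fun x => Num.max x 0 ^+ 2) (2 * Num.max x 0).
Proof.
apply: is_derive_quadratic => h; rewrite ler_norml.
case: (leP x 0) => x0; case: (leP (h + x) 0) => hx0; apply/andP; split; nra.
Qed.

(** The tent function of mass one on [[0, 1]], written with positive parts so
    that its primitive [smoothstep] is explicit. *)
Definition hat (s : R) : R :=
  4 * (Num.max s 0 - 2 * Num.max (s - 2^-1) 0 + Num.max (s - 1) 0).

Definition smoothstep (s : R) : R :=
  2 * (Num.max s 0 ^+ 2 - 2 * Num.max (s - 2^-1) 0 ^+ 2 + Num.max (s - 1) 0 ^+ 2).

Lemma is_derive_smoothstep (s : R) : is_derive s (1 : R) smoothstep (hat s).
Proof.
have Q (c : R) : is_derive s (1 : R) (fun s => Num.max (s - c) 0 ^+ 2) (2 * Num.max (s - c) 0).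
  apply: is_derive_quadratic => h; rewrite ler_norml.
  have -> : h + s - c = h + (s - c) by ring.
  case: (leP (s - c) 0) => x0; case: (leP (h + (s - c)) 0) => hx0; apply/andP; split; nra.
have P := is_derive_pos_sqr s.
have -> : hat s = 2 * (2 * Num.max s 0 - 2 * (2 * Num.max (s - 2^-1) 0) + 2 * Num.max (s - 1) 0).
  by rewrite /hat; ring.
have Q1 := Q 2^-1; have Q2 := Q 1.
exact: is_deriveZ.
Qed.

Lemma smoothstep0 s : s <= 0 -> smoothstep s = 0.
Proof.
move=> s0; rewrite /smoothstep !max_r ?subr_le0//.
- by rewrite expr0n/=; ring.
- by rewrite (le_trans s0).
- by rewrite (le_trans s0)// invr_ge0.
Qed.

Lemma smoothstep1 s : 1 <= s -> smoothstep s = 1.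
Proof.
move=> s1; rewrite /smoothstep !max_l ?subr_ge0//; [by field| |]; lra.
Qed.

Lemma smoothstep_ge0 s : 0 <= smoothstep s.
Proof.
rewrite /smoothstep.
by case: (leP s 0) => s0; case: (leP (s - 2^-1) 0) => s2; case: (leP (s - 1) 0) => s1; nra.
Qed.

Lemma smoothstep_le1 s : smoothstep s <= 1.
Proof.
rewrite /smoothstep.
by case: (leP s 0) => s0; case: (leP (s - 2^-1) 0) => s2; case: (leP (s - 1) 0) => s1; nra.
Qed.

Lemma hat_ge0 s : 0 <= hat s.
Proof.
rewrite /hat.
by case: (leP s 0) => s0; case: (leP (s - 2^-1) 0) => s2; case: (leP (s - 1) 0) => s1; lra.
Qed.

Lemma hat_le2 s : hat s <= 2.
Proof.
rewrite /hat.
by case: (leP s 0) => s0; case: (leP (s - 2^-1) 0) => s2; case: (leP (s - 1) 0) => s1; lra.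
Qed.

Lemma hat0l s : s <= 0 -> hat s = 0.
Proof.
rewrite /hat.
by case: (leP s 0) => s0; case: (leP (s - 2^-1) 0) => s2; case: (leP (s - 1) 0) => s1; lra.
Qed.

Lemma hat0r s : 1 <= s -> hat s = 0.
Proof.
rewrite /hat.
by case: (leP s 0) => s0; case: (leP (s - 2^-1) 0) => s2; case: (leP (s - 1) 0) => s1; lra.
Qed.

Lemma continuous_hat : continuous hat.
Proof. by rewrite /hat; continuity. Qed.

Lemma continuous_smoothstep : continuous smoothstep.
Proof. by rewrite /smoothstep; continuity. Qed.

(** A C^1 transition from 0 to 1 over [[c, c + w]], and its derivative. *)
Definition ramp (c w t : R) : R := smoothstep (w^-1 * (t - c)).
Definition dramp (c w t : R) : R := w^-1 * hat (w^-1 * (t - c)).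

Lemma is_derive_ramp (c w t : R) : is_derive t (1 : R) (ramp c w) (dramp c w t).
Proof.
have A : is_derive t (1 : R) (fun t : R => w^-1 * (t - c)) w^-1.
  rewrite -[X in is_derive _ _ _ X]mulr1 -{2}[1]subr0; apply: is_deriveZ.
have B := is_derive_smoothstep (w^-1 * (t - c)).
have := @is_derive1_comp R smoothstep (fun t => w^-1 * (t - c)) t _ _ B A.
by rewrite /dramp mulrC.
Qed.

Lemma partial_radial_profile (F F' : R -> R) i : (forall t, is_derive t (1 : R) F (F' t)) ->
  has_partial i (fun p : R3 R => F (nsq p)) (fun p => 2 * crd i p * F' (nsq p)).
Proof.
move=> FD q t.
have A : is_derive t (1 : R) (fun s => nsq (ins i q s)) (2 * t).
  apply: is_derive_quadratic => h.
  have -> : nsq (ins i q (h + t)) - nsq (ins i q t) - 2 * t * h = h ^+ 2.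
    rewrite /nsq !sum3.
    by have [->|[->|->]] := I3P i; rewrite /crd/=; ring.
  by rewrite ger0_norm// sqr_ge0.
have := @is_derive1_comp R F (fun s => nsq (ins i q s)) t _ _ (FD (nsq (ins i q t))) A.
by rewrite coord_ins mulrC.
Qed.

End smoothstep.

(** * Flux through thin shells *)

Section limits_inferior.
Context {R : realType}.
Local Open Scope ereal_scope.
Implicit Types u : (\bar R)^nat.

Lemma limn_einf_ge u (c : \bar R) n0 : (forall n, (n0 <= n)%N -> c <= u n) -> c <= limn_einf u.
Proof.
move=> cu; rewrite -[limn_einf u]/(limf_einf u \oo) limf_einfE.
apply: le_ereal_sup_tmp; exists (ereal_inf (u @` [set n | (n0 <= n)%N])).
  by exists [set n | (n0 <= n)%N] => //; exists n0.
by apply: le_ereal_inf_tmp => _ [n /= n0n <-]; exact: cu.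
Qed.

Lemma limn_einf_le u (c : \bar R) n0 : (forall n, (n0 <= n)%N -> u n <= c) -> limn_einf u <= c.
Proof.
move=> uc; rewrite -[limn_einf u]/(limf_einf u \oo) limf_einfE.
apply: ge_ereal_sup => _ [V [n1 _ n1V] <-].
apply: ge_ereal_inf; exists (u (maxn n0 n1)); last by apply: uc; rewrite leq_maxl.
by exists (maxn n0 n1) => //; apply: n1V; rewrite /= leq_maxr.
Qed.

Lemma measurable_fun_limn_einf d (T : measurableType d) (D : set T) (f : (T -> \bar R)^nat) :
  (forall n, measurable_fun D (f n)) -> measurable_fun D (fun x => limn_einf (f ^~ x)).
Proof.
move=> mf; apply: (@emeasurable_fun_cvg _ T R D (fun n x => einfs (f ^~ x) n)).
  exact: measurable_fun_einfs.
by move=> x _; rewrite limn_einf_lim; exact: is_cvg_einfs.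
Qed.

End limits_inferior.

(** The integral of a nonnegative function is a supremum over the simple
    functions below it. The entry set is not known to be measurable, so that
    this is the form in which integrals over it can be compared. *)
Lemma le_integral_lower d (T : measurableType d) (R : realType)
    (mu : {measure set T -> \bar R}) (D : set T) (f g : T -> \bar R) :
  (forall x, D x -> 0 <= f x)%E -> (forall x, D x -> f x <= g x)%E ->
  (\int[mu]_(x in D) f x <= \int[mu]_(x in D) g x)%E.
Proof.
move=> f0 fg; have g0 x : D x -> (0 <= g x)%E.
  by move=> Dx; apply: le_trans (fg x Dx); exact: f0.
rewrite !ge0_integralE//; apply: ereal_sup_le => _ [h hf <-].
exists h => // x; apply: le_trans (hf x) _; rewrite !patchE.
by case: ifPn => // /set_mem/fg.
Qed.

Section flux.
Context {R : realType}.
Variables (v : 'I_3 -> R3 R -> R) (dv : 'I_3 -> 'I_3 -> R3 R -> R) (a r : R).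
Hypotheses (v_cc : forall j, cc (v j)) (dv_cc : forall j i, cc (dv j i)).
Hypothesis v_pd : forall j i, has_partial i (v j) (dv j i).
Hypotheses (r_gt0 : 0 < r) (r_lt_a : 4 * r ^+ 2 < a ^+ 2) (a_gt0 : 0 < a).
Hypothesis v_div : forall p, r ^+ 2 <= nsq p <= a ^+ 2 -> \sum_i dv i i p = 0.

(** Bumps of mass one in the squared radius, supported in
    [r ^+ 2 < nsq p < 4 * r ^+ 2] and in a shell of thickness [tau] below the
    outer sphere. *)
Definition inner (t : R) := dramp (r ^+ 2) (3 * r ^+ 2) t.
Definition outer (tau t : R) := dramp (a ^+ 2 - tau) tau t.

Definition inflow (p : R3 R) := Num.max (- radial v p) 0.

Let psi := reaching v (a ^+ 2) (r ^+ 2).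

Lemma r2_gt0 : 0 < r ^+ 2. Proof. by rewrite exprn_gt0. Qed.
Lemma a2_gt0 : 0 < a ^+ 2. Proof. by rewrite exprn_gt0. Qed.

Lemma dramp_ge0 (c w t : R) : 0 <= w -> 0 <= dramp c w t.
Proof. by move=> w0; rewrite /dramp mulr_ge0 ?invr_ge0 ?hat_ge0. Qed.

Lemma dramp0l (c w t : R) : 0 < w -> t <= c -> dramp c w t = 0.
Proof.
by move=> w0 tc; rewrite /dramp hat0l ?mulr0// pmulr_rle0 ?invr_gt0// subr_le0.
Qed.

Lemma dramp0r (c w t : R) : 0 < w -> c + w <= t -> dramp c w t = 0.
Proof.
move=> w0 tc; rewrite /dramp hat0r ?mulr0//.
by rewrite mulrC ler_pdivlMr// mul1r; lra.
Qed.

Lemma continuous_dramp (c w : R) : continuous (dramp c w).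
Proof. by have ch := @continuous_hat R; rewrite /dramp; continuity. Qed.

Lemma continuous_ramp (c w : R) : continuous (ramp c w).
Proof. by have ch := @continuous_smoothstep R; rewrite /ramp; continuity. Qed.

Lemma ramp0 (c w t : R) : 0 < w -> t <= c -> ramp c w t = 0.
Proof.
by move=> w0 tc; rewrite /ramp smoothstep0// pmulr_rle0 ?invr_gt0// subr_le0.
Qed.

Lemma ramp1 (c w t : R) : 0 < w -> c + w <= t -> ramp c w t = 1.
Proof.
move=> w0 tc; rewrite /ramp smoothstep1//.
by rewrite mulrC ler_pdivlMr// mul1r; lra.
Qed.

Lemma ramp_ge0 (c w t : R) : 0 <= ramp c w t.
Proof. exact: smoothstep_ge0. Qed.

Lemma ramp_le1 (c w t : R) : ramp c w t <= 1.
Proof. exact: smoothstep_le1. Qed.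

Lemma cc_profile (F : R -> R) (c : R) : 0 <= c -> continuous F ->
  (forall t, c ^+ 2 <= t -> F t = 0) -> cc (fun p : R3 R => F (nsq p)).
Proof.
move=> c0 cF Fc; split.
  by have cn := @continuous_nsq R; continuity.
exists c => p cp; apply: Fc.
apply: le_trans (sqr_norm_le p); rewrite lerXn2r ?nnegrE//; exact: ltW.
Qed.

(** The derivative of this profile is [inner - outer tau]: testing the continuity
    equation against it compares the fluxes through the two shells. *)
Definition chi (tau t : R) := ramp (r ^+ 2) (3 * r ^+ 2) t - ramp (a ^+ 2 - tau) tau t.

(** Where [chi] is nonzero, the divergence vanishes and [psi m] does not decrease
    along a step. Hence [step_weak] leaves only the flux terms. *)
Lemma flux_step (tau : R) : 0 < tau -> 4 * r ^+ 2 <= a ^+ 2 - tau ->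
  forall e, 0 < e -> exists m0, forall m, (m0 <= m)%N ->
  J (fun p => 2 * radial v p * (inner (nsq p) - outer tau (nsq p)) * psi m p) <= e.
Proof.
move=> tau0 tau_le e e0.
have r2 := r2_gt0.
have w0 : 0 < 3 * r ^+ 2 by rewrite mulr_gt0.
pose phi (p : R3 R) := chi tau (nsq p).
pose dphi i (p : R3 R) := 2 * crd i p * (inner (nsq p) - outer tau (nsq p)).
have chi0l t : t <= r ^+ 2 -> chi tau t = 0.
  by move=> tr; rewrite /chi !ramp0 ?subrr//; lra.
have chi0r t : a ^+ 2 <= t -> chi tau t = 0.
  by move=> ta; rewrite /chi !ramp1 ?subrr//; lra.
have d0r t : a ^+ 2 <= t -> inner t - outer tau t = 0.
  by move=> ta; rewrite /inner /outer !dramp0r ?subrr//; lra.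
have d0l t : t <= r ^+ 2 -> inner t - outer tau t = 0.
  by move=> ta; rewrite /inner /outer !dramp0l ?subrr//; lra.
have chi_ge0 t : 0 <= chi tau t.
  rewrite /chi; have [ta|ta] := leP t (a ^+ 2 - tau).
    by rewrite [X in _ - X]ramp0// subr0 ramp_ge0.
  by rewrite [X in X - _]ramp1 ?subr_ge0 ?ramp_le1//; lra.
have cchi : continuous (chi tau).
  have c1 := @continuous_ramp (r ^+ 2) (3 * r ^+ 2).
  have c2 := @continuous_ramp (a ^+ 2 - tau) tau.
  by rewrite /chi; continuity.
have cd : continuous (fun t => inner t - outer tau t).
  have c1 := @continuous_dramp (r ^+ 2) (3 * r ^+ 2).
  have c2 := @continuous_dramp (a ^+ 2 - tau) tau.
  by rewrite /inner /outer; continuity.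
have phicc : cc phi by apply: (cc_profile (ltW a_gt0)).
have dcc : cc (fun p : R3 R => inner (nsq p) - outer tau (nsq p)).
  exact: (@cc_profile (fun t => inner t - outer tau t) a (ltW a_gt0) cd d0r).
have dphicc i : cc (dphi i).
  have cc1 := @continuous_coord R i.
  have : continuous (fun p : R3 R => 2 * crd i p) by continuity.
  move=> /(ccM dcc); rewrite /dphi.
  by under eq_fun do rewrite mulrC.
have phipd i : has_partial i phi (dphi i).
  apply: (@partial_radial_profile R (chi tau) (fun t => inner t - outer tau t)) => t.
  by apply: is_deriveB; exact: is_derive_ramp.
have [h0 [h00 H]] := step_weak v_cc (fun i => dv_cc i i) (fun i => v_pd i i)
  phicc dphicc phipd e0.
have [m0 Hm] := near_infty_inv h00.
exists m0 => m m0m.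
have [/andP[hp hh] _] := Hm m m0m.
set h := (m.+1%:R^-1 : R) in hp hh *.
have h01 : 0 < h < h0 by rewrite hp.
have cpsi : continuous (psi m) by exact: continuous_reaching.
have upsi : unit_valued (psi m) by exact: reaching_unit.
have := H h h01 _ cpsi upsi.
have cv i : continuous (v i) by case: (v_cc i).
have cstep := continuous_step (h := h) cv.
have A1 : cc (fun p => phi p * psi m (step v h p)).
  by apply: ccM phicc _; exact: continuous_comp_all cstep cpsi.
have A2 : cc (fun p => phi p * psi m p) by exact: ccM.
rewrite -(JB A1 A2) => HJ.
have P0 : 0 <= J (fun p => phi p * psi m (step v h p) - phi p * psi m p).
  apply: J_ge0 => p; rewrite -mulrBr.
  have [rp|rp] := leP (nsq p) (r ^+ 2); first by rewrite /phi chi0l// mul0r.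
  by rewrite mulr_ge0 ?chi_ge0// subr_ge0 reaching_step// ltW.
have GE : (fun p => (\sum_i (v i p * dphi i p + phi p * dv i i p)) * psi m p) =
    (fun p => 2 * radial v p * (inner (nsq p) - outer tau (nsq p)) * psi m p).
  apply/funext => p; congr (_ * _); rewrite big_split/= -mulr_sumr.
  have -> : phi p * \sum_i dv i i p = 0.
    have [rp|rp] := leP (nsq p) (r ^+ 2); first by rewrite /phi chi0l// mul0r.
    have [ap|ap] := leP (a ^+ 2) (nsq p); first by rewrite /phi chi0r// mul0r.
    by rewrite v_div ?mulr0// !ltW.
  rewrite addr0 /dphi /radial !mulr_sumr mulr_suml; apply: eq_bigr => i _; ring.
rewrite GE in HJ.
move: HJ; rewrite ler_norml => /andP[_ HJ].
rewrite -(ler_pM2l hp) [leRHS]mulrC; apply: le_trans HJ.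
by rewrite lerDr.
Qed.

Variables (K L : R).
Hypotheses (K_gt0 : 0 < K) (v_le : forall i p, `|v i p| <= K).
Hypotheses (L_gt0 : 0 < L) (v_lip : forall i p q, `|v i p - v i q| <= L * `|p - q|).

Let cradial : continuous (radial v). Proof. by case: (cc_radial v_cc). Qed.

Lemma continuous_inflow : continuous inflow.
Proof. by have c := cradial; rewrite /inflow; continuity. Qed.

Lemma inflow_ge0 p : 0 <= inflow p.
Proof. by rewrite /inflow le_max lexx orbT. Qed.

Lemma cc_outer tau : 0 < tau -> cc (fun p : R3 R => outer tau (nsq p)).
Proof.
move=> tau0; apply: (cc_profile (ltW a_gt0)); first exact: continuous_dramp.
by move=> t ta; rewrite /outer dramp0r//; lra.
Qed.

Lemma cc_inner : cc (fun p : R3 R => inner (nsq p)).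
Proof.
have r2 := r2_gt0.
apply: (@cc_profile _ (2 * r)); first by rewrite mulr_ge0// ltW.
  exact: continuous_dramp.
by move=> t ta; rewrite /inner dramp0r ?mulr_gt0//; lra.
Qed.

(** The outward flux through the outer shell has the wrong sign in [flux_step].
    Where [radial] is at least [delta], [psi m] vanishes by [reaching_exit];
    elsewhere the outward flux is at most [delta] times the mass of the shell. *)
Lemma tube_step (delta : R) : 0 < delta -> exists tau0, 0 < tau0 /\
  forall tau, 0 < tau <= tau0 -> exists m0, forall m, (m0 <= m)%N ->
  J (fun p => 2 * inflow p * outer tau (nsq p) * psi m p) <=
    J (fun p => 2 * `|radial v p| * inner (nsq p)) + delta +
    2 * delta * J (fun p => outer tau (nsq p)).
Proof.
move=> delta0; have r2 := r2_gt0; have a2 := a2_gt0.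
have ra : r ^+ 2 < a ^+ 2 by have := r_lt_a; lra.
have [t0 [t00 H]] := reaching_exit v_cc K_gt0 v_le L_gt0 v_lip ra delta0.
exists (Num.min t0 (a ^+ 2 - 4 * r ^+ 2)); split; first by rewrite lt_min t00 subr_gt0.
move=> tau /andP[tau0]; rewrite le_min => /andP[tau1 tau2].
have tau01 : 0 < tau <= t0 by rewrite tau0.
have {H}[m1 H1] := H tau tau01.
have tau3 : 4 * r ^+ 2 <= a ^+ 2 - tau by move: tau2; lra.
have [m2 H2] := flux_step tau0 tau3 delta0.
exists (maxn m1 m2) => m; rewrite geq_max => /andP[/H1 {}H1 /H2 {}H2].
have occ := cc_outer tau0; have icc := cc_inner.
have [co _] := occ; have [ci _] := icc.
have cpsi : continuous (psi m) by exact: continuous_reaching.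
have upsi : unit_valued (psi m) by exact: reaching_unit.
have cr := cradial; have cI := continuous_inflow.
have o0 p : 0 <= outer tau (nsq p) by apply: dramp_ge0; exact: ltW.
have i0 p : 0 <= inner (nsq p) by apply: dramp_ge0; rewrite mulr_ge0// ltW.
pose f1 p := 2 * radial v p * (inner (nsq p) - outer tau (nsq p)) * psi m p.
pose f2 p := 2 * `|radial v p| * inner (nsq p).
pose f3 (p : R3 R) := outer tau (nsq p).
have c1 : cc f1.
  have : continuous (fun p => 2 * radial v p * psi m p) by continuity.
  move=> /(ccM (ccB icc occ)); rewrite /f1; congr cc; apply/funext => p; ring.
have c2 : cc f2.
  have : continuous (fun p => 2 * `|radial v p|) by continuity.
  move=> /(ccM icc); rewrite /f2; congr cc; apply/funext => p; ring.
have c0 : cc (fun p => 2 * inflow p * outer tau (nsq p) * psi m p).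
  have : continuous (fun p => 2 * inflow p * psi m p) by continuity.
  move=> /(ccM occ); congr cc; apply/funext => p; ring.
have c3 : cc (fun p => 2 * delta * f3 p) by apply: ccZ; exact: occ.
apply: (@le_trans _ _ (J (fun p => f1 p + f2 p + 2 * delta * f3 p))).
  apply: J_le => //; first by do 2?apply: ccD.
  move=> p; rewrite /f1 /f2 /f3 /inflow.
  have /andP[p0 p1] := upsi p.
  have io : 0 <= `|radial v p| * inner (nsq p) + radial v p * inner (nsq p) * psi m p.
    have A : `|radial v p| * inner (nsq p) * psi m p <= `|radial v p| * inner (nsq p).
      by rewrite ler_piMr// mulr_ge0.
    have B : - (radial v p * (inner (nsq p) * psi m p)) <= `|radial v p| * (inner (nsq p) * psi m p).
      have rn : - radial v p <= `|radial v p| by rewrite -normrN ler_norm.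
      by rewrite -mulNr; apply: ler_wpM2r => //; rewrite mulr_ge0.
    lra.
  have op0 : 0 <= outer tau (nsq p) * psi m p by rewrite mulr_ge0.
  have key : (Num.max (- radial v p) 0 + radial v p) * (outer tau (nsq p) * psi m p)
      <= delta * outer tau (nsq p).
    have [rp|rp] := leP (- radial v p) 0; last by rewrite addNr mul0r mulr_ge0// ltW.
    rewrite add0r.
    have [tp|tp] := leP (nsq p) (a ^+ 2 - tau); first by rewrite /outer dramp0l// mul0r !mulr0.
    have [dp|dp] := leP delta (radial v p).
      have -> : psi m p = 0 by apply: H1 => //; exact: ltW.
      by rewrite !mulr0 mulr_ge0// ltW.
    rewrite ler_pM//; first lra; first exact: ltW.
    by rewrite ler_piMr.
  lra.
rewrite (JD (ccD c1 c2) c3) (JD c1 c2) (JZ (2 * delta) occ) lerD2r addrC lerD2l.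
exact: H2.
Qed.

Lemma nsq_sphere_point (rho : R) q : nsq (sphere_point rho q) = rho ^+ 2.
Proof.
rewrite /nsq sum3 /crd/=.
have -> : (rho * (sin q.1 * cos q.2)) ^+ 2 + (rho * (sin q.1 * sin q.2)) ^+ 2 + (rho * cos q.1) ^+ 2
   = rho ^+ 2 * (sin q.1 ^+ 2 * (cos q.2 ^+ 2 + sin q.2 ^+ 2) + cos q.1 ^+ 2) by ring.
by rewrite cos2Dsin2 mulr1 addrC cos2Dsin2 mulr1.
Qed.

Lemma scale_sphere_point (c rho : R) q : c *: sphere_point rho q = sphere_point (c * rho) q.
Proof.
by apply: coord_eq => i; rewrite coordZ; have [->|[->|->]] := I3P i; rewrite /crd/= mulrA.
Qed.

Lemma outer_mass tau : 0 < tau < a ^+ 2 ->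
  (\int[leb]_rho (outer tau (rho ^+ 2) * (2 * Num.max rho 0))%:E = 1)%E.
Proof.
move=> /andP[tau0 taua].
pose f (rho : R) := outer tau (rho ^+ 2) * (2 * rho).
pose F (rho : R) := ramp (a ^+ 2 - tau) tau (rho ^+ 2).
have cd := @continuous_dramp (a ^+ 2 - tau) tau.
have cf : continuous f by rewrite /f /outer; continuity.
have FD (t : R) : is_derive t (1 : R) F (f t).
  have A : is_derive t (1 : R) (fun s : R => s ^+ 2) (2 * t).
    apply: is_derive_quadratic => h.
    have -> : (h + t) ^+ 2 - t ^+ 2 - 2 * t * h = h ^+ 2 by ring.
    by rewrite ger0_norm// sqr_ge0.
  have := @is_derive1_comp R (ramp (a ^+ 2 - tau) tau) (fun s : R => s ^+ 2) t _ _
    (is_derive_ramp _ _ _) A.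
  by [].
have cF := is_derive_continuous FD.
transitivity (\int[leb]_(rho in `[0%R, a]) (f rho)%:E)%E.
  rewrite [RHS]integral_mkcond; apply: eq_integral => rho _; rewrite patchE.
  case: ifPn => [/set_mem|]; first by rewrite /= in_itv/= => /andP[r0 _]; rewrite /f max_l.
  rewrite notin_setE /= in_itv/= => /negP; rewrite negb_and -!ltNge => /orP[r0|ra].
    by rewrite max_r ?ltW// !mulr0.
  rewrite /outer dramp0r// ?mul0r// subrK lerXn2r ?nnegrE// ltW//.
  exact: lt_trans ra.
rewrite (@continuous_FTC2 _ f F 0 a a_gt0).
- rewrite /F expr0n/= ramp1 ?ramp0 ?subrK//; last by rewrite subr_ge0 ltW.
  by rewrite oppr0 adde0.
- exact: continuous_subspaceT.
- split; first by move=> x _; have [] := FD x.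
  + by apply: cvg_at_right_filter; exact: cF.
  + by apply: cvg_at_left_filter; exact: cF.
- by move=> x _; rewrite derive1E; apply: derive_val.
Qed.

Lemma J_outer tau : 0 < tau < a ^+ 2 -> J (fun p => outer tau (nsq p)) <= a * pi ^+ 2.
Proof.
move=> /andP[tau0 taua].
have tau01 : 0 < tau < a ^+ 2 by rewrite tau0.
have occ := cc_outer tau0; have [co _] := occ.
have o0 t : 0 <= outer tau t by apply: dramp_ge0; exact: ltW.
have max0 (x : R) : 0 <= Num.max x 0 by rewrite le_max lexx orbT.
have w0 (rho th : R) : 0 <= Num.max rho 0 ^+ 2 * Num.max (sin th) 0.
  by apply: mulr_ge0 => //; exact: sqr_ge0.
have k0 (rho : R) : 0 <= outer tau (rho ^+ 2) * (2 * Num.max rho 0).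
  by apply: mulr_ge0 => //; apply: mulr_ge0.
have key (rho th : R) : outer tau (rho ^+ 2) * (Num.max rho 0 ^+ 2 * Num.max (sin th) 0) <=
    a / 2 * (outer tau (rho ^+ 2) * (2 * Num.max rho 0)).
  have [ra|ra] := leP rho a; last first.
    rewrite /outer dramp0r ?mul0r ?mulr0// subrK lerXn2r ?nnegrE ?ltW//.
    exact: lt_trans ra.
  have -> : a / 2 * (outer tau (rho ^+ 2) * (2 * Num.max rho 0)) =
      outer tau (rho ^+ 2) * (Num.max rho 0 * a) by field.
  apply: ler_wpM2l => //; rewrite expr2 -mulrA; apply: ler_wpM2l => //.
  have s1 : Num.max (sin th) 0 <= 1 by rewrite ge_max sin_le1 ler01.
  rewrite -[leRHS]mulr1; apply: ler_pM => //.
  by rewrite ge_max ra ltW.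
rewrite -lee_fin J_EFin// integral_spherical//.
have mpi : measurable (`[0%R, pi]%classic : set (mR R)) by exact: measurable_itv.
have mpi2 : measurable (`[0%R, pi *+ 2]%classic : set (mR R)) by exact: measurable_itv.
have cd := @continuous_dramp (a ^+ 2 - tau) tau.
have cg : continuous (fun rho : R => outer tau (rho ^+ 2) * (2 * Num.max rho 0)).
  by rewrite /outer; continuity.
apply: (@le_trans _ _ (\int[leb \x leb]_(q in angles) (a / 2)%:E)%E).
  apply: le_integral_lower => q _.
    by apply: integral_ge0 => rho _; rewrite lee_fin; apply: mulr_ge0.
  apply: (@le_trans _ _ (\int[leb]_rho ((a / 2)%:E * (outer tau (rho ^+ 2) * (2 * Num.max rho 0))%:E))%E).
    apply: le_integral_lower => rho _; first by rewrite lee_fin; apply: mulr_ge0.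
    by rewrite nsq_sphere_point -EFinM lee_fin; exact: key.
  rewrite ge0_integralZl//=; last 3 first.
  - exact: (measurable_continuous1 cg).
  - by move=> rho _; rewrite lee_fin.
  - by rewrite lee_fin divr_ge0// ltW.
  by rewrite outer_mass// mule1.
rewrite integral_cst; last exact: measurableX.
rewrite [X in (_ * X)%E](_ : _ = (@lebesgue_measure R \x @lebesgue_measure R)%E angles)//.
have -> : ((@lebesgue_measure R \x @lebesgue_measure R) angles = (pi * (pi *+ 2))%:E)%E.
  have e1 : @lebesgue_measure R [set` `[0, pi]] = pi%:E.
    by rewrite lebesgue_measure_itv/= lte_fin pi_gt0 -EFinB subr0.
  have e2 : @lebesgue_measure R [set` `[0, pi *+ 2]] = (pi *+ 2)%:E.
    by rewrite lebesgue_measure_itv/= lte_fin pmulrn_lgt0// pi_gt0 -EFinB subr0.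
  rewrite EFinM -e1 -e2; exact: (product_measure1E _ _ mpi mpi2).
rewrite -EFinM lee_fin; have := @pi_gt0 R; lra.
Qed.

(** The points of the sphere at which the inflow survives the limit of
    [psi m] along the inward ray. *)
Definition captured (q : R * R) := radial v (sphere_point a q) < 0 /\
  exists rho0, 0 <= rho0 < 1 /\ forall rho, rho0 < rho < 1 ->
  exists m0, forall m, (m0 <= m)%N -> psi m (rho *: sphere_point a q) = 1.

Definition inflow_shell (tau : R) (m : nat) (p : R3 R) : R :=
  2 * inflow p * outer tau (nsq p) * psi m p.

Let ray_integrand (tau : R) (m : nat) (p : R3 R) : R :=
  inflow_shell tau m (sphere_point p.2 p.1) * (Num.max p.2 0 ^+ 2 * Num.max (sin p.1.1) 0).

Let ray_integral (tau : R) (m : nat) (q : R * R) : \bar R :=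
  (\int[leb]_rho (ray_integrand tau m (q, rho))%:E)%E.

Let max0 (x : R) : 0 <= Num.max x 0. Proof. by rewrite le_max lexx orbT. Qed.

Lemma cc_inflow_shell tau m : 0 < tau -> cc (inflow_shell tau m).
Proof.
move=> tau0.
have cpsi : continuous (psi m) by exact: continuous_reaching.
have cI := continuous_inflow.
have : continuous (fun p => 2 * inflow p * psi m p) by continuity.
move=> /(ccM (cc_outer tau0)); congr cc; apply/funext => p; rewrite /inflow_shell; ring.
Qed.

Lemma inflow_shell_ge0 tau m p : 0 < tau -> 0 <= inflow_shell tau m p.
Proof.
move=> tau0; have /andP[p0 _] : 0 <= psi m p <= 1 by exact: reaching_unit.
rewrite /inflow_shell; apply: mulr_ge0 => //; apply: mulr_ge0.
  by apply: mulr_ge0 => //; exact: inflow_ge0.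
by apply: dramp_ge0; exact: ltW.
Qed.

Let ray_integrand_ge0 tau m p : 0 < tau -> 0 <= ray_integrand tau m p.
Proof.
move=> tau0; apply: mulr_ge0; first exact: inflow_shell_ge0.
by apply: mulr_ge0 => //; exact: sqr_ge0.
Qed.

Let continuous_ray_integrand tau m : 0 < tau -> continuous (ray_integrand tau m).
Proof.
move=> tau0; have [ci _] := cc_inflow_shell m tau0.
have csin := @continuous_sin R; have ccos := @continuous_cos R.
by rewrite /ray_integrand /sphere_point; continuity.
Qed.

Let ray_integral_ge0 tau m q : 0 < tau -> (0 <= ray_integral tau m q)%E.
Proof.
by move=> tau0; apply: integral_ge0 => rho _; rewrite lee_fin; exact: ray_integrand_ge0.
Qed.

Let measurable_ray_integral tau m : 0 < tau -> measurable_fun [set: mR2 R] (ray_integral tau m).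
Proof.
move=> tau0; apply: (measurable_line_integral (K := ray_integrand tau m)).
  exact: continuous_ray_integrand.
by move=> p; exact: ray_integrand_ge0.
Qed.

Let J_inflow_shell tau m : 0 < tau ->
  ((J (inflow_shell tau m))%:E = \int[leb \x leb]_(q in angles) ray_integral tau m q)%E.
Proof.
move=> tau0; have icc := cc_inflow_shell m tau0; have [ci _] := icc.
rewrite J_EFin//; apply: (integral_spherical ci) => p; exact: inflow_shell_ge0.
Qed.

(** Fatou's lemma along a ray: where the trajectories do enter the small ball,
    a thin shell keeps almost the whole inflow in the limit. *)
Lemma ray_integral_lower q (e : R) : captured q -> 0 < e < a -> e < inflow (sphere_point a q) ->
  exists tau0, 0 < tau0 /\ forall tau, 0 < tau <= tau0 ->
  (((inflow (sphere_point a q) - e) * (a - e) * Num.max (sin q.1) 0)%:E <=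
    limn_einf (fun m => ray_integral tau m q))%E.
Proof.
move=> [radq [rho0 [/andP[rho00 rho01] reachq]]] /andP[e0 ea] eN.
set N := inflow _ in eN *; set s := Num.max (sin q.1) 0.
have csin := @continuous_sin R; have ccos := @continuous_cos R.
have cI := continuous_inflow.
have cray : continuous (fun rho : R => inflow (sphere_point rho q)).
  by rewrite /sphere_point; continuity.
have := cray a => /cvgrPdist_lt/(_ e e0)/nbhs_ballP[d /= d0 ballP].
(* For [b < rho < a] the inflow at radius rho is within e of its value on the
   sphere, and psi m is eventually 1 there. *)
pose b := Num.max (rho0 * a) (Num.max (a - d) (a - e)).
have ba : b < a.
  by rewrite /b !gt_max gtr_pMl// rho01 !gtrBl d0 e0.
have b0 : 0 < b.
  apply: (@lt_le_trans _ _ (a - e)); first by rewrite subr_gt0.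
  by rewrite /b !le_max lexx !orbT.
exists (a ^+ 2 - b ^+ 2); split.
  by rewrite subr_gt0 ltrXn2r ?nnegrE// ltW.
move=> tau /andP[tau0 taub].
have taua : 0 < tau < a ^+ 2.
  by rewrite tau0 (le_lt_trans taub)// gtrBl exprn_gt0.
have c1 := @continuous_dramp (a ^+ 2 - tau) tau.
pose C := (N - e) * (a - e) * s.
have C0 : 0 <= C.
  apply: mulr_ge0; last exact: max0.
  by apply: mulr_ge0; rewrite subr_ge0 ltW.
have o0 t : 0 <= outer tau t by apply: dramp_ge0; exact: ltW.
pose g (rho : R) := outer tau (rho ^+ 2) * (2 * Num.max rho 0).
have cg : continuous g by rewrite /g /outer; continuity.
have g0 rho : 0 <= g rho by apply: mulr_ge0 => //; apply: mulr_ge0.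
have -> : C%:E = (\int[leb]_rho (C%:E * (g rho)%:E))%E.
  rewrite ge0_integralZl//=; last 2 first.
  - exact: (measurable_continuous1 cg).
  - by move=> rho _; rewrite lee_fin.
  by rewrite outer_mass// mule1.
have slice m : continuous (fun rho : R => ray_integrand tau m (q, rho)).
  apply: (@continuous_comp_all R (R3 R) R (fun rho => (q, rho)) (ray_integrand tau m)).
    by continuity.
  exact: continuous_ray_integrand.
apply: (@le_trans _ _ (\int[leb]_rho limn_einf (fun m => (ray_integrand tau m (q, rho))%:E))%E).
  apply: le_integral_lower => rho _; first by rewrite mule_ge0 ?lee_fin.
  have [out|rin] := boolP (outer tau (rho ^+ 2) * Num.max rho 0 == 0).
    have -> : g rho = 0.
      by rewrite /g mulrCA (eqP out) mulr0.
    rewrite mule0; apply: (limn_einf_ge (n0 := 0%N)) => m _.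
    by rewrite lee_fin ray_integrand_ge0.
  have [rho_pos nz] : 0 < rho /\ outer tau (rho ^+ 2) != 0.
    move: rin; rewrite mulf_eq0 negb_or => /andP[-> H]; split=> //.
    by rewrite ltNge; apply/negP => h; move: H; rewrite max_r// eqxx.
  have rho_a : rho < a.
    rewrite ltNge; apply/negP => ar; move/negP: nz; apply; apply/eqP.
    rewrite /outer dramp0r// subrK lerXn2r ?nnegrE// ltW//.
  have b_rho : b < rho.
    rewrite ltNge; apply/negP => rb; move/negP: nz; apply; apply/eqP.
    rewrite /outer dramp0l//; have : rho ^+ 2 <= b ^+ 2 by rewrite lerXn2r ?nnegrE// ltW.
    move: taub; lra.
  have [m0 m0P] : exists m0, forall m, (m0 <= m)%N -> psi m (sphere_point rho q) = 1.
    have -> : sphere_point rho q = (rho / a) *: sphere_point a q.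
      by rewrite scale_sphere_point mulfVK// gt_eqF.
    apply: reachq; rewrite ltr_pdivlMr// ltr_pdivrMr// mul1r rho_a andbT.
    by apply: le_lt_trans b_rho; rewrite /b !le_max lexx.
  have Nr : N - e <= inflow (sphere_point rho q).
    have : `|N - inflow (sphere_point rho q)| < e.
      apply: ballP; rewrite /ball/= ltr_norml; apply/andP; split.
        by apply: (@lt_trans _ _ 0); rewrite ?oppr_lt0// subr_gt0.
      rewrite ltrBlDr -ltrBlDl; apply: le_lt_trans b_rho.
      by rewrite /b !le_max lexx !orbT.
    by rewrite ltr_norml => /andP[_]; lra.
  have ar : a - e <= rho.
    by apply: le_trans (ltW b_rho); rewrite /b !le_max lexx !orbT.
  apply: (limn_einf_ge (n0 := m0)) => m mm0.
  rewrite -EFinM lee_fin /ray_integrand /inflow_shell /= nsq_sphere_point m0P// mulr1 /C /g.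
  rewrite max_l; last exact: ltW.
  have -> : (N - e) * (a - e) * s * (outer tau (rho ^+ 2) * (2 * rho)) =
     (2 * outer tau (rho ^+ 2) * rho * s) * ((N - e) * (a - e)) by ring.
  have -> : 2 * inflow (sphere_point rho q) * outer tau (rho ^+ 2) * (rho ^+ 2 * Num.max (sin q.1) 0) =
     (2 * outer tau (rho ^+ 2) * rho * s) * (inflow (sphere_point rho q) * rho).
    by rewrite /s; ring.
  apply: ler_wpM2l.
    apply: mulr_ge0; last exact: max0.
    by apply: mulr_ge0; [exact: mulr_ge0|exact: ltW].
  by apply: ler_pM => //; rewrite subr_ge0 ltW.
apply: fatou => //.
- by move=> m; exact: (measurable_continuous1 (slice m)).
- by move=> m rho _; rewrite lee_fin ray_integrand_ge0.
Qed.

(** [ray_integral_lower] is integrated over the sphere, with Fatou's lemma for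
    [m] tending to infinity at a fixed thickness, and then for the thickness
    tending to zero. The function [F] is arbitrary because it will be the inflow
    cut off to the entry set. *)
Lemma tube_flux (F : R * R -> \bar R) :
  (forall q, angles q -> 0 <= F q)%E ->
  (forall q, angles q -> F q <= (a * inflow (sphere_point a q) * Num.max (sin q.1) 0)%:E)%E ->
  (forall q, angles q -> F q != 0%E -> captured q) ->
  (\int[leb \x leb]_(q in angles) F q <=
    (J (fun p => 2 * `|radial v p| * inner (nsq p)))%:E)%E.
Proof.
move=> F0 Fle Fcaptured.
set X := J _.
pose tn (n : nat) : R := a ^+ 2 / n.+2%:R.
have tn0 n : 0 < tn n by rewrite divr_gt0// a2_gt0.
have tna n : 0 < tn n < a ^+ 2.
  by rewrite tn0/= ltr_pdivrMr// ltr_pMr ?a2_gt0// ltr1n.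
have tn_small t : 0 < t -> exists n0, forall n, (n0 <= n)%N -> tn n <= t.
  move=> t0; exists (Num.truncn (a ^+ 2 / t)) => n nn.
  rewrite ler_pdivrMr// mulrC -ler_pdivrMr//.
  apply: le_trans (ltW (truncnS_gt _)) _.
  by rewrite ler_nat; apply: leq_trans (leqnSn _); rewrite ltnS.
pose W n (q : R * R) := limn_einf (fun m => ray_integral (tn n) m q).
pose W2 (q : R * R) := limn_einf (fun n => W n q).
have mA : measurable (angles : set (mR2 R)) by apply: measurableX; exact: measurable_itv.
have W0 n q : (0 <= W n q)%E.
  by apply: (limn_einf_ge (n0 := 0%N)) => m _; exact: ray_integral_ge0.
have W20 q : (0 <= W2 q)%E by apply: (limn_einf_ge (n0 := 0%N)).
have mray n m : measurable_fun (angles : set (mR2 R)) (ray_integral (tn n) m).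
  by apply: measurable_funTS; exact: measurable_ray_integral.
have mW n : measurable_fun (angles : set (mR2 R)) (W n).
  exact: measurable_fun_limn_einf.
apply: (@le_trans _ _ (\int[leb \x leb]_(q in angles) W2 q)%E).
  apply: le_integral_lower => // q qA.
  have [->//|/(Fcaptured q qA) gq] := eqVneq (F q) 0%E.
  apply/lee_addgt0Pr => eps eps0.
  set N := inflow (sphere_point a q); set s := Num.max (sin q.1) 0.
  have N0 : 0 < N by have [rad _] := gq; rewrite /N /inflow lt_max oppr_gt0 rad.
  have s1 : 0 <= s <= 1 by rewrite max0 ge_max sin_le1 ler01.
  pose e := Num.min (eps / (N + a)) (Num.min (a / 2) (N / 2)).
  have Na0 : 0 < N + a by exact: addr_gt0.
  have e0 : 0 < e by rewrite /e !lt_min !divr_gt0.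
  have ea : e < a.
    have : e <= a / 2 by rewrite /e !ge_min lexx !orbT.
    have := a_gt0; lra.
  have eN : e < N.
    have : e <= N / 2 by rewrite /e !ge_min lexx !orbT.
    lra.
  have eeps : e * (N + a) <= eps.
    by rewrite -ler_pdivlMr// /e ge_min lexx.
  have [tau0 [tau00 H]] := @ray_integral_lower q e gq (introT andP (conj e0 ea)) eN.
  have [n0 Hn] := tn_small _ tau00.
  have low : (((N - e) * (a - e) * s)%:E <= W2 q)%E.
    by apply: (limn_einf_ge (n0 := n0)) => n nn; apply: H; rewrite tn0 Hn.
  apply: le_trans (Fle q qA) _; rewrite -/N -/s.
  apply: (@le_trans _ _ (((N - e) * (a - e) * s)%:E + eps%:E)%E); last exact: leeD2r.
  rewrite -EFinD lee_fin.
  have [s0 s1'] := andP s1.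
  have h1 : e * (N + a) * s <= e * (N + a).
    by rewrite -[leRHS]mulr1; apply: ler_wpM2l => //; apply: mulr_ge0; exact: ltW.
  have h2 : 0 <= e * e * s by apply: mulr_ge0 => //; apply: mulr_ge0; exact: ltW.
  have : a * N * s = (N - e) * (a - e) * s + e * (N + a) * s - e * e * s by ring.
  lra.
apply/lee_addgt0Pr => eps eps0.
pose c : R := 1 + 2 * (a * pi ^+ 2).
have c0 : 0 < c.
  by apply: ltr_pwDl => //; apply: mulr_ge0 => //; apply: mulr_ge0; [exact: ltW|exact: sqr_ge0].
pose del := eps / c.
have del0 : 0 < del by apply: divr_gt0.
have [tau0 [tau00 H]] := tube_step del0.
have [n0 Hn] := tn_small _ tau00.
apply: le_trans (fatou _ mA mW (fun n q _ => W0 n q)) _; apply: (limn_einf_le (n0 := n0)) => n nn.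
apply: le_trans (fatou _ mA (mray n) (fun m q _ => ray_integral_ge0 m q (tn0 n))) _.
have [m0 Hm] := H (tn n) (introT andP (conj (tn0 n) (Hn n nn))).
apply: (limn_einf_le (n0 := m0)) => m mm.
rewrite -J_inflow_shell// -EFinD lee_fin.
apply: le_trans (Hm m mm) _; rewrite -/X.
have := ler_wpM2l (ltW del0) (J_outer (tna n)).
have : del * c = eps by rewrite /del mulfVK// gt_eqF.
rewrite /c; lra.
Qed.

End flux.

(** * Reduction to a compactly supported field *)

Section row_vectors.
Context {R : realType}.
Implicit Types (p : R3 R) (x : 'rV[R]_3).

Lemma vec3_coord i p : vec3 p ord0 i = crd i p.
Proof. by rewrite mxE; have [->|[->|->]] := I3P i. Qed.

Definition unvec x : R3 R := (x ord0 i0, x ord0 i1, x ord0 i2).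

Lemma crd_unvec i x : crd i (unvec x) = x ord0 i.
Proof. by have [->|[->|->]] := I3P i. Qed.

Lemma unvecK x : vec3 (unvec x) = x.
Proof. by apply/rowP => i; rewrite vec3_coord crd_unvec. Qed.

Lemma vec3K p : unvec (vec3 p) = p.
Proof. by apply: coord_eq => i; rewrite crd_unvec vec3_coord. Qed.

Lemma dot_vec3 p x : dot x (vec3 p) = \sum_i crd i p * x ord0 i.
Proof. by apply: eq_bigr => i _; rewrite vec3_coord mulrC. Qed.

Lemma enorm_vec3 p : enorm (vec3 p) = Num.sqrt (nsq p).
Proof.
by rewrite /enorm dot_vec3; congr Num.sqrt; apply: eq_bigr => i _; rewrite vec3_coord expr2.
Qed.

Lemma enorm_lt p (c : R) : 0 < c -> (enorm (vec3 p) < c) = (nsq p < c ^+ 2).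
Proof.
move=> c0; rewrite enorm_vec3.
by rewrite -[in LHS](ger0_norm (ltW c0)) -sqrtr_sqr ltr_sqrt// exprn_gt0.
Qed.

Lemma enorm_eq p (c : R) : 0 < c -> enorm (vec3 p) = c -> nsq p = c ^+ 2.
Proof. by move=> c0 <-; rewrite enorm_vec3 sqr_sqrtr// nsq_ge0. Qed.

Lemma vec3B p (p' : R3 R) : vec3 (p - p') = vec3 p - vec3 p'.
Proof.
apply/rowP => i; rewrite vec3_coord coordD coordN -!vec3_coord [RHS]mxE.
by rewrite [X in _ = _ + X]mxE.
Qed.

Lemma norm_vec3 p : `|vec3 p| <= `|p|.
Proof.
rewrite [leLHS]/Num.Def.normr/= mx_normrE; apply: bigmax_le => //= -[k i] _.
by rewrite ord1/= vec3_coord norm_coord.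
Qed.

Lemma continuous_vec3 : continuous (@vec3 R).
Proof.
move=> p; apply/cvgrPdist_lt => e e0; near=> q.
rewrite -vec3B.
apply: le_lt_trans (norm_vec3 _) _; near: q.
by apply: cvgr_dist_lt.
Unshelve. all: by end_near. Qed.

Lemma vec3_ins i q (h t : R) : vec3 (ins i q (h + t)) = h *: e_ R i + vec3 (ins i q t).
Proof.
apply/rowP => k; rewrite !mxE eqxx/=.
by have [->|[->|->]] := I3P i; have [->|[->|->]] := I3P k; rewrite /= ?mulr1 ?mulr0 ?add0r.
Qed.

Lemma is_derive_line (u : 'rV[R]_3 -> 'rV[R]_3) i j q (t : R) :
  derivable u (vec3 (ins i q t)) (e_ R i) ->
  is_derive t (1 : R) (fun s => u (vec3 (ins i q s)) ord0 j)
    (('D_(e_ R i) u (vec3 (ins i q t))) ord0 j).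
Proof.
move=> du; rewrite (derive_mx du) mxE.
have := (derivable_mxP u _ _).1 du ord0 j.
set g := (fun x => u x ord0 j) => dg.
have E : (fun h : R => h^-1 *: (((fun s : R => g (vec3 (ins i q s))) \o shift t) (h *: (1 : R)) - g (vec3 (ins i q t))))
  = (fun h : R => h^-1 *: ((g \o shift (vec3 (ins i q t))) (h *: e_ R i) - g (vec3 (ins i q t)))).
  by apply/funext => h; rewrite /= [h *: (1 : R)]mulr1 vec3_ins.
apply: DeriveDef; last by rewrite /derive E.
by rewrite /derivable E.
Qed.

End row_vectors.

Section cutoff.
Context {R : realType}.
Variables (U : set (R3 R)) (g : R3 R -> R) (dg : 'I_3 -> R3 R -> R) (lo hi : R).
Hypothesis shellU : forall p, lo <= nsq p <= hi -> U p.
Hypothesis cg : forall p, U p -> {for p, continuous g}.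

Let near_out (c : R -> R) : (forall t, (t < lo) || (hi < t) -> c t = 0) ->
  forall p, ~ U p -> \forall q \near p, c (nsq q) = 0.
Proof.
move=> c0 p nUp; have cn := @continuous_nsq R p.
have : (nsq p < lo) || (hi < nsq p).
  by rewrite !ltNge -negb_and; apply/negP => /shellU.
move=> /orP[H|H].
- near=> q; apply: c0; apply/orP; left; near: q.
  exact: (cvgr_lt (nsq p)).
- near=> q; apply: c0; apply/orP; right; near: q.
  exact: (cvgr_gt (nsq p)).
Unshelve. all: by end_near. Qed.

(** Outside [U] the profile vanishes in a neighbourhood, so that [g] has to be
    regular on [U] only. *)
Lemma cc_cut (c : R -> R) : continuous c ->
  (forall t, (t < lo) || (hi < t) -> c t = 0) -> cc (fun p => c (nsq p) * g p).
Proof.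
move=> cont_c c0; split.
  move=> p; have [Up|nUp] := pselect (U p).
    apply: cvgM; last exact: cg.
    by apply: (@continuous_comp_all _ _ _ (@nsq R) c) => //; exact: continuous_nsq.
  have H := near_out c0 nUp; have H0 := nbhs_singleton H.
  rewrite /continuous_at H0 mul0r.
  apply/cvgrPdist_lt => e e0; near=> q.
  suff -> : c (nsq q) = 0 by rewrite mul0r subrr normr0.
  by near: q.
exists (Num.max hi 0 + 1) => p Hp; rewrite c0 ?mul0r//.
apply/orP; right; apply: lt_le_trans (sqr_norm_le p).
have h1 : hi <= Num.max hi 0 by rewrite le_max lexx.
have h2 : 0 <= Num.max hi 0 by rewrite le_max lexx orbT.
nra.
Unshelve. all: by end_near. Qed.

Lemma partial_cut (c c' : R -> R) i : (forall t, is_derive t (1 : R) c (c' t)) ->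
  (forall t, (t < lo) || (hi < t) -> c t = 0) ->
  (forall t, (t < lo) || (hi < t) -> c' t = 0) ->
  (forall q t, U (ins i q t) ->
     is_derive t (1 : R) (fun s => g (ins i q s)) (dg i (ins i q t))) ->
  has_partial i (fun p => c (nsq p) * g p)
       (fun p => c (nsq p) * dg i p + c' (nsq p) * (2 * crd i p * g p)).
Proof.
move=> cD c0 c'0 gD q t; have [Up|nUp] := pselect (U (ins i q t)).
  have D1 := partial_radial_profile i cD q t.
  have D2 := gD q t Up.
  have := is_deriveM D1 D2; congr is_derive.
  by rewrite /= /GRing.scale/=; ring.
have H := near_out c0 nUp; rewrite (nbhs_singleton (near_out c'0 nUp)).
rewrite (nbhs_singleton H) !mul0r addr0.
have ci : continuous (fun s : R => ins i q s) by apply: continuous_ins; continuity.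
apply: (@near_eq_is_derive R R R (cst 0) _ _ _ _ _ (is_derive_cst _ _ _)).
have Hs : \forall s \near t, c (nsq (ins i q s)) = 0 := ci t _ H.
by near=> s; rewrite /= (_ : c (nsq (ins i q s)) = 0) ?mul0r//; near: s.
Unshelve. all: by end_near. Qed.

End cutoff.

Section cutoff_field.
Context {R : realType}.
Variables (Omega : set 'rV[R]_3) (a : R).
Hypotheses (openO : open Omega) (a_gt0 : 0 < a).
Hypothesis ballO : closure (eball a) `<=` Omega.

Lemma closed_ball_closure (p : R3 R) : nsq p <= a ^+ 2 -> closure (eball a) (vec3 p).
Proof.
move=> pa B nB.
have cs : continuous (fun c : R => vec3 (c *: p)).
  apply: (@continuous_comp_all _ _ _ (fun c : R => c *: p) (@vec3 R)).
    by move=> c; apply: cvgZr_tmp; exact: cvg_id.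
  exact: continuous_vec3.
have H : \forall c \near (1 : R), B (vec3 (c *: p)).
  by apply: (cs 1); rewrite scale1r.
have /nbhs_ballP[d /= d0 dB] := H.
pose c := Num.max 2^-1 (1 - d / 2).
have c1 : c < 1 by rewrite gt_max invf_lt1// ltr1n gtrBl divr_gt0.
have c0 : 0 < c by rewrite lt_max invr_gt0 ltr0n.
exists (vec3 (c *: p)); split; last first.
  apply: dB; rewrite /ball/= gtr0_norm ?subr_gt0//.
  have : 1 - d / 2 <= c by rewrite le_max lexx orbT.
  lra.
rewrite /eball/= enorm_lt//; have -> : nsq (c *: p) = c ^+ 2 * nsq p.
  by rewrite /nsq mulr_sumr; apply: eq_bigr => i _; rewrite coordZ exprMn.
have a2 : 0 < a ^+ 2 by rewrite exprn_gt0.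
have c2 : c ^+ 2 < 1 by rewrite expr_lt1// ltW.
have := nsq_ge0 p; have := sqr_ge0 c; nra.
Qed.

(** Otherwise the squared radius would attain its minimum on the part of a larger
    ball outside [Omega], and this minimum would be at most [a ^+ 2]. *)
Lemma ball_room : exists kappa, 0 < kappa /\
  forall p : R3 R, nsq p <= a ^+ 2 + kappa -> Omega (vec3 p).
Proof.
pose A := [set p : R3 R | `|p| <= a + 1] `&` (@vec3 R @^-1` ~` Omega).
have cA : compact A.
  apply: compact_closedI; first exact: box_compact.
  apply: closed_comp; last by rewrite closedC.
  by move=> p _; exact: continuous_vec3.
have a2 : 0 < a ^+ 2 by rewrite exprn_gt0.
have inbox (p : R3 R) : nsq p <= a ^+ 2 + 1 -> `|p| <= a + 1.
  move=> pa; rewrite leNgt; apply/negP => ap.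
  have : (a + 1) ^+ 2 < `|p| ^+ 2.
    by rewrite ltrXn2r ?nnegrE// addr_ge0// ltW.
  by have := sqr_norm_le p; rewrite sqrrD1; have := a_gt0; lra.
have [A0|/set0P A0] := eqVneq A set0.
  exists 1; split=> // p /inbox pb; apply: contrapT => nO.
  by have : A p by []; rewrite A0.
have [c /set_mem[_ /= cO] cmin] := @compact_EVT_min _ R (@nsq R) A A0 cA
  (continuous_subspaceT (@continuous_nsq R)).
have ac : a ^+ 2 < nsq c.
  by rewrite ltNge; apply/negP => /closed_ball_closure/ballO.
pose k := Num.min 1 ((nsq c - a ^+ 2) / 2).
have k1 : k <= 1 by rewrite ge_min lexx.
have k2 : k <= (nsq c - a ^+ 2) / 2 by rewrite ge_min lexx orbT.
exists k; split; first by rewrite lt_min ltr01 divr_gt0// subr_gt0.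
move=> p pk; apply: contrapT => nO.
have Ap : A p by split=> //; apply: inbox; lra.
have := cmin p (mem_set Ap); lra.
Qed.

Variables (u : 'rV[R]_3 -> 'rV[R]_3) (r : R).
Hypotheses (hu : Ck 1 (Omega `\ 0) u) (r_gt0 : 0 < r).
Hypothesis hdiv : forall x, (Omega `\ 0) x -> divergence u x = 0.

Let punctured : set (R3 R) := [set p | Omega (vec3 p) /\ 0 < nsq p].

Lemma punctured_vec3 p : Omega (vec3 p) -> 0 < nsq p -> (Omega `\ 0) (vec3 p).
Proof.
move=> Op p0; split=> // /(congr1 unvec); rewrite vec3K => E.
by move: p0; rewrite E /nsq big1 ?ltxx// => i _; rewrite crd_unvec mxE expr0n.
Qed.

(** Multiplies [u] by a profile of the squared radius that is 1 on
    [[r ^+ 2 / 2, a ^+ 2]] and vanishes near 0 and outside a slightly larger ball.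
    The lower end lies below [r ^+ 2] so that a streamline of [u] solves the
    equation of the new field until it is strictly inside the ball of radius
    [r]. *)
Lemma cutoff_field : exists v dv,
  [/\ forall j, cc (v j), forall j i, cc (dv j i), forall j i, has_partial i (v j) (dv j i),
      forall j p, r ^+ 2 / 2 <= nsq p <= a ^+ 2 -> v j p = u (vec3 p) ord0 j &
      forall p, r ^+ 2 / 2 <= nsq p <= a ^+ 2 -> \sum_i dv i i p = 0].
Proof.
have [k [k0 kO]] := ball_room.
have r2 : 0 < r ^+ 2 / 4 by rewrite divr_gt0// exprn_gt0.
pose f := ramp (r ^+ 2 / 4) (r ^+ 2 / 4); pose g := ramp (a ^+ 2) k.
pose df := dramp (r ^+ 2 / 4) (r ^+ 2 / 4); pose dg := dramp (a ^+ 2) k.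
pose c (t : R) := f t * (1 - g t).
pose c' (t : R) := f t * - dg t + (1 - g t) * df t.
have cf : continuous f by exact: continuous_ramp.
have cg : continuous g by exact: continuous_ramp.
have cdf : continuous df by exact: continuous_dramp.
have cdg : continuous dg by exact: continuous_dramp.
have cont_c : continuous c by rewrite /c; continuity.
have cont_c' : continuous c' by rewrite /c'; continuity.
have cD t : is_derive t (1 : R) c (c' t).
  have D1 : is_derive t (1 : R) f (df t) by exact: is_derive_ramp.
  have D2 : is_derive t (1 : R) g (dg t) by exact: is_derive_ramp.
  have D3 : is_derive t (1 : R) (cst 1 - g) (0 - dg t) by exact: is_deriveB.
  have := is_deriveM D1 D3; congr is_derive.
  by rewrite /c' /GRing.scale/= sub0r.
have cc0 t : (t < r ^+ 2 / 4) || (a ^+ 2 + k < t) -> c t = 0.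
  move=> /orP[/ltW H|/ltW H]; first by rewrite /c /f ramp0// mul0r.
  by rewrite /c /g ramp1// subrr mulr0.
have c'0 t : (t < r ^+ 2 / 4) || (a ^+ 2 + k < t) -> c' t = 0.
  move=> /orP[/ltW H|/ltW H].
    by rewrite /c' /f /df ramp0// dramp0l// mul0r mulr0 addr0.
  by rewrite /c' /g /dg ramp1// dramp0r// subrr oppr0 mulr0 mul0r addr0.
have cc1 t : r ^+ 2 / 2 <= t <= a ^+ 2 -> c t = 1.
  move=> /andP[H1 H2]; rewrite /c /f /g ramp1//; last lra.
  by rewrite ramp0// subr0 mulr1.
have c'1 t : r ^+ 2 / 2 <= t <= a ^+ 2 -> c' t = 0.
  move=> /andP[H1 H2]; rewrite /c' /df /dg dramp0l// dramp0r//; last lra.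
  by rewrite oppr0 !mulr0 addr0.
have shell p : r ^+ 2 / 4 <= nsq p <= a ^+ 2 + k -> punctured p.
  by move=> /andP[H1 H2]; split; [exact: kO|exact: lt_le_trans H1].
have [cu du] := hu.
have cont_comp (w : 'rV[R]_3 -> 'rV[R]_3) j : (forall x, (Omega `\ 0) x -> {for x, continuous w}) ->
    forall p, punctured p -> {for p, continuous (fun p => w (vec3 p) ord0 j)}.
  move=> cw p [Op p0].
  have cwp : {for vec3 p, continuous w} by apply: cw; exact: punctured_vec3.
  have H : {for p, continuous (w \o @vec3 R)}.
    by apply: continuous_comp; [exact: continuous_vec3|exact: cwp].
  exact: (continuous_comp H (@coord_continuous R 1 3 ord0 j _)).
pose U j p : R := u (vec3 p) ord0 j.
pose dU j i p : R := ('D_(e_ R i) u (vec3 p)) ord0 j.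
have cU j := cont_comp u j cu.
have cdU j i : forall p, punctured p -> {for p, continuous (dU j i)}.
  by apply: (cont_comp ('D_(e_ R i) u)); have [_ []] := du i.
exists (fun j p => c (nsq p) * U j p).
exists (fun j i p => c (nsq p) * dU j i p + c' (nsq p) * (2 * crd i p * U j p)).
split.
- by move=> j; exact: (cc_cut shell (cU j) cont_c cc0).
- move=> j i; apply: ccD; first exact: (cc_cut shell (cdU j i) cont_c cc0).
  apply: (cc_cut shell _ cont_c' c'0) => p Pp.
  apply: (@cvgM _ _ _ _ (fun p => 2 * crd i p)); last exact: cU.
  by apply: cvgM; [exact: cvg_cst|exact: continuous_coord].
- move=> j i; apply: (partial_cut shell cD cc0 c'0).
  move=> q t [Op p0]; apply: is_derive_line.
  by have [H _] := du i; apply: H; exact: punctured_vec3.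
- by move=> j p H; rewrite cc1// mul1r.
- move=> p H; under eq_bigr do rewrite c'1// cc1// mul1r mul0r addr0.
  apply: hdiv; have /andP[H1 H2] := H; apply: punctured_vec3.
    by apply: kO; lra.
  by apply: lt_le_trans H1; lra.
Qed.

End cutoff_field.

(** * Streamlines from the entry set *)

Section streamlines.
Context {R : realType}.

Lemma within_comp (T U V : topologicalType) (A : set T) (f : T -> U) (g : U -> V) :
  {within A, continuous f} -> continuous g -> {within A, continuous (fun t => g (f t))}.
Proof. by move=> cf cg x; exact: (continuous_comp (cf x) (cg (f x))). Qed.

Lemma continuous_unvec : continuous (@unvec R).
Proof.
have c i : continuous (fun x : 'rV[R]_3 => x ord0 i) by exact: coord_continuous.
have c0 := c i0; have c1 := c i1; have c2 := c i2.
by rewrite /unvec; continuity.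
Qed.

Lemma first_hit (n : R -> R) (s l : R) : 0 <= s -> {within `[0, s], continuous n} ->
  n s <= l -> exists s1, [/\ 0 <= s1 <= s, n s1 <= l & forall t, 0 <= t < s1 -> l < n t].
Proof.
move=> s0 cn ns.
have := @closed_comp (subspace `[0, s]%classic) R n [set t | t <= l] (fun x _ => cn x) (@closed_le R l).
move=> /closed_subspaceP[V cV VE].
have HV t : 0 <= t <= s -> V t <-> n t <= l.
  move=> ts; have ti : `[0, s]%classic t by rewrite /= in_itv.
  split=> [Vt|nt].
    have : (V `&` `[0, s]%classic) t by split.
    by rewrite VE => -[].
  have : ((n @^-1` [set t | t <= l]) `&` `[0, s]%classic) t by split.
  by rewrite -VE => -[].
pose A := `[0, s]%classic `&` V.
have cA : compact A by apply: compact_closedI => //; exact: segment_compact.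
have A0 : A !=set0.
  by exists s; split; [rewrite /= in_itv/= s0 lexx|apply/HV => //; rewrite s0 lexx].
have [|s1 /set_mem[s1s Vs1] smin] := @compact_EVT_min _ R id A A0 cA.
  by apply: continuous_subspaceT => x; exact: cvg_id.
move: s1s; rewrite /= in_itv/= => s1s.
exists s1; split=> //; first exact/HV.
move=> t /andP[t0 ts1]; rewrite ltNge; apply/negP => nt.
have ts : 0 <= t <= s by rewrite t0 (le_trans (ltW ts1))//; have /andP[] := s1s.
have /smin : t \in A by apply/mem_set; split; [rewrite /= in_itv|exact/HV].
by rewrite leNgt ts1.
Qed.

Lemma is_derive_nsq (v : 'I_3 -> R3 R -> R) (c : R -> R3 R) (t : R) :
  (forall i, is_derive t (1 : R) (fun s => crd i (c s)) (v i (c t))) ->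
  is_derive t (1 : R) (fun s => nsq (c s)) (2 * radial v (c t)).
Proof.
move=> D.
have E : (fun s => nsq (c s)) = (fun s : R => crd i0 (c s)) * (fun s : R => crd i0 (c s))
   + (fun s : R => crd i1 (c s)) * (fun s : R => crd i1 (c s))
   + (fun s : R => crd i2 (c s)) * (fun s : R => crd i2 (c s)).
  by apply/funext => s; rewrite /nsq sum3 /= !expr2.
rewrite E; have M i := is_deriveM (D i) (D i).
have := is_deriveD (is_deriveD (M i0) (M i1)) (M i2); congr is_derive.
by rewrite /radial sum3 /GRing.scale/=; ring.
Qed.

(** Otherwise the squared radius would increase right after time 0. *)
Lemma radial_nonpos (v : 'I_3 -> R3 R -> R) (c : R -> R3 R) (s : R) :
  continuous (radial v) -> 0 < s ->
  {within `[0, s], continuous c} ->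
  (forall i t, 0 < t < s -> is_derive t (1 : R) (fun s => crd i (c s)) (v i (c t))) ->
  (forall t, 0 < t < s -> nsq (c t) < nsq (c 0)) -> radial v (c 0) <= 0.
Proof.
move=> cr s0 cc D H; rewrite leNgt; apply/negP => rad0.
have cw (f : R3 R -> R) : continuous f -> {within `[0, s], continuous (fun t => f (c t))}.
  exact: within_comp.
have [_ cvr _] := (continuous_within_itvP _ s0).1 (cw _ cr).
have : \forall t \near 0^'+, 0 < radial v (c t) by exact: (cvgr_gt _ cvr).
move=> /nbhs_ballP[d /= d0 dP].
pose t := Num.min d s / 2.
have ms : Num.min d s <= s by rewrite ge_min lexx orbT.
have md : Num.min d s <= d by rewrite ge_min lexx.
have m0 : 0 < Num.min d s by rewrite lt_min d0.
have t0 : 0 < t by rewrite divr_gt0.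
have ts : t < s by rewrite /t; lra.
have td : t < d by rewrite /t; lra.
have [||x] := @MVT _ (fun t => nsq (c t)) (fun t => 2 * radial v (c t)) 0 t t0.
- move=> x; rewrite in_itv/= => /andP[x0 xt]; apply: is_derive_nsq => i.
  by apply: D; rewrite x0 (lt_trans xt).
- apply: (@continuous_subspaceW _ _ _ `[0, s]%classic); last exact: (cw _ (@continuous_nsq R)).
  by move=> x /=; rewrite !in_itv/= => /andP[-> /le_trans->//]; exact: ltW.
rewrite in_itv/= subr0 => /andP[x0 xt] E.
have : 0 < radial v (c x).
  apply: dP => //; rewrite /ball/= sub0r normrN gtr0_norm//; exact: lt_trans td.
have := H t; rewrite t0 ts => /(_ isT); nra.
Qed.

Variables (Omega : set 'rV[R]_3) (u : 'rV[R]_3 -> 'rV[R]_3).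
Variables (v : 'I_3 -> R3 R -> R) (a r K L : R).
Hypotheses (a_gt0 : 0 < a) (r_gt0 : 0 < r) (r_lt_a : r < a).
Hypotheses (v_cc : forall i, cc (v i)) (K_gt0 : 0 < K) (v_le : forall i p, `|v i p| <= K).
Hypotheses (L_gt0 : 0 < L) (v_lip : forall i p (q : R3 R), `|v i p - v i q| <= L * `|p - q|).
Hypothesis vu : forall j p, r ^+ 2 / 2 <= nsq p <= a ^+ 2 -> v j p = u (vec3 p) ord0 j.

Lemma dot_nhat p : nsq p = a ^+ 2 ->
  dot (u (vec3 p)) (nhat (vec3 p)) = a^-1 * radial v p.
Proof.
move=> pa; have e : enorm (vec3 p) = a by rewrite enorm_vec3 pa sqrtr_sqr gtr0_norm.
have H : r ^+ 2 / 2 <= nsq p <= a ^+ 2.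
  have : r ^+ 2 < a ^+ 2 by rewrite ltrXn2r ?nnegrE// ltW.
  by rewrite pa lexx andbT; have := sqr_ge0 r; lra.
rewrite /dot /nhat e mulr_sumr; apply: eq_bigr => i _.
by rewrite mxE vec3_coord vu//; ring.
Qed.

(** The streamline is stopped when its squared radius first comes down to
    [l < r ^+ 2]; up to then it stays in the region where [v] agrees with [u],
    because [l] is at least [r ^+ 2 / 2]. *)
Lemma entry_streamline p : entry_set Omega u a r (vec3 p) -> exists (c : R -> R3 R) s1,
  [/\ 0 < s1, c 0 = p /\ nsq p = a ^+ 2, {within `[0, s1], continuous c},
      forall i t, 0 < t < s1 -> is_derive t (1 : R) (fun s => crd i (c s)) (v i (c t)) &
      (forall t, 0 < t <= s1 -> nsq (c t) < a ^+ 2) /\ nsq (c s1) < r ^+ 2].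
Proof.
move=> [pa [T [gam [[[T0 gam0 _ cgam dgam] _]]]]] [s [s0 sT ins inside]].
have r2a2 : r ^+ 2 < a ^+ 2 by rewrite ltrXn2r ?nnegrE// ltW.
pose c t := unvec (gam t).
have vecc t : vec3 (c t) = gam t by rewrite unvecK.
have c0p : c 0 = p by rewrite /c gam0 vec3K.
have np : nsq p = a ^+ 2 by apply: enorm_eq.
have cc : {within `[0, s], continuous c}.
  have cs : {within `[0, s], continuous gam}.
    apply: continuous_subspaceW cgam => t /=; rewrite in_itv/= => /andP[-> ts]; split=> //.
    by apply: le_lt_trans sT; rewrite lee_fin.
  exact: (within_comp cs continuous_unvec).
have cn : {within `[0, s], continuous (fun t => nsq (c t))}.
  exact: (within_comp cc (@continuous_nsq R)).
have nlt t : 0 < t < s -> nsq (c t) < a ^+ 2.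
  by move=> /andP[t0 ts]; have := inside t t0 ts; rewrite -vecc /eball/= enorm_lt.
have ns : nsq (c s) < r ^+ 2 by move: ins; rewrite -vecc /eball/= enorm_lt.
pose l := Num.max (nsq (c s)) (r ^+ 2 / 2).
have lr : l < r ^+ 2 by rewrite gt_max ns; have : 0 < r ^+ 2 := exprn_gt0 2 r_gt0; lra.
have nsl : nsq (c s) <= l by rewrite le_max lexx.
have [s1 [/andP[s10 s1s] ns1 before]] := first_hit (ltW s0) cn nsl.
have s1_gt0 : 0 < s1.
  rewrite lt_neqAle s10 andbT; apply/negP => /eqP E.
  by move: ns1; rewrite -E c0p np leNgt (lt_trans lr).
have lt_s1 t : 0 < t <= s1 -> nsq (c t) < a ^+ 2.
  move=> /andP[t0 ts1]; have [ts|st] := ltP t s; first by apply: nlt; rewrite t0.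
  have -> : t = s by apply/eqP; rewrite eq_le st (le_trans ts1).
  exact: lt_trans ns _.
exists c, s1; split=> //.
- apply: continuous_subspaceW cc => t /=; rewrite !in_itv/= => /andP[-> /le_trans]; exact.
- move=> i t /andP[t0 ts1].
  have ts : t < s by exact: lt_le_trans s1s.
  have tT : (t%:E < T)%E by apply: lt_trans sT; rewrite lte_fin.
  have [Dg Dv] := dgam t t0 tT.
  have E : (fun s => crd i (c s)) = (fun s => gam s ord0 i).
    by apply/funext => x; rewrite crd_unvec.
  have vE : v i (c t) = u (gam t) ord0 i.
    rewrite vu ?vecc//; apply/andP; split; last by apply/ltW/nlt; rewrite t0.
    apply: le_trans (ltW (before t _)); first by rewrite le_max lexx orbT.
    by rewrite ts1 ltW.
  rewrite E vE -Dv (derive_mx Dg) mxE.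
  apply: DeriveDef => //.
  exact: ((derivable_mxP gam _ _).1 Dg).
- by split=> //; exact: le_lt_trans lr.
Qed.

Lemma entry_captured q : entry_set Omega u a r (sph a q) ->
  dot (u (sph a q)) (nhat (sph a q)) != 0 -> captured v a r q.
Proof.
rewrite -[sph a q]/(vec3 (sphere_point a q)).
move=> /entry_streamline[c [s1 [s10 [c0 np] cc D [inside below]]]].
rewrite dot_nhat// => nz.
have rad : radial v (sphere_point a q) < 0.
  rewrite lt_neqAle; apply/andP; split.
    by apply: contraNneq nz => ->; rewrite mulr0.
  rewrite -c0; apply: (@radial_nonpos v c s1) => //.
    by have [] := cc_radial v_cc.
  by move=> t /andP[t0 ts]; rewrite c0 np inside// t0 ltW.
split=> //.
have cci i : {within `[0, s1], continuous (fun t => crd i (c t))}.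
  exact: (within_comp cc (@continuous_coord R i)).
have := reaching_near_streamline v_cc K_gt0 v_le L_gt0 v_lip a_gt0 s10 cci D.
rewrite c0 => /(_ (r ^+ 2)); apply => //.
Qed.

End streamlines.

Section flux_bound.
Context {R : realType}.

Lemma abse_integral_npos d (T : measurableType d) (mu : {measure set T -> \bar R})
    (D : set T) (G : T -> \bar R) : (forall x, D x -> G x <= 0)%E ->
  (`| \int[mu]_(x in D) G x | = \int[mu]_(x in D) - G x)%E.
Proof.
move=> G0; rewrite integralE.
have -> : (\int[mu]_(x in D) (G^\+ x) = 0)%E.
  apply: integral0_eq => x Dx; rewrite funeposE; apply/max_idPr; exact: G0.
rewrite sub0e abseN.
have -> : (\int[mu]_(x in D) (G^\- x) = \int[mu]_(x in D) - G x)%E.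
  apply: eq_integral => x /set_mem Dx; rewrite funenegE; apply/max_idPl.
  by rewrite leeNr oppe0; exact: G0.
by rewrite gee0_abs//; apply: integral_ge0 => x Dx; rewrite leeNr oppe0; exact: G0.
Qed.

Variables (Omega : set 'rV[R]_3) (a r : R) (u : 'rV[R]_3 -> 'rV[R]_3).
Hypotheses (openO : open Omega) (a_gt0 : 0 < a).
Hypothesis ballO : closure (eball a) `<=` Omega.
Hypotheses (hu : Ck 1 (Omega `\ 0) u).
Hypothesis hdiv : forall x, (Omega `\ 0) x -> divergence u x = 0.
Hypotheses (r_gt0 : 0 < r) (r_lt_a : 4 * r ^+ 2 < a ^+ 2).

(** On the part of the entry set where the normal component does not vanish it is
    negative, so that the absolute value of the surface integral is the integral
    of the inflow, and [tube_flux] applies. *)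
Lemma entry_flux_le : exists v : 'I_3 -> R3 R -> R,
  [/\ forall j, cc (v j),
      forall j p, r ^+ 2 / 2 <= nsq p <= a ^+ 2 -> v j p = u (vec3 p) ord0 j &
      (`| sphere_integral a
            (entry_set Omega u a r `&` [set eta | dot (u eta) (nhat eta) != 0%R])
            (fun eta => dot (u eta) (nhat eta)) | <=
       (J (fun p => 2 * `|radial v p| * inner r (nsq p)))%:E)%E].
Proof.
have [v [dv [v_cc dv_cc v_pd vu v_div]]] := cutoff_field openO a_gt0 ballO hu r_gt0 hdiv.
exists v; split=> //.
have ra : r < a.
  rewrite ltNge; apply/negP => ar.
  have : a ^+ 2 <= r ^+ 2 by rewrite lerXn2r ?nnegrE// ltW.
  by have := r_lt_a; have : 0 < r ^+ 2 := exprn_gt0 2 r_gt0; lra.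
have [K [K0 vK]] : exists K, 0 < K /\ forall i p, `|v i p| <= K.
  have [K0 [K00 H0]] := cc_bounded (v_cc i0); have [K1 [K10 H1]] := cc_bounded (v_cc i1).
  have [K2 [K20 H2]] := cc_bounded (v_cc i2); exists (K0 + K1 + K2); split; first lra.
  move=> i p; have := H0 p; have := H1 p; have := H2 p.
  by have [->|[->|->]] := I3P i; lra.
have [L [L0 vL]] : exists L, 0 < L /\ forall i p (q : R3 R), `|v i p - v i q| <= L * `|p - q|.
  have H i := cc_lipschitz (v_pd i) (dv_cc i).
  have [L0 [L00 H0]] := H i0; have [L1 [L10 H1]] := H i1; have [L2 [L20 H2]] := H i2.
  exists (L0 + L1 + L2); split; first lra.
  move=> i p q; have := H0 p q; have := H1 p q; have := H2 p q.
  have := mulr_ge0 (ltW L00) (normr_ge0 (p - q)); have := mulr_ge0 (ltW L10) (normr_ge0 (p - q)).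
  have := mulr_ge0 (ltW L20) (normr_ge0 (p - q)).
  by have [->|[->|->]] := I3P i; rewrite !mulrDl; lra.
set A := _ `&` _; set f := fun eta => _.
have captured_of q : A (sph a q) -> captured v a r q.
  by move=> [Eq nz]; apply: (entry_captured a_gt0 r_gt0 ra v_cc K0 vK L0 vL vu Eq nz).
have fE q : f (sph a q) = a^-1 * radial v (sphere_point a q).
  by apply: (dot_nhat a_gt0 r_gt0 ra vu); exact: nsq_sphere_point.
have sin0 (q : R * R) : angles q -> 0 <= sin q.1.
  by move=> [/=]; rewrite in_itv/= => qpi _; exact: sin_ge0_pi.
have GE q : f (sph a q) * (a ^+ 2 * sin q.1) = a * radial v (sphere_point a q) * sin q.1.
  by rewrite fE; field; rewrite gt_eqF.
rewrite /sphere_integral abse_integral_npos; last first.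
  move=> q [qA /captured_of[rad _]]; rewrite GE lee_fin.
  apply: mulr_le0_ge0; last exact: sin0.
  by apply: mulr_ge0_le0; exact: ltW.
rewrite integral_mkcondr.
apply: (tube_flux v_cc dv_cc v_pd r_gt0 r_lt_a a_gt0 _ K0 vK L0 vL).
- move=> p /andP[p1 p2]; apply: v_div; rewrite p2 andbT.
  by apply: le_trans p1; have := sqr_ge0 r; lra.
- move=> q qA; rewrite patchE; case: ifPn => // /set_mem/captured_of[rad _].
  rewrite GE -EFinN lee_fin -mulNr -mulrN.
  by apply: mulr_ge0; [apply: mulr_ge0; [exact: ltW|rewrite oppr_ge0 ltW]|exact: sin0].
- move=> q qA; rewrite patchE max_l; last exact: sin0.
  case: ifPn => [/set_mem/captured_of[rad _]|_].
    rewrite GE -EFinN lee_fin -mulNr -mulrN; apply: ler_wpM2r; first exact: sin0.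
    by apply: ler_wpM2l; [exact: ltW|rewrite /inflow le_max lexx].
  rewrite lee_fin; apply: mulr_ge0; last exact: sin0.
  by apply: mulr_ge0; [exact: ltW|exact: inflow_ge0].
- move=> q qA; rewrite patchE; case: ifPn => [/set_mem/captured_of//|_].
  by rewrite eqxx.
Qed.

End flux_bound.

(** * Energy in dyadic shells *)

Section energy.
Context {R : realType}.

Lemma inner_eq0 (r t : R) : 0 < r -> ~~ (r ^+ 2 < t < 4 * r ^+ 2) -> inner r t = 0.
Proof.
move=> r0; have w0 : 0 < 3 * r ^+ 2 by rewrite mulr_gt0// exprn_gt0.
rewrite negb_and -!leNgt => /orP[H|H]; first by rewrite /inner dramp0l.
by rewrite /inner dramp0r//; lra.
Qed.

Lemma inner_le (r t : R) : 0 < r -> 3 * r ^+ 2 / 2 * inner r t <= 1.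
Proof.
move=> r0; have r2 : 0 < r ^+ 2 by rewrite exprn_gt0.
rewrite /inner /dramp; set h := hat _; have h2 : h <= 2 by exact: hat_le2.
have -> : 3 * r ^+ 2 / 2 * ((3 * r ^+ 2)^-1 * h) = h / 2 by field; rewrite gt_eqF.
lra.
Qed.

Lemma inner_ge0 (r t : R) : 0 <= inner r t.
Proof. by apply: dramp_ge0; apply: mulr_ge0 => //; exact: sqr_ge0. Qed.

(** Young's inequality [2 * |x.v| <= lam * |v|^2 + |x|^2 / lam] under the integral.
    The last term contributes at most [512 / 3 * r ^+ 3 / lam], and [lam], of order
    [r] to the power 5/2, is chosen to make this [C / 2 * Num.sqrt r]. *)
Lemma flux_energy (v : 'I_3 -> R3 R -> R) (r C : R) : (forall j, cc (v j)) ->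
  0 < r -> 0 < C ->
  C * Num.sqrt r <= J (fun p => 2 * `|radial v p| * inner r (nsq p)) ->
  9 * C ^+ 2 / 4096 <=
    J (fun p => 3 * r ^+ 2 / 2 * inner r (nsq p) * \sum_i v i p ^+ 2).
Proof.
move=> v_cc r0 C0 flux.
have r2 : 0 < r ^+ 2 by rewrite exprn_gt0.
set s := Num.sqrt r in flux; have s0 : 0 < s by rewrite sqrtr_gt0.
have ss : s ^+ 2 = r by rewrite sqr_sqrtr// ltW.
have ci : cc (fun p : R3 R => inner r (nsq p)) by exact: cc_inner.
have cn := @continuous_nsq R.
have cv : continuous (fun p => \sum_i v i p ^+ 2).
  have -> : (fun p => \sum_i v i p ^+ 2) = (fun p => v i0 p ^+ 2 + v i1 p ^+ 2 + v i2 p ^+ 2).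
    by apply/funext => p; rewrite sum3.
  have [c0 _] := v_cc i0; have [c1 _] := v_cc i1; have [c2 _] := v_cc i2.
  by continuity.
have cr : continuous (radial v) by have [] := cc_radial v_cc.
pose E (p : R3 R) := inner r (nsq p) * \sum_i v i p ^+ 2.
pose N (p : R3 R) := inner r (nsq p) * nsq p.
have cE : cc E by exact: ccM.
have cN : cc N by exact: ccM.
pose lam := 1024 / (3 * C) * (r ^+ 2 * s).
have lam0 : 0 < lam.
  have n0 : (0 : R) < 1024 by rewrite ltr0n.
  by apply: mulr_gt0; [apply: divr_gt0; [exact: n0|exact: mulr_gt0]|exact: mulr_gt0].
have JN_le : J N <= 8 / 3 * (4 * r) ^+ 3.
  apply: le_trans (ler_norm _) _.
  have -> : 4 * r = (2 * r) *+ 2 by ring.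
  apply: (@J_bound R N (2 * r) (8 / 3)) => //; first by apply: mulr_ge0 => //; exact: ltW.
    move=> p rp; rewrite /N inner_eq0 ?mul0r// negb_and -!leNgt; apply/orP; right.
    apply: le_trans (sqr_norm_le p); have -> : 4 * r ^+ 2 = (2 * r) ^+ 2 by ring.
    by rewrite lerXn2r ?nnegrE ?mulr_ge0// ltW.
  move=> p; rewrite ger0_norm; last by apply: mulr_ge0; [exact: inner_ge0|exact: nsq_ge0].
  have [/andP[_ np]|H] := boolP (r ^+ 2 < nsq p < 4 * r ^+ 2); last first.
    by rewrite /N inner_eq0// mul0r divr_ge0.
  apply: (@le_trans _ _ (inner r (nsq p) * (4 * r ^+ 2))).
    by apply: ler_wpM2l; [exact: inner_ge0|exact: ltW].
  by have := inner_le (nsq p) r0; lra.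
have young p : 2 * `|radial v p| * inner r (nsq p) <= lam * E p + lam^-1 * N p.
  have -> : lam * E p + lam^-1 * N p =
    (lam * (\sum_i v i p ^+ 2) + lam^-1 * nsq p) * inner r (nsq p) by rewrite /E /N; ring.
  apply: ler_wpM2r; first exact: inner_ge0.
  have sq (x y : R) : 2 * (x * y) <= lam * y ^+ 2 + lam^-1 * x ^+ 2 /\
      - (2 * (x * y)) <= lam * y ^+ 2 + lam^-1 * x ^+ 2.
    have h e : e ^+ 2 = 1 -> 0 <= lam * y ^+ 2 + lam^-1 * x ^+ 2 - e * (2 * (x * y)).
      move=> e1; have -> : lam * y ^+ 2 + lam^-1 * x ^+ 2 - e * (2 * (x * y)) =
        lam * (y - e * lam^-1 * x) ^+ 2 + (1 - e ^+ 2) * (lam^-1 * x ^+ 2).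
        by field; rewrite gt_eqF.
      by rewrite e1 subrr mul0r addr0; apply: mulr_ge0; [exact: ltW|exact: sqr_ge0].
    have N1 : (- 1 : R) ^+ 2 = 1 by rewrite sqrrN expr1n.
    by have := h 1 (expr1n _ 2); have := h (- 1) N1; lra.
  have [p0 n0] := sq (crd i0 p) (v i0 p); have [p1 n1] := sq (crd i1 p) (v i1 p).
  have [p2 n2] := sq (crd i2 p) (v i2 p).
  by rewrite /radial /nsq !sum3; case: (ler0P (crd i0 p * v i0 p + crd i1 p * v i1 p + crd i2 p * v i2 p)) => _; lra.
have J1 : C * s <= lam * J E + lam^-1 * J N.
  apply: le_trans flux _; rewrite -JZ// -[lam^-1 * J N]JZ// -JD; [|exact: ccZ|exact: ccZ].
  apply: J_le => //; last by apply: ccD; exact: ccZ.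
  have cg : continuous (fun p => 2 * `|radial v p|) by continuity.
  have := ccM ci cg; congr cc; apply/funext => p; exact: mulrC.
have -> : J (fun p => 3 * r ^+ 2 / 2 * inner r (nsq p) * \sum_i v i p ^+ 2) = 3 * r ^+ 2 / 2 * J E.
  by rewrite -JZ//; congr J; apply/funext => p; rewrite /E mulrA.
have J2 : lam^-1 * J N <= C / 2 * s.
  have -> : C / 2 * s = lam^-1 * (8 / 3 * (4 * r) ^+ 3).
    by rewrite /lam -ss; field; rewrite !gt_eqF.
  by apply: ler_wpM2l => //; rewrite invr_ge0 ltW.
have J3 : C / 2 * s <= lam * J E by lra.
have -> : 9 * C ^+ 2 / 4096 = 3 * r ^+ 2 / 2 * (lam^-1 * (C / 2 * s)).
  by rewrite /lam; field; rewrite !gt_eqF.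
apply: ler_wpM2l; first by rewrite divr_ge0// mulr_ge0// ltW.
by rewrite [lam^-1 * _]mulrC ler_pdivrMr// [J E * _]mulrC.
Qed.

(** The shells for the radii [r0 / 2 ^+ N] are disjoint, so that the sum of their
    profiles is still dominated by [|u|^2]. *)
Lemma shells_energy (u : 'rV[R]_3 -> 'rV[R]_3) (a r0 c0 : R) :
  0 < r0 -> 4 * r0 ^+ 2 < a ^+ 2 ->
  (forall r, 0 < r <= r0 -> exists f : R3 R -> R,
     [/\ cc f, forall p, 0 <= f p <= enorm (u (vec3 p)) ^+ 2,
         forall p, f p != 0 -> r ^+ 2 < nsq p < 4 * r ^+ 2 & c0 <= J f]) ->
  forall N, exists f : R3 R -> R,
     [/\ cc f, forall p, 0 <= f p <= enorm (u (vec3 p)) ^+ 2,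
         forall p, f p != 0 -> 4 * (r0 / 2 ^+ N) ^+ 2 <= nsq p <= a ^+ 2 & c0 *+ N <= J f].
Proof.
move=> r00 r0a shell; elim=> [|N [f [cf fu fs Jf]]].
  exists (fun=> 0); split.
  - by split; [exact: continuous_cst_all|exists 0].
  - by move=> p; rewrite lexx sqr_ge0.
  - by move=> p; rewrite eqxx.
  - by apply: J_ge0.
pose r := r0 / 2 ^+ N.
have r_gt0 : 0 < r by rewrite divr_gt0// exprn_gt0.
have r_le : r <= r0.
  by rewrite ler_pdivrMr ?exprn_gt0// ler_peMr ?exprn_ege1 ?ler1n// ltW.
have r2 : r ^+ 2 <= r0 ^+ 2 by rewrite lerXn2r ?nnegrE// ltW.
have [g [cg gu gs Jg]] := shell r (introT andP (conj r_gt0 r_le)).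
have E : 4 * (r0 / 2 ^+ N.+1) ^+ 2 = r ^+ 2.
  have : (2 : R) ^+ N != 0 by rewrite expf_neq0.
  by rewrite /r (exprS 2 N); move: ((2 : R) ^+ N) => x x0; field.
have fg p : g p != 0 -> f p = 0.
  move=> /gs /andP[_ H]; apply/eqP/negPn/negP => /fs; rewrite -/r; move: H; lra.
exists (fun p => f p + g p); split.
- exact: ccD.
- move=> p; have [g0|/fg ->] := eqVneq (g p) 0; first by rewrite g0 addr0.
  by rewrite add0r.
- move=> p; rewrite E; have [->|g0 _] := eqVneq (g p) 0.
    by rewrite addr0 => /fs; rewrite -/r => /andP[H1 ->]; rewrite andbT; have := sqr_ge0 r; lra.
  by have /andP[H1 H2] := gs p g0; lra.
- by rewrite mulrSr JD//; exact: lerD.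
Qed.

End energy.

Theorem theorem2p5 (R : realType) (Omega : set 'rV[R]_3)
    (u : 'rV[R]_3 -> 'rV[R]_3) (alpha C epsilon : R)
    (hOmega : smooth_domain Omega) (hOmega0 : Omega 0)
    (hu : Ck 1 (Omega `\ 0) u)
    (hdiv : forall x, (Omega `\ 0) x -> divergence u x = 0)
    (halpha : 0 < alpha) (hball : closure (eball alpha) `<=` Omega)
    (hC : 0 < C) (hepsilon : 0 < epsilon < alpha)
    (hflux : forall r : R, 0 < r <= epsilon ->
      ((C * Num.sqrt r)%:E <=
       `| sphere_integral alpha
            (entry_set Omega u alpha r `&` [set eta | dot (u eta) (nhat eta) != 0%R])
            (fun eta => dot (u eta) (nhat eta)) |)%E) :
  integral3 Omega (fun x => (enorm (u x) ^+ 2)%:E) = +oo%E.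
Proof.
have [openO _ _] := hOmega; have /andP[eps0 _] := hepsilon.
pose r0 := Num.min epsilon (alpha / 4).
have r00 : 0 < r0 by rewrite lt_min eps0 divr_gt0.
have r0a : 4 * r0 ^+ 2 < alpha ^+ 2.
  have r04 : r0 <= alpha / 4 by rewrite ge_min lexx orbT.
  have : r0 ^+ 2 <= (alpha / 4) ^+ 2 by rewrite lerXn2r ?nnegrE ?divr_ge0// ltW.
  have -> : (alpha / 4) ^+ 2 = alpha ^+ 2 / 16 by field.
  by have : 0 < alpha ^+ 2 := exprn_gt0 2 halpha; lra.
pose c0 := 9 * C ^+ 2 / 4096.
have c00 : 0 < c0.
  have n0 : (0 : R) < 4096 by rewrite ltr0n.
  by apply: divr_gt0 n0; apply: mulr_gt0 => //; exact: exprn_gt0.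
have shell r : 0 < r <= r0 -> exists f : R3 R -> R,
     [/\ cc f, forall p, 0 <= f p <= enorm (u (vec3 p)) ^+ 2,
         forall p, f p != 0 -> r ^+ 2 < nsq p < 4 * r ^+ 2 & c0 <= J f].
  move=> /andP[r_gt0 rr0].
  have r2 : 0 < r ^+ 2 by rewrite exprn_gt0.
  have ra : 4 * r ^+ 2 < alpha ^+ 2.
    have : r ^+ 2 <= r0 ^+ 2 by rewrite lerXn2r ?nnegrE// ltW.
    by lra.
  have [v [v_cc vu flux]] := entry_flux_le openO halpha hball hu hdiv r_gt0 ra.
  have reps : 0 < r <= epsilon by rewrite r_gt0 (le_trans rr0)// ge_min lexx.
  have := le_trans (hflux r reps) flux; rewrite lee_fin => /(flux_energy v_cc r_gt0 hC) Jc.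
  exists (fun p => 3 * r ^+ 2 / 2 * inner r (nsq p) * \sum_i v i p ^+ 2); split=> //.
  - apply: ccM; first by apply: ccZ; exact: cc_inner.
    have -> : (fun p => \sum_i v i p ^+ 2) = (fun p => v i0 p ^+ 2 + v i1 p ^+ 2 + v i2 p ^+ 2).
      by apply/funext => p; rewrite sum3.
    have [d0 _] := v_cc i0; have [d1 _] := v_cc i1; have [d2 _] := v_cc i2.
    by continuity.
  - move=> p; have [H|H] := boolP (r ^+ 2 < nsq p < 4 * r ^+ 2); last first.
      by rewrite inner_eq0// mulr0 mul0r lexx sqr_ge0.
    have -> : enorm (u (vec3 p)) ^+ 2 = \sum_i v i p ^+ 2.
      rewrite /enorm sqr_sqrtr; last by apply: sumr_ge0 => i _; rewrite -expr2 sqr_ge0.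
      apply: eq_bigr => i _; rewrite vu ?expr2//.
      by have /andP[H1 H2] := H; lra.
    have s0 : 0 <= \sum_i v i p ^+ 2 by apply: sumr_ge0 => i _; exact: sqr_ge0.
    apply/andP; split.
      apply: mulr_ge0 => //; apply: mulr_ge0; last exact: inner_ge0.
      by rewrite divr_ge0// mulr_ge0// ltW.
    by rewrite -[leRHS]mul1r; apply: ler_wpM2r => //; exact: inner_le.
  - move=> p; apply: contraNT => H; rewrite inner_eq0//; apply/eqP; ring.
apply: eq_infty => A.
pose N := (Num.truncn (A / c0)).+1.
have AN : A <= c0 *+ N.
  by rewrite -mulr_natl -ler_pdivrMr// ltW// truncnS_gt.
have [f [cf fu fs Jf]] := shells_energy r00 r0a shell N.
apply: (@le_trans _ _ (J f)%:E); first by rewrite lee_fin (le_trans AN).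
rewrite J_EFin// /integral3.
apply: (@le_trans _ _ (\int[mu3]_(p in @vec3 R @^-1` Omega) (f p)%:E)%E); last first.
  by apply: le_integral_lower => p _; rewrite lee_fin; have /andP[] := fu p.
rewrite [leRHS]integral_mkcond; apply: le_integral_lower => p _.
  by rewrite lee_fin; have /andP[] := fu p.
rewrite patchE; case: ifPn => // /negP nO.
have [->//|/fs/andP[_ pa]] := eqVneq (f p) 0.
by case: nO; apply/mem_set/hball; exact: closed_ball_closure.
Qed.
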